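(* Let $\lambda=\lambda(d)>0$ be any function with $\lambda(d)\, d^{1/4}(\log d)^{-3/4}\to\infty$ as $d\to\infty$. Then there is a function $\varepsilon(d)\to 0$ (as $d\to\infty$) such that for all (sufficiently large) $d$, every positive integer $M$, and every odd vertex $v_0\in\Lambda_M$, $$\mu_M^e(v_0\in\mathbf I)<(1+\lambda)^{-(2-\varepsilon(d))d}.$$ The same holds with the roles of even and odd reversed, i.e. $\mu_M^o(v_0\in\mathbf I)<(1+\lambda)^{-(2-\varepsilon(d))d}$ for every even vertex $v_0\in\Lambda_M$.
   Context: Work in the nearest-neighbor graph on $\mathbb{Z}^d$. A vertex $x\in\mathbb{Z}^d$ is even if $\sum_i x_i$ is even and odd otherwise; $\mathcal E$, $\mathcal O$ denote the sets of even and odd vertices. Let $\Lambda_M=\{z\in\mathbb{Z}^d:\|z\|_\infty\le M\}$ and $\partial\Lambda_M=\{z\in\mathbb{Z}^d:\|z\|_\infty=M\}$. Let $\mu_M$ be the hard-core measure with activity $\lambda$ on the subgraph induced by $\Lambda_M$: a random independent set $\mathbf I$ of this graph with $\Pr(\mathbf I=I)\propto\lambda^{|I|}$. Let $\mu_M^e$ be $\mu_M$ conditioned on the event $\{\mathbf I\supseteq\partial\Lambda_M\cap\mathcal E\}$ and $\mu_M^o$ be $\mu_M$ conditioned on $\{\mathbf I\supseteq\partial\Lambda_M\cap\mathcal O\}$. *)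

(* Defs.v *)
From HB Require Import structures.
From mathcomp Require Import all_boot all_order all_algebra.
From mathcomp Require Import all_classical all_reals all_analysis.

Set Implicit Arguments.
Unset Strict Implicit.
Unset Printing Implicit Defensive.

Import Order.TTheory GRing.Theory Num.Theory.
Import numFieldNormedType.Exports.

Local Open Scope ring_scope.

Section HardCore.
Variables (R : realType) (T : finType) (e : rel T).
Implicit Types (I : {set T}) (A B : {set {set T}}).

Definition independent I : bool :=
  [forall x in I, forall y in I, ~~ e x y].

Definition hc_partition (lam : R) : R :=
  \sum_(I : {set T} | independent I) lam ^+ #|I|.

Definition hc_mass (lam : R) I : R :=
  if independent I then lam ^+ #|I| / hc_partition lam else 0.

Definition hc_prob (lam : R) A : R := \sum_(I in A) hc_mass lam I.

Definition hc_cond_prob (lam : R) A B : R :=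
  hc_prob lam (A :&: B) / hc_prob lam B.

End HardCore.

Notation lattice d := {ffun 'I_d -> int}.

Definition lattice_adj d (x y : lattice d) : bool :=
  \sum_(i < d) `|x i - y i| == 1.

Definition even_vertex d (x : lattice d) : bool := (2 %| \sum_(i < d) x i)%Z.

Definition odd_vertex d (x : lattice d) : bool := ~~ even_vertex x.

Definition sup_norm d (x : lattice d) : nat := \max_(i < d) absz (x i).

Record box (d M : nat) := Box {
  box_val :> lattice d;
  box_valP : (sup_norm box_val <= M)%N
}.
HB.instance Definition _ d M := [isSub for @box_val d M].
HB.instance Definition _ d M := [Countable of box d M by <:].

(* [box d M] is finite: shifting every coordinate by [M] encodes its elements
   as functions into ['I_(2 * M).+1]. *)
Definition box_encode d M (x : box d M) : {ffun 'I_d -> 'I_(2 * M).+1} :=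
  [ffun i => inord (absz (x i + M%:Z))].

Definition box_decode d M (f : {ffun 'I_d -> 'I_(2 * M).+1}) :
  option (box d M) :=
  insub ([ffun i => (f i : nat)%:Z - M%:Z] : lattice d).

Lemma box_encodeK d M : pcancel (@box_encode d M) (@box_decode d M).
Proof.
move=> x; rewrite /box_decode.
suff -> : [ffun i => (box_encode x i : nat)%:Z - M%:Z] = x :> lattice d.
  exact: (@valK _ _ (box d M) x).
apply/ffunP => i; rewrite !ffunE.
have xi : (absz (x i) <= M)%N.
  exact: leq_trans (leq_bigmax (F := fun i => absz (x i)) i) (box_valP x).
have : - M%:Z <= x i <= M%:Z by rewrite -ler_norml.
case/andP => l u.
have p : 0 <= x i + M%:Z by rewrite -lerBlDr sub0r.
rewrite inordK ?gez0_abs ?addrK //.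
by rewrite ltnS -lez_nat gez0_abs // mulSn mul1n PoszD lerD2r.
Qed.

HB.instance Definition _ d M : fintype.isFinite (box d M) :=
  PCanIsFinite (@box_encodeK d M).

Section BoxMeasures.
Variables (R : realType) (d M : nat).

Definition box_adj : rel (box d M) := fun x y => lattice_adj x y.

Definition boundary : {set box d M} := [set x : box d M | sup_norm x == M].

Definition even_box : {set box d M} := [set x : box d M | even_vertex x].

Definition odd_box : {set box d M} := [set x : box d M | odd_vertex x].

Definition occupied (v : box d M) : {set {set box d M}} :=
  [set I : {set box d M} | v \in I].

Definition contains (S : {set box d M}) : {set {set box d M}} :=
  [set I : {set box d M} | S \subset I].

Definition mu_even (lam : R) (A : {set {set box d M}}) : R :=
  hc_cond_prob box_adj lam A (contains (boundary :&: even_box)).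

Definition mu_odd (lam : R) (A : {set {set box d M}}) : R :=
  hc_cond_prob box_adj lam A (contains (boundary :&: odd_box)).

End BoxMeasures.

(* Main.v *)
(** A Peierls argument.  Say [v0] is odd and occupied, and the even boundary
    vertices are occupied.  Let [A] be the set of odd particles joined to [v0]
    by steps of length two through odd particles, and let [W] be [A] with its
    neighbours and everything they separate from the boundary.  Every edge
    leaving [W] joins a vacant even vertex of [W] to a vacant odd vertex, and
    the thickness [t], the number of even minus the number of odd vertices of
    [W], is the number of these edges divided by [2d]; it is at least [2d - 1].
    Translating the particles of [W] by a unit vector frees [t] even vertices,
    so for a given [W] the probability is at most [(1 + lambda) ^ (-t)].

    It remains to sum over [W]. If [t] is small, isoperimetry makes the odd
    part of [W] much smaller than [t], and [W] is encoded by a walk through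
    it. If [t] is large, the vertices with many boundary edges are covered
    by the neighbourhoods of a small set of vertices. Every component of the
    uncovered set lies essentially on one side of the boundary, and the
    large components are few; recording the cover and the large components
    inside [W] gives sets [F] and [S] close to the even and the odd part of
    [W], which two greedy passes of Sapozhenko bring closer still. If [F]
    misses many even vertices of [W], the translation can be carried out
    knowing [F] and [S] only, with a gain; if it misses few, these are
    recorded too and [W] is known. With [q] about [d ^ (1 / 160)], all these
    codes cost at most a fraction [1 / q] of the gain, since [lambda >= d ^
    (- 1 / 4)] implies [(1 + lambda) ^ (q ^ 44) >= 2]. *)

Require Import Defs.
From HB Require Import structures.
From mathcomp Require Import all_boot.
From mathcomp Require Import zify.

Set Implicit Arguments.
Unset Strict Implicit.
Unset Printing Implicit Defensive.

(** * Finite lattice graphs *)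

(** The obstacle is entropy. A bit of code has to be paid with [q ^ 44] units of the exponent, so a
    region of thickness [t] can afford only about [t / q ^ 44] bits, while its boundary consists of
    [2 * d * t] edges and cannot be listed. A step of a walk costs about [q] bits; hence only sets
    of fewer than about [t / q ^ 46] vertices can be recorded, and everything else must be an
    approximation computed from such sets. The price is that the translation no longer knows where
    all particles came from. The missing information is added to the image of the map, and the gain
    becomes a difference of two sizes. The two ranges of [t] have different accounts. Near the
    minimum [2 * d - 1] only a fraction [1 / q] of [t] may be spent. From [2 ^ q] on, an exponent
    [2 * d], more than the theorem demands, is negligible against [t], so that a gain of
    [t / (2 * q ^ 50)] suffices. The box is placed in a torus of side [2 * M + 2]: all vertices then
    have the same degree and translations are bijections. The additional layer carries no
    particles. *)

(* [sh e x] is [x + e] for a unit step [e], and [op e] is [- e]; [par] is true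
   on the parity class of the vertex whose occupation is estimated. *)
Record lattice_graph := LatticeGraph {
  pt :> finType;
  dir : finType;
  sh : dir -> pt -> pt;
  op : dir -> dir;
  par : pt -> bool;
  sh_comm : forall e f x, sh e (sh f x) = sh f (sh e x);
  shK : forall e, cancel (sh e) (sh (op e));
  opK : involutive op;
  par_sh : forall e x, par (sh e x) = ~~ par x;
  sh_injl : forall x e f, sh e x = sh f x -> e = f
}.

Arguments sh : simpl never.
Arguments op : simpl never.
Arguments par : simpl never.

Section Neighbours.
Variable L : lattice_graph.
Implicit Types (x y z v : L) (e f s : dir L) (X Y : {set L}).

(** Locking keeps [inE] from unfolding membership in a neighbourhood. *)
Fact nb_key : unit. Proof. exact: tt. Qed.
Definition nb X : {set L} :=
  locked_with nb_key [set y | [exists e, sh e y \in X]].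

Lemma shKV e : cancel (sh (op e)) (@sh L e).
Proof. by move=> x; rewrite -{1}(opK e) shK. Qed.

Lemma nbP X y : reflect (exists e, sh e y \in X) (y \in nb X).
Proof. by rewrite /nb locked_withE inE; apply: existsP. Qed.

Lemma nb_sh X e x : x \in X -> sh e x \in nb X.
Proof. by move=> xX; apply/nbP; exists (op e); rewrite shK. Qed.

Lemma nb_bigcup X : nb X = \bigcup_(x in X) nb [set x].
Proof.
apply/setP => y; apply/nbP/bigcupP => [[e eX]|[x xX /nbP[e]]].
  by exists (sh e y) => //; apply/nbP; exists e; rewrite inE.
by rewrite inE => /eqP ex; exists e; rewrite ex.
Qed.

Lemma card_dirs x X :
  #|[set e | sh e x \in X]| = #|nb [set x] :&: X|.
Proof.
rewrite -(card_imset _ (fun e f => @sh_injl L x e f)); apply: eq_card => y.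
apply/imsetP/setIP => [[e]|[/nbP[e]]]; rewrite inE.
  by move=> eX ->; split=> //; apply: nb_sh; rewrite inE.
by move/eqP=> <- yX; exists (op e); rewrite ?inE shK.
Qed.

Lemma card_nb1 x : #|nb [set x]| = #|dir L|.
Proof.
rewrite -[nb _]setIT -card_dirs -cardsT; apply: eq_card => e.
by rewrite !inE.
Qed.

Lemma card_bigcup_le (I : finType) (P : pred I) (F : I -> {set L}) :
  #|\bigcup_(i | P i) F i| <= \sum_(i | P i) #|F i|.
Proof.
elim/big_rec2: _ => [|i m A _ le]; first by rewrite cards0.
by rewrite (leq_trans (leq_card_setU _ _)) // leq_add2l.
Qed.

Lemma card_nb X : #|nb X| <= #|dir L| * #|X|.
Proof.
rewrite nb_bigcup (leq_trans (card_bigcup_le _ _)) //.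
rewrite (eq_bigr (fun=> #|dir L|)) => [|x _]; last exact: card_nb1.
by rewrite sum_nat_const mulnC.
Qed.

(** Double counting of the edges between [X] and [Y]; reversing an oriented edge is an
    involution. *)
Lemma sum_dirs X Y :
  \sum_(x in X) #|[set e | sh e x \in Y]|
    = \sum_(y in Y) #|[set e | sh e y \in X]|.
Proof.
have E A B : \sum_(x in A) #|[set e | sh e x \in B]|
    = #|[set p : L * dir L | (p.1 \in A) && (sh p.2 p.1 \in B)]|.
  transitivity (\sum_(x in A) \sum_(e | sh e x \in B) 1).
    by apply: eq_bigr => x _; rewrite -sum1_card; apply: eq_bigl => e; rewrite inE.
  by rewrite pair_big_dep -sum1_card; apply: eq_bigl => p; rewrite inE.
rewrite !E.
pose g (p : L * dir L) := (sh p.2 p.1, op p.2).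
have gK : involutive g by case=> x e; rewrite /g /= shK opK.
rewrite -(card_imset _ (inv_inj gK)); apply: eq_card => p.
rewrite -{1}(gK p) (mem_imset _ _ (inv_inj gK)) !inE andbC /=.
by rewrite shK.
Qed.

Fixpoint walk (w : seq (dir L)) x := if w is e :: w' then walk w' (sh e x) else x.

Fixpoint visits (w : seq (dir L)) x :=
  x :: (if w is e :: w' then visits w' (sh e x) else [::]).

Lemma walk_cat p q x : walk (p ++ q) x = walk q (walk p x).
Proof. by elim: p x => //= e p IH x; rewrite IH. Qed.

Lemma size_visits w x : size (visits w x) = (size w).+1.
Proof. by elim: w x => //= e w IH x; rewrite IH. Qed.

Lemma mem_visits_cat p q x y :
  (y \in visits (p ++ q) x) = (y \in visits p x) || (y \in visits q (walk p x)).
Proof.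
elim: p x => /= [|e p IH] x; last by rewrite !inE IH orbA.
by case: q => [|? ?] /=; rewrite !inE ?orbF ?orbA ?orbb.
Qed.

Lemma visitsP w x y :
  reflect (exists p q, w = p ++ q /\ walk p x = y) (y \in visits w x).
Proof.
apply: (iffP idP) => [|[p [q [-> <-]]]].
  elim: w x => /= [|e w IH] x; rewrite !inE.
    by move/eqP->; exists [::], [::].
  case/orP => [/eqP->|/IH[p [q [-> <-]]]]; first by exists [::], (e :: w).
  by exists (e :: p), q.
rewrite mem_visits_cat orbC; case: q => [|? ?] /=; by rewrite inE eqxx.
Qed.

Definition back (p : seq (dir L)) := rev (map (@op L) p).

Lemma walk_back p x : walk (back p) (walk p x) = x.
Proof.
elim: p x => //= e p IH x.
by rewrite /back /= rev_cons -cats1 walk_cat -/(back p) IH /= shK.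
Qed.

Lemma size_back p : size (back p) = size p.
Proof. by rewrite size_rev size_map. Qed.

Definition near r x y := exists2 p, size p <= r & walk p x = y.

Lemma near0 x : near 0 x x. Proof. by exists [::]. Qed.

Lemma near_le r r' x y : r <= r' -> near r x y -> near r' x y.
Proof. by move=> le [p sp <-]; exists p; first exact: leq_trans le. Qed.

Lemma near_sh e x : near 1 x (sh e x). Proof. by exists [:: e]. Qed.

Lemma near_sym r x y : near r x y -> near r y x.
Proof. by case=> p sp <-; exists (back p); rewrite ?size_back ?walk_back. Qed.

Lemma near_trans r r' x y z : near r x y -> near r' y z -> near (r + r') x z.
Proof.
case=> p sp <- [q sq <-]; exists (p ++ q); last exact: walk_cat.
by rewrite size_cat leq_add.
Qed.

Lemma near_nb X y : y \in nb X -> exists2 x, x \in X & near 1 y x.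
Proof. by case/nbP=> e eX; exists (sh e y) => //; apply: near_sh. Qed.

(** Connectivity under jumps of length at most [r], phrased by cuts: a partial traversal that misses
    a vertex can always be extended. *)
Definition linked r X x0 :=
  forall Y, x0 \in Y -> Y \proper X ->
    exists x z, [/\ x \in Y, z \in X :\: Y & near r x z].

(* A depth-first traversal: each new vertex costs an excursion of length at
   most [2 * r] from a vertex already visited. *)
Lemma linked_walk r X x0 : x0 \in X -> linked r X x0 ->
  exists2 w, size w <= 2 * r * #|X| & {subset X <= visits w x0}.
Proof.
move=> x0X lX.
suff grow n : n < #|X| -> exists (Y : {set L}) w, [/\ Y \subset X, #|Y| = n.+1, x0 \in Y,
    size w <= 2 * r * n & {subset Y <= visits w x0}].
  have X0 : 0 < #|X| by rewrite (cardD1 x0) x0X.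
  have [|Y [w [YX cY _ sw YV]]] := grow #|X|.-1; first by rewrite prednK.
  have EX : Y = X by apply/eqP; rewrite eqEcard YX cY prednK ?leqnn.
  exists w; last by rewrite -EX.
  by rewrite (leq_trans sw) // leq_mul2l leq_pred orbT.
elim: n => [_|n IH ltn].
  exists [set x0], [::]; split; rewrite ?sub1set ?cards1 ?inE //.
  by move=> y; rewrite !inE.
have [Y [w [YX cY x0Y sw YV]]] := IH (ltnW ltn).
have pYX : Y \proper X by rewrite properEcard YX cY.
have [x [z [xY /setDP[zX zY] [p sp pz]]]] := lX Y x0Y pYX.
have [w1 [w2 [ew w1x]]] := visitsP _ _ _ (YV x xY).
exists (z |: Y), (w1 ++ (p ++ back p) ++ w2); split.
- by rewrite subUset sub1set zX.
- by rewrite cardsU1 zY cY.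
- by rewrite inE x0Y orbT.
- by rewrite !size_cat size_back; move: sw; rewrite ew size_cat; nia.
move=> y; rewrite !inE !mem_visits_cat w1x !walk_cat pz.
have -> : walk (back p) z = x by rewrite -pz walk_back.
case/orP => [/eqP->|/YV]; last first.
  by rewrite ew mem_visits_cat w1x => /orP[]->; rewrite ?orbT.
suff -> : z \in visits p x by rewrite orbT.
by apply/visitsP; exists p, [::]; rewrite cats0.
Qed.

(** Padding the walk to a prescribed length puts it in a finite type of known cardinality. *)
Lemma linked_tuple r n X x0 : 0 < #|dir L| -> x0 \in X -> linked r X x0 ->
    2 * r * #|X| <= n ->
  exists w : n.-tuple (dir L), {subset X <= visits w x0}.
Proof.
case/card_gt0P => e _ x0X lX le.
have [w sw Xw] := linked_walk x0X lX.
have sz : size (w ++ nseq (n - size w) e) == n.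
  by rewrite size_cat size_nseq subnKC // (leq_trans sw).
by exists (Tuple sz) => y /Xw yw; rewrite mem_visits_cat yw.
Qed.

(** Once a walk is known, a set that it visits costs one bit per visit. *)
Definition selected n (w : n.-tuple (dir L)) (m : n.+1.-tuple bool) x : {set L} :=
  [set y in mask m (visits w x)].

Lemma selectedP n (w : n.-tuple (dir L)) x X : {subset X <= visits w x} ->
  exists m, X = selected w m x.
Proof.
move=> XV; have sz : size [seq y \in X | y <- visits w x] == n.+1.
  by rewrite size_map size_visits size_tuple.
exists (Tuple sz); apply/setP => y; rewrite inE /= -filter_mask mem_filter.
by apply/idP/andP => [yX|[]//]; split=> //; apply: XV.
Qed.

End Neighbours.

(** * Greedy selection and covers *)

Section Greedy.
Variables (I T : finType) (N : I -> {set T}).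

(** Take [P] of maximal size subject to the first two properties; an element of [B] that still sees
    [k] points of [X] outside the union could be added to it. *)
Lemma greedy (B : {set I}) (X : {set T}) k : 0 < k ->
  exists P : {set I}, [/\ P \subset B, k * #|P| <= #|X :&: \bigcup_(p in P) N p|
    & forall b, b \in B -> #|(N b :&: X) :\: \bigcup_(p in P) N p| < k].
Proof.
move=> k0.
pose ok (P : {set I}) := (P \subset B) && (k * #|P| <= #|X :&: \bigcup_(p in P) N p|).
have ok0 : ok set0 by rewrite /ok sub0set cards0 muln0.
case: (arg_maxnP (fun P : {set I} => #|P|) ok0) => P /andP[PB kP] maxP.
exists P; split=> // b bB; rewrite ltnNge; apply/negP => big.
have bP : b \notin P.
  apply: contraL big => bP; rewrite -ltnNge (_ : _ :\: _ = set0) ?cards0 //.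
  apply/setP => x; rewrite !inE; apply/negP => /and3P[/negP nx xb _].
  by apply: nx; apply/bigcupP; exists b.
have /maxP : ok (b |: P).
  rewrite /ok subUset sub1set bB PB cardsU1 bP mulnDr muln1 /=.
  rewrite bigcup_setU big_set1.
  set V := \bigcup_(p in P) N p in kP big *.
  apply: leq_trans (leq_add big kP) _.
  have disj : ((N b :&: X) :\: V) :&: (X :&: V) = set0.
    by apply/setP => x; rewrite !inE; case: (x \in V); rewrite ?andbF.
  rewrite -cardsUI disj cards0 addn0.
  apply: subset_leq_card; apply/subsetP => x; rewrite !inE.
  by case: (x \in N b); case: (x \in X); case: (x \in V).
by rewrite /= cardsU1 bP add1n ltnn.
Qed.

End Greedy.

Section Cover.
Variable L : lattice_graph.
Implicit Types (x y z v : L) (e f s : dir L) (X Y B U : {set L}).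

Lemma nbU X Y : nb (X :|: Y) = nb X :|: nb Y.
Proof.
apply/setP => y; rewrite in_setU; apply/nbP/orP => [[e]|[]/nbP[e eX]].
- by rewrite inE => /orP[]?; [left|right]; apply/nbP; exists e.
- by exists e; rewrite inE eX.
- by exists e; rewrite inE eX orbT.
Qed.

(* The dyadic version of the greedy bound on a cover: in round [j] the vertices
   of [B] that reach more than [#|dir L| / 2 ^ j.+1] uncovered vertices are
   used up. *)
Lemma cover_exists B phi k : 0 < phi -> #|dir L| < 2 ^ k ->
  exists U, [/\ U \subset B, phi * #|U| <= 2 * #|B| * k &
    forall v, phi <= #|[set e | sh e v \in B]| -> v \in nb U].
Proof.
move=> phi0 ltk; set D := #|dir L| in ltk *.
pose Y := [set v | phi <= #|[set e | sh e v \in B]|].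
(* After round [j] every vertex of [B] has at most [D / 2 ^ j] uncovered neighbours in [Y]; for
   [j = k] this is less than one. *)
suff stage j : exists U, [/\ U \subset B, phi * #|U| <= 2 * #|B| * j &
    forall b, b \in B -> #|nb [set b] :&: (Y :\: nb U)| * 2 ^ j <= D].
  have [U [UB cU small]] := stage k; exists U; split=> // v dv.
  apply: contraLR (dv) => vU; rewrite -ltnNge.
  suff -> : [set e | sh e v \in B] = set0 by rewrite cards0.
  apply/setP => e; rewrite !inE; apply: contraTF ltk => eB.
  rewrite -leqNgt (leq_trans _ (small _ eB)) //.
  rewrite -[leqLHS]mul1n leq_mul2r; apply/orP; right.
  apply/card_gt0P; exists v; rewrite !inE vU /= dv andbT.
  by apply/nbP; exists e; rewrite inE.
elim: j => [|j [U [UB cU small]]].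
  exists set0; rewrite sub0set cards0 muln0; split=> // b _.
  by rewrite expn0 muln1 (leq_trans (subset_leq_card (subsetIl _ _))) ?card_nb1.
set X := Y :\: nb U in small.
pose theta := (D %/ 2 ^ j.+1).+1.
have [P [PB cP rest]] := @greedy _ _ (fun b => nb [set b]) B X theta isT.
rewrite -nb_bigcup in cP rest.
exists (U :|: P); split; first by rewrite subUset UB.
  rewrite (leq_trans (leq_mul (leqnn _) (leq_card_setU U P))) // mulnDr mulnS addnC leq_add //.
  (* Each uncovered vertex of [Y] has [phi] edges to [B], each vertex of [B] at most [D / 2 ^ j]
     edges back, and each vertex of [P] accounts for more than [D / 2 ^ j.+1] of the uncovered
     vertices. So a round adds at most [2 * #|B| / phi] vertices. *)
  have cX : phi * #|X| * 2 ^ j <= #|B| * D.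
    have le : phi * #|X| <= \sum_(b in B) #|[set e | sh e b \in X]|.
      rewrite mulnC -sum_nat_const -sum_dirs leq_sum // => x.
      by rewrite inE => /andP[_]; rewrite inE.
    rewrite (leq_trans (leq_mul le (leqnn _))) // big_distrl /=.
    rewrite -sum_nat_const leq_sum // => b bB.
    by rewrite card_dirs small.
  have cP' : theta * #|P| <= #|X|.
    by rewrite (leq_trans cP) // subset_leq_card ?subsetIl.
  have th : D < theta * 2 ^ j.+1 by rewrite ltn_ceil ?expn_gt0.
  case: (posnP D) => [D0|D0]; last first.
    rewrite -(leq_pmul2r D0).
    rewrite (leq_trans (leq_mul (leqnn _) (ltnW th))) //.
    have le : phi * (theta * #|P|) * 2 ^ j <= phi * #|X| * 2 ^ j.
      by rewrite leq_mul2r leq_mul2l cP' !orbT.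
    by rewrite expnS; move: (leq_trans le cX); move: (2 ^ j) => p; lia.
  suff -> : P = set0 by rewrite cards0 muln0.
  apply: contraTeq cP => P0; rewrite -ltnNge.
  rewrite (leq_ltn_trans (subset_leq_card (subsetIr _ _))) //.
  by rewrite (leq_ltn_trans (card_nb _)) // -/D D0 mul0n muln_gt0 card_gt0 P0.
move=> b bB.
have := rest b bB; rewrite nbU ltnS leq_divRL ?expn_gt0 //.
by rewrite /X -setIDA setDDl.
Qed.

End Cover.

(** * Contours *)

Section Contour.
Variable L : lattice_graph.
Implicit Types (x y z v : L) (e f s : dir L) (X Y B U W : {set L}).

(* Edges leaving [W] go from even to odd vertices, and no vertex has all its
   edges across the boundary. *)
Definition contour W :=
  (forall v e, (v \in W) = par v -> (sh e v \in W) = (v \in W)) /\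
  (forall v, (v \in W) = ~~ par v -> exists e, (sh e v \in W) = (v \in W)).

Definition crossing W v : {set dir L} := [set e | (sh e v \in W) != (v \in W)].

Definition Aside W := [set v in W | par v].
Definition Gside W := [set v in W | ~~ par v].
Definition thickness W := #|Gside W| - #|Aside W|.

Variable W : {set L}.
Hypothesis cW : contour W.
Local Notation kk v := #|crossing W v|.
Local Notation D := #|dir L|.

Lemma crossing_loose v e : e \in crossing W v -> (v \in W) = ~~ par v.
Proof.
rewrite inE; case: (boolP (par v)) => pv; case: (boolP (v \in W)) => //= vW.
  by rewrite cW.1 ?vW ?pv ?eqxx.
by rewrite cW.1 ?(negbTE vW) ?(negbTE pv) ?eqxx.
Qed.

Lemma tight_kk0 v : (v \in W) = par v -> kk v = 0.
Proof.
move=> vW; apply: eq_card0 => e; rewrite [RHS]inE; apply/negP => /crossing_loose.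
by rewrite vW; case: (par v).
Qed.

Lemma kk_gt0 v : (0 < kk v) -> exists e, e \in crossing W v.
Proof. by case/card_gt0P => e; exists e. Qed.

Lemma crossing_op v e : e \in crossing W v -> op e \in crossing W (sh e v).
Proof. by rewrite !inE shK eq_sym. Qed.

(* In the square spanned by [s] and [e] a boundary edge in direction [s] cannot
   be alone. *)
Lemma crossing_sum v s : s \in crossing W v -> D <= kk v + kk (sh s v).
Proof.
move=> cs; rewrite -cardsT (leq_trans _ (leq_card_setU _ _)) //.
apply: subset_leq_card; apply/subsetP => e _; rewrite 3!inE.
have vl := crossing_loose cs; move: cs; rewrite inE => cs.
case: eqP => //= ev.
by rewrite (sh_comm e s) cW.1 ?par_sh ?ev // eq_sym.
Qed.

Lemma sum_crossing_out :
  \sum_(x in Gside W) kk x = \sum_(y in [set v | (v \notin W) && par v]) kk y.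
Proof.
pose Oo := [set v | (v \notin W) && par v].
transitivity (\sum_(x in Gside W) #|[set e | sh e x \in Oo]|).
  apply: eq_bigr => x; rewrite inE => /andP[xW px]; apply: eq_card => e.
  by rewrite !inE xW par_sh px andbT; case: (sh e x \in W).
rewrite sum_dirs; apply: eq_bigr => y; rewrite inE => /andP[yW py].
apply: eq_card => e; rewrite !inE (negbTE yW) par_sh py andbT.
by case: (sh e y \in W).
Qed.

(** Sort the edges at even vertices of [W] by their other end: no edge leaves an odd vertex of [W],
    so those staying inside are exactly the [D * #|Aside W|] edges at odd vertices. *)
Lemma sum_crossing : \sum_(x in Gside W) kk x + D * #|Aside W| = D * #|Gside W|.
Proof.
have -> : D * #|Aside W| = \sum_(x in Gside W) #|[set e | sh e x \in Aside W]|.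
  rewrite sum_dirs mulnC -sum_nat_const; apply: eq_bigr => y.
  rewrite inE => /andP[yW py]; rewrite -cardsT; apply: eq_card => e.
  by rewrite !inE par_sh py andbT cW.1 ?yW.
rewrite -big_split mulnC -sum_nat_const; apply: eq_bigr => x.
rewrite inE => /andP[xW px] /=; rewrite -cardsT -(cardsID (crossing W x) setT).
congr (_ + _); apply: eq_card => e; rewrite !inE ?andbT xW //.
by rewrite par_sh px andbT; case: (sh e x \in W).
Qed.

Lemma leq_AG : 0 < D -> #|Aside W| <= #|Gside W|.
Proof. by move=> D0; rewrite -(leq_pmul2l D0) -sum_crossing leq_addl. Qed.

Lemma sum_crossing_thickness :
  \sum_(x in Gside W) kk x = D * thickness W.
Proof. by rewrite /thickness mulnBr -sum_crossing addnK. Qed.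

Lemma card_W : 0 < D -> #|W| = 2 * #|Aside W| + thickness W.
Proof.
move=> D0; have -> : #|W| = #|Aside W| + #|Gside W|.
  rewrite -(cardsID [set v : L | par v] W); congr (_ + _); apply: eq_card => v.
    by rewrite !inE.
  by rewrite !inE andbC.
by rewrite /thickness mul2n -addnn -addnA subnKC // leq_AG.
Qed.

Lemma card_many_in X n : X \subset Gside W ->
  (forall x, x \in X -> n <= kk x) -> n * #|X| <= D * thickness W.
Proof.
move=> XG nX; rewrite -sum_crossing_thickness.
rewrite (bigID (mem X)) /= (leq_trans _ (leq_addr _ _)) //.
rewrite mulnC -sum_nat_const.
rewrite [leqRHS](eq_bigl (fun x => x \in X)); first exact: leq_sum.
by move=> x; apply: andb_idl; apply: (subsetP XG).
Qed.

Lemma card_many_out X n : (forall x, x \in X -> (x \notin W) && par x) ->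
  (forall x, x \in X -> n <= kk x) -> n * #|X| <= D * thickness W.
Proof.
move=> XG nX; rewrite -sum_crossing_thickness sum_crossing_out.
rewrite (bigID (mem X)) /= (leq_trans _ (leq_addr _ _)) //.
rewrite mulnC -sum_nat_const.
rewrite [leqRHS](eq_bigl (fun x => x \in X)); first exact: leq_sum.
by move=> x; apply: andb_idl; rewrite inE; apply: XG.
Qed.

Lemma card_many X n : 0 < n ->
  (forall x, x \in X -> n <= kk x) -> n * #|X| <= 2 * (D * thickness W).
Proof.
move=> n0 nX; have loose x : x \in X -> (x \in W) = ~~ par x.
  by move=> /nX nx; have [e /crossing_loose] := kk_gt0 (leq_trans n0 nx).
rewrite -(cardsID W X) mulnDr mul2n -addnn leq_add //.
  apply: card_many_in => [|x]; last by rewrite inE => /andP[/nX].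
  apply/subsetP => x; rewrite !inE => /andP[/loose xl xW].
  by rewrite xW -xl.
apply: card_many_out => x; rewrite inE => /andP[xW]; last exact: nX.
by move/loose=> xl; rewrite xW; move: xW; rewrite xl negbK.
Qed.

End Contour.

(** * Components of the uncovered set *)

Section Components.
Variable L : lattice_graph.
Implicit Types (x y z v : L) (e f s : dir L) (X Y B C U W K : {set L}).

Definition uncovered_rel K : rel L :=
  [rel v w | [&& v \notin K, w \notin K & [exists e, sh e v == w]]].

Definition comp K v : {set L} := [set w | connect (uncovered_rel K) v w].

Lemma uncovered_sym K : connect_sym (uncovered_rel K).
Proof.
apply/sym_connect_sym/symmetric_from_pre => v w /and3P[vK wK /existsP[e /eqP vw]].
by apply/and3P; split=> //; apply/existsP; exists (op e); rewrite -vw shK.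
Qed.

Lemma comp_refl K v : v \in comp K v.
Proof. by rewrite inE connect0. Qed.

Lemma comp_eq K v w : w \in comp K v -> comp K w = comp K v.
Proof.
rewrite inE => vw; apply/setP => z; rewrite !inE.
by rewrite (same_connect (@uncovered_sym K) vw).
Qed.

Lemma comp_sh K v e : v \notin K -> sh e v \notin K -> sh e v \in comp K v.
Proof.
move=> vK wK; rewrite inE connect1 //; apply/and3P; split=> //.
by apply/existsP; exists e.
Qed.

Lemma comp_uncovered K v w : v \notin K -> w \in comp K v -> w \notin K.
Proof.
move=> vK; rewrite inE => /connectP[p pv ->] {w}.
elim: p v vK pv => //= w p IH v vK /andP[/and3P[_ wK _] pw]; exact: IH.
Qed.

Definition bigcomps (Lout : {set L}) n U : {set {set L}} :=
  [set C in [set comp (nb U) v | v in ~: nb U] | (n <= #|C|) && [disjoint C & Lout]].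

Lemma trivIset_bigcomps Lout n U : trivIset (bigcomps Lout n U).
Proof.
apply/trivIsetP => C1 C2; rewrite !inE => /andP[/imsetP[v _ ->] _].
move=> /andP[/imsetP[w _ ->] _]; apply: contraNT => /pred0Pn[z /= /andP[zv zw]].
by rewrite -(comp_eq zv) -(comp_eq zw).
Qed.

(** The boundary edges of a component all end in [nb U]; the components are disjoint, and [nb U]
    receives at most [#|dir L|] edges per vertex. *)
Lemma card_bigcomps (Lout : {set L}) n b U :
    (forall C, [disjoint C & Lout] -> n <= #|C| ->
       b <= \sum_(x in C) #|[set e | sh e x \notin C]|) ->
  b * #|bigcomps Lout n U| <= #|dir L| * #|nb U|.
Proof.
move=> iso; set BC := bigcomps _ _ _.
apply: (@leq_trans (\sum_(C in BC) \sum_(x in C) #|[set e | sh e x \in nb U]|)).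
  rewrite mulnC -sum_nat_const leq_sum // => C CB.
  move: (CB); rewrite inE => /andP[/imsetP[v vU eC] /andP[nC dC]].
  rewrite (leq_trans (iso C dC nC)) // leq_sum // => x xC.
  apply: subset_leq_card; apply/subsetP => e; rewrite !inE.
  apply: contraR => xeU; rewrite eC -(@comp_eq (nb U) v x) -?eC //.
  by rewrite comp_sh // (@comp_uncovered (nb U) v) -?eC //; rewrite inE in vU.
rewrite -big_trivIset ?trivIset_bigcomps //=.
apply: (@leq_trans (\sum_(x in [set: L]) #|[set e | sh e x \in nb U]|)).
  rewrite [leqRHS](bigID (mem (cover BC))) /=; apply: leq_trans (leq_addr _ _).
  by apply/eq_leq/eq_bigl => x; rewrite inE.
rewrite sum_dirs mulnC -sum_nat_const leq_sum // => y _.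
by rewrite max_card.
Qed.

(** A vertex has fewer than [n] neighbours in a component of fewer than [n] vertices, so more than
    half of its edges lead to [nb U]. *)
Lemma card_smallcomps n U (small : {set L}) : #|dir L| = 2 * n ->
  (forall v, v \in small -> v \notin nb U /\ #|comp (nb U) v| < n) ->
  n * #|small| <= #|dir L| * #|nb U| /\
  (forall v, v \in small -> exists e, sh e v \in nb U).
Proof.
move=> Dn sm.
have deg v : v \in small -> n < #|[set e | sh e v \in nb U]|.
  move=> /sm[vU cv].
  have := cardsC [set e | sh e v \in nb U]; rewrite Dn.
  have : #|~: [set e | sh e v \in nb U]| <= #|comp (nb U) v|.
    rewrite (@leq_trans #|nb [set v] :&: comp (nb U) v|) ?subset_leq_card ?subsetIr //.
    rewrite -card_dirs subset_leq_card //; apply/subsetP => e.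
    by rewrite in_setC 2!in_set => ve; exact: comp_sh.
  lia.
split=> [|v /deg nv]; last first.
  have /card_gt0P[e] : 0 < #|[set e | sh e v \in nb U]| by apply: leq_ltn_trans nv.
  by rewrite inE; exists e.
apply: (@leq_trans (\sum_(x in small) #|[set e | sh e x \in nb U]|)).
  by rewrite mulnC -sum_nat_const leq_sum // => x /deg/ltnW.
rewrite sum_dirs mulnC -sum_nat_const leq_sum // => y _.
by rewrite max_card.
Qed.

End Components.

(** * Reading a contour off its cover *)

Section CoverContour.
Variable L : lattice_graph.
Implicit Types (x y z v : L) (e f s : dir L) (X Y B C U : {set L}).
Variables (W U Lout : {set L}) (d theta : nat).
Hypothesis cW : contour W.
Hypothesis Dd : #|dir L| = 2 * d.
Hypothesis theta_le : 2 * theta <= d.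
Local Notation kk v := #|crossing W v|.

Definition rough : {set L} := [set v | theta <= kk v].
Definition rough_dirs v := [set e | sh e v \in rough].

Hypothesis covU : forall v, theta <= #|rough_dirs v| -> v \in nb U.

(* Every boundary edge has an endpoint with at least [d] boundary edges;
   flipping membership at those vertices leaves a function that changes only
   along edges meeting [nb U]. *)
Definition status v := (v \in W) (+) (d <= kk v).

(** If both ends were uncovered, all but fewer than [2 * theta] of the edges at each would cross the
    boundary and lead to vertices with fewer than [theta] boundary edges. Some direction does so at
    both ends. Translating the edge along it gives a boundary edge whose ends violate
    [crossing_sum]. *)
Lemma cover_crossing u s : s \in crossing W u -> d <= kk u -> d <= kk (sh s u) ->
  u \in nb U \/ sh s u \in nb U.
Proof.
move=> su du dy; set y := sh s u in dy *.
case: (boolP (u \in nb U)) => uU; first by left.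
case: (boolP (y \in nb U)) => yU; first by right.
have sm v : v \notin nb U -> #|rough_dirs v| < theta.
  by apply: contraR; rewrite -leqNgt; apply: covU.
have big v : v \notin nb U -> d <= kk v ->
    #|dir L| < #|crossing W v :\: rough_dirs v| + 2 * theta.
  move=> /sm sv dv.
  have h : kk v < #|crossing W v :\: rough_dirs v| + theta.
    rewrite -(cardsID (rough_dirs v) (crossing W v)) addnC ltn_add2l.
    by rewrite (leq_ltn_trans _ sv) // subset_leq_card ?subsetIr.
  have /card_gt0P[e] : 0 < #|crossing W v :\: rough_dirs v| by lia.
  rewrite in_setD => /andP[]; rewrite 2!in_set -ltnNge => kv /(crossing_sum cW).
  lia.
have /card_gt0P[e] :
    0 < #|(crossing W u :\: rough_dirs u) :&: (crossing W y :\: rough_dirs y)|.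
  have := cardsUI (crossing W u :\: rough_dirs u) (crossing W y :\: rough_dirs y).
  have := max_card ((crossing W u :\: rough_dirs u) :|: (crossing W y :\: rough_dirs y)).
  have := big u uU du; have := big y yU dy; lia.
rewrite !inE -!ltnNge => /and3P[/andP[ku cu] ky cy].
have : s \in crossing W (sh e u).
  rewrite inE sh_comm -/y; move: su; rewrite inE -/y.
  by move: cu cy; do 4!case: (_ \in W).
move/(crossing_sum cW); rewrite sh_comm -/y; lia.
Qed.

(** The vertex [sh s y] has no boundary edge. So if [f] crosses at [y], the edge parallel to [s] at
    [sh f y] crosses as well, and when [sh f y] is not rough its other end must be. If [y] is
    uncovered there are at least [theta] such [f], which gives [sh s y] enough rough neighbours to
    be covered. *)
Lemma cover_same y s : (sh s y \in W) = (y \in W) -> d <= kk y ->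
  y \in nb U \/ sh s y \in nb U.
Proof.
move=> sy dy; case: (boolP (y \in nb U)) => yU; first by left.
right; apply: covU.
have sm : #|rough_dirs y| < theta by apply: contraR yU; rewrite -leqNgt; apply: covU.
rewrite (@leq_trans #|crossing W y :\: rough_dirs y|) //.
  have := cardsID (rough_dirs y) (crossing W y).
  have := subset_leq_card (subsetIr (crossing W y) (rough_dirs y)); lia.
apply: subset_leq_card; apply/subsetP => f.
rewrite in_setD => /andP[]; rewrite 2!in_set -ltnNge => kx cf.
have yl := crossing_loose cW cf.
have : s \in crossing W (sh f y).
  move: cf; rewrite !inE sh_comm (cW.1 (sh s y) f) ?sy ?par_sh //.
  by rewrite eq_sym.
by move/(crossing_sum cW); rewrite sh_comm 2!in_set; lia.
Qed.

Lemma status_change v s : status v != status (sh s v) ->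
  v \in nb U \/ sh s v \in nb U.
Proof.
rewrite /status; case: (boolP (s \in crossing W v)) => cs.
  have kv := crossing_sum cW cs; move=> ne.
  have : (d <= kk v) = (d <= kk (sh s v)).
    move: cs ne; rewrite inE.
    by case: (sh s v \in W); case: (v \in W); case: (d <= kk v); case: (d <= _).
  case: (leqP d (kk v)) => [dv dw|]; last lia.
  by apply: cover_crossing; rewrite -?dw.
have sv : (sh s v \in W) = (v \in W) by move: cs; rewrite inE negbK => /eqP.
case: (leqP d (kk v)) => [dv _|]; first exact: cover_same.
rewrite sv; case: (leqP d (kk (sh s v))) => [dv _ _|]; last by rewrite eqxx.
by have := @cover_same (sh s v) (op s); rewrite shK sv => /(_ erefl dv)[]; [right|left].
Qed.

Lemma near_cover2 v : 0 < d -> d <= kk v -> exists2 u, u \in U & near 2 v u.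
Proof.
move=> d0 dv; have [e ev] := kk_gt0 (leq_trans d0 dv).
have [f fv] := cW.2 v (crossing_loose cW ev).
have [/near_nb[u uU vu]|/near_nb[u uU vu]] := cover_same fv dv.
  by exists u => //; apply: near_le vu.
by exists u => //; apply: (near_trans (near_sh f v)).
Qed.

Lemma near_cover3 v : 0 < d -> 0 < kk v -> exists2 u, u \in U & near 3 v u.
Proof.
move=> d0 /kk_gt0[e ev]; have := crossing_sum cW ev.
case: (leqP d (kk v)) => dv.
  by have [u uU vu] := near_cover2 d0 dv; exists u => //; apply: near_le vu.
move=> ?; have [|u uU vu] := @near_cover2 (sh e v) d0; first by lia.
by exists u => //; apply: (near_trans (near_sh e v)).
Qed.

Lemma status_comp v w : v \notin nb U -> w \in comp (nb U) v -> status w = status v.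
Proof.
move=> vU; rewrite inE => /connectP[p pv ->] {w}.
elim: p v vU pv => //= w p IH v vU /andP[/and3P[_ wU /existsP[e /eqP ew]] pw].
rewrite IH //; apply/eqP; apply: contraT => ne.
have [] : v \in nb U \/ sh e v \in nb U.
  by apply: status_change; rewrite ew eq_sym.
  by rewrite (negbTE vU).
by rewrite ew (negbTE wU).
Qed.

Hypothesis d_gt0 : 0 < d.
Hypothesis Lout_status : forall v, v \in Lout -> ~~ status v.

Definition evens (Q : {set {set L}}) : {set L} :=
  [set v in cover Q | ~~ par v].

(** The status is constant on uncovered components, and an even vertex of true status lies in [W],
    because outside [W] it would have no boundary edge. A component meeting [Lout] has false status.
    So the even vertices of [W] missed by the large components of true status have [d] boundary
    edges, or lie in [nb U], or lie in a component of fewer than [d] vertices. *)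
Lemma inner_approx : exists Q : {set {set L}}, [/\ Q \subset bigcomps Lout d U,
   evens Q \subset Gside W,
   #|Gside W :\: evens Q| <= 2 * thickness W + 6 * d * #|U|
 & forall v, v \in Gside W :\: evens Q -> exists2 u, u \in U & near 2 v u].
Proof.
pose Q := [set C in bigcomps Lout d U | [exists v in C, status v]].
pose small := [set v | (v \notin nb U) && (#|comp (nb U) v| < d)].
have [|cs ns] := @card_smallcomps L d U small Dd.
  by move=> v; rewrite inE => /andP[].
exists Q; split.
- by apply/subsetP => C; rewrite inE => /andP[].
- apply/subsetP => v; rewrite inE => /andP[/bigcupP[C] CQ vC pv].
  rewrite inE pv andbT; move: CQ; rewrite 2!inE.
  move=> /andP[/andP[/imsetP[w wU eC] _] /existsP[z /andP[zC sz]]].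
  rewrite inE in wU; rewrite eC in vC zC.
  have : status v by rewrite (status_comp wU vC) -(status_comp wU zC).
  rewrite /status; case: (boolP (v \in W)) => //= vW.
  have -> : kk v = 0.
    by apply: (tight_kk0 cW); rewrite (negbTE vW) (negbTE pv).
  by rewrite leqn0 (gtn_eqF d_gt0).
- have sub : Gside W :\: evens Q \subset
      [set v in Gside W | d <= kk v] :|: (nb U :|: small).
    apply/subsetP => v; rewrite in_setD => /andP[vQ vG].
    rewrite !in_setU; case: (leqP d (kk v)) => kv; first by rewrite in_set vG kv.
    case: (boolP (v \in nb U)) => [_|vU]; first by rewrite orbT.
    suff -> : v \in small by rewrite !orbT.
    rewrite in_set vU ltnNge; apply: contraNN vQ => cv.
    have pv : ~~ par v by move: vG; rewrite inE => /andP[].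
    rewrite inE pv andbT; apply/bigcupP; exists (comp (nb U) v); last exact: comp_refl.
    have sv : status v.
      by rewrite /status leqNgt kv addbF; move: vG; rewrite inE => /andP[].
    rewrite 2!inE cv imset_f ?in_setC //=; apply/andP; split.
      apply/pred0P => w /=; apply/negP => /andP[wv /Lout_status].
      by rewrite (status_comp vU wv) sv.
    by apply/existsP; exists v; rewrite comp_refl.
  have aux (a b c w n t u : nat) : a <= b + w -> w <= n + c -> b <= 2 * t ->
      c <= 2 * n -> n <= 2 * u -> a <= 2 * t + 6 * u by lia.
  rewrite -mulnA; apply: (aux _ _ _ _ _ _ _ (leq_trans (subset_leq_card sub)
    (leq_card_setU _ _)) (leq_card_setU _ _)).
  - rewrite -(leq_pmul2l d_gt0) mulnCA mulnA -Dd.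
    apply: card_many_in => // [|x]; last by rewrite inE => /andP[].
    by apply/subsetP => x; rewrite inE => /andP[].
  - by rewrite -(leq_pmul2l d_gt0) [leqRHS]mulnCA mulnA -Dd.
  - by rewrite mulnA -Dd card_nb.
move=> v; rewrite in_setD => /andP[vQ vG].
case: (boolP (v \in nb U)) => vU.
  by have [u uU vu] := near_nb vU; exists u => //; apply: near_le vu.
have pv : ~~ par v by move: vG; rewrite inE => /andP[].
case: (leqP d (kk v)) => kv; first exact: near_cover2.
have [e /near_nb[u uU ue]] : exists e, sh e v \in nb U.
  apply: ns; rewrite inE vU /= ltnNge; apply: contraNN vQ => cv.
  rewrite inE pv andbT; apply/bigcupP; exists (comp (nb U) v); last exact: comp_refl.
  have sv : status v.
    by rewrite /status leqNgt kv addbF; move: vG; rewrite inE => /andP[].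
  rewrite 2!inE cv imset_f ?in_setC //=; apply/andP; split.
    apply/pred0P => w /=; apply/negP => /andP[wv /Lout_status].
    by rewrite (status_comp vU wv) sv.
  by apply/existsP; exists v; rewrite comp_refl.
by exists u => //; apply: (near_trans (near_sh e v)).
Qed.

End CoverContour.

(** * Greedy refinement of an approximation *)

Section Refinement.
Variable L : lattice_graph.
Implicit Types (x y z v : L) (e f s : dir L) (X Y B C U F S P : {set L}).

Definition out_dirs F y := [set e | sh e y \notin F].
Definition in_dirs S v := [set e | sh e v \in S].

(* The approximations of Sapozhenko. *)
Definition approx psi W F S :=
  [/\ F \subset Gside W, Aside W \subset S, forall y, y \in S -> par y,
      forall y, y \in S -> #|out_dirs F y| <= psi
    & forall v, ~~ par v -> v \notin F -> #|in_dirs S v| <= psi].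

Definition approxb psi W F S :=
  [&& F \subset Gside W, Aside W \subset S, [forall y in S, par y],
      [forall y in S, #|out_dirs F y| <= psi]
    & [forall v, (~~ par v) ==> (v \notin F) ==> (#|in_dirs S v| <= psi)]].

Lemma approxP psi W F S : reflect (approx psi W F S) (approxb psi W F S).
Proof.
apply: (iffP and5P) => -[h1 h2 h3 h4 h5]; split=> //.
- exact: (forall_inP h3).
- exact: (forall_inP h4).
- by move=> v pv vF; have /forallP/(_ v) := h5; rewrite pv vF.
- exact/forall_inP.
- exact/forall_inP.
by apply/forallP => v; apply/implyP => pv; apply/implyP => vF; apply: h5.
Qed.

(** The two passes are functions of [F] and of the recorded sets [P1], [P2] only, so a decoder can
    carry them out without knowing [W]. *)
Definition grow_in F P := F :|: nb P.
Definition almost_in psi F : {set L} := [set y | par y & #|out_dirs F y| <= psi].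
Definition prune_out S P := S :\: nb P.
Definition close_in psi F S : {set L} :=
  F :|: [set v | ~~ par v & psi < #|in_dirs S v|].

Definition refined_S psi F P1 P2 := prune_out (almost_in psi (grow_in F P1)) P2.
Definition refined_F psi F P1 P2 :=
  close_in psi (grow_in F P1) (refined_S psi F P1 P2).

Lemma card_in_out S v : #|in_dirs S v| + #|out_dirs S v| = #|dir L|.
Proof.
rewrite -(cardsC (in_dirs S v)); congr (_ + _); apply: eq_card => e.
by rewrite !inE.
Qed.

Variables (W : {set L}) (psi d : nat).
Hypothesis cW : contour W.
Hypothesis Dd : #|dir L| = 2 * d.
Hypothesis psi_le : psi <= d.
Local Notation kk v := #|crossing W v|.

Lemma kk_almost F y : F \subset Gside W -> y \notin W ->
  #|out_dirs F y| <= psi -> d <= kk y.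
Proof.
move=> /subsetP FG yW sy; rewrite (@leq_trans #|in_dirs F y|) //.
  by have := card_in_out F y; lia.
apply: subset_leq_card; apply/subsetP => e; rewrite !inE => /FG.
by rewrite inE (negbTE yW) => /andP[->].
Qed.

Lemma kk_missing S v : Aside W \subset S -> v \in Gside W ->
  #|in_dirs S v| <= psi -> d <= kk v.
Proof.
move=> /subsetP AS; rewrite inE => /andP[vW pv] sv.
rewrite (@leq_trans #|out_dirs S v|) //; first by have := card_in_out S v; lia.
apply: subset_leq_card; apply/subsetP => e; rewrite !inE vW.
by apply: contraNN => /eqP eW; apply: AS; rewrite inE eW par_sh.
Qed.

Lemma card_almost F Y : 0 < d -> F \subset Gside W ->
    (forall y, y \in Y -> par y /\ #|out_dirs F y| <= psi) ->
  #|Y :\: Aside W| <= 2 * thickness W.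
Proof.
move=> d0 FG Yp; have notW y : y \in Y :\: Aside W -> (y \notin W) && par y.
  by rewrite !inE => /andP[+ /Yp[py _]]; rewrite py !andbT.
rewrite -(leq_pmul2l d0) mulnCA mulnA -Dd.
apply: (card_many_out cW notW) => y yY.
have /andP[yW _] := notW y yY; apply: (kk_almost FG yW).
by move: yY; rewrite in_setD => /andP[_ /Yp[]].
Qed.

Lemma card_missing F S : 0 < d -> approx psi W F S ->
  #|Gside W :\: F| <= 2 * thickness W.
Proof.
move=> d0 [FG AS _ _ sF].
rewrite -(leq_pmul2l d0) mulnCA mulnA -Dd.
apply: card_many_in => // [|v]; first exact: subsetDl.
rewrite in_setD => /andP[vF vG]; apply: (kk_missing AS vG).
by apply: sF vF; move: vG; rewrite inE => /andP[].
Qed.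

(** Count the edges at [S]. At most [#|dir L| * #|F|] end in [F]. The others end in [Gside W :\: F],
    whose vertices see at most [psi] of [S], or outside [W]; the latter start in [S :\: Aside W],
    from each vertex of which at most [psi] edges avoid [F]. *)
Lemma approx_card F S : approx psi W F S ->
  #|dir L| * #|S| <= #|dir L| * #|F| + psi * (#|Gside W :\: F| + #|S :\: Aside W|).
Proof.
case=> FG AS pS sS sF.
have -> : #|dir L| * #|S| =
    \sum_(y in S) #|in_dirs F y| + \sum_(y in S) #|out_dirs F y|.
  by rewrite -big_split mulnC -sum_nat_const; apply: eq_bigr => y _; rewrite /= card_in_out.
apply: leq_add.
  by rewrite sum_dirs mulnC -sum_nat_const leq_sum // => y _; rewrite max_card.
apply: (@leq_trans (\sum_(y in S) #|in_dirs (Gside W :\: F) y| +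
   \sum_(y in S) #|out_dirs W y|)).
  rewrite -big_split leq_sum // => y yS; apply: leq_trans (leq_card_setU _ _).
  apply: subset_leq_card; apply/subsetP => e; rewrite !inE => ->.
  by rewrite par_sh (pS y yS); case: (sh e y \in W).
rewrite mulnDr leq_add //.
  rewrite sum_dirs mulnC -sum_nat_const leq_sum // => v.
  by rewrite !inE => /and3P[vF _ pv]; apply: sF.
rewrite (bigID (mem W)) /= big1 => [|y /andP[yS yW]].
  rewrite add0n mulnC -sum_nat_const.
  rewrite [leqRHS](eq_bigl (fun y => (y \in S) && (y \notin W))).
    apply: leq_sum => y /andP[yS yW]; apply: leq_trans (sS y yS).
    apply: subset_leq_card; apply/subsetP => e; rewrite !inE.
    by apply: contraNN => /(subsetP FG); rewrite inE => /andP[].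
  by move=> y; rewrite !inE andbC; case: (boolP (y \in S)) => //= /pS ->; rewrite andbT.
apply: eq_card0 => e; rewrite !inE; apply/negbTE; rewrite negbK.
by rewrite cW.1 // yW pS.
Qed.

(** The vertices of [P1] are odd and in [W], so their neighbours may be added to [F0]; afterwards
    every odd vertex of [W] has at most [psi] neighbours off the enlarged set. The vertices of [P2]
    are even and outside [W], so their neighbours may be removed from the odd candidates; afterwards
    an even vertex with more than [psi] neighbours among these must be in [W]. *)
Lemma refine_exists F0 : F0 \subset Gside W ->
  exists P1 P2, [/\ approx psi W (refined_F psi F0 P1 P2) (refined_S psi F0 P1 P2),
    psi.+1 * #|P1| <= #|Gside W :\: F0|,
    psi.+1 * #|P2| <= #|almost_in psi (grow_in F0 P1) :\: Aside W|,
    forall p, p \in P1 -> exists2 g, g \in Gside W :\: F0 & near 1 p g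
  & grow_in F0 P1 \subset Gside W /\ forall p, p \in P2 ->
      exists2 y, y \in almost_in psi (grow_in F0 P1) :\: Aside W & near 1 p y].
Proof.
move=> F0G.
have meetP (X : {set L}) p : 0 < #|nb [set p] :&: X| -> exists2 g, g \in X & near 1 p g.
  case/card_gt0P => g /setIP[/near_nb[q]]; rewrite inE => /eqP -> gp gX.
  by exists g => //; apply: near_sym.
pose X1 := Gside W :\: F0.
pose B1 := [set a in Aside W | 0 < #|nb [set a] :&: X1|].
have [P1 [P1B cP1 rest1]] := @greedy _ _ (fun a => nb [set a]) B1 X1 psi.+1 isT.
rewrite -nb_bigcup in cP1 rest1; set F1 := grow_in F0 P1.
have P1A a : a \in P1 -> a \in Aside W /\ 0 < #|nb [set a] :&: X1|.
  by move/(subsetP P1B); rewrite inE => /andP[].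
have F1G : F1 \subset Gside W.
  rewrite subUset F0G; apply/subsetP => g /nbP[e /P1A[+ _]].
  rewrite !inE par_sh => /andP[eW pe]; rewrite pe andbT.
  by rewrite -(shK e g) cW.1 // eW par_sh pe.
have AS1 : Aside W \subset almost_in psi F1.
  apply/subsetP => a aA; move: (aA); rewrite inE => /andP[aW pa].
  rewrite inE pa /=.
  have -> : #|out_dirs F1 a| = #|nb [set a] :&: ~: F1|.
    by rewrite -card_dirs; apply: eq_card => e; rewrite !inE.
  have sub : nb [set a] :&: ~: F1 \subset (nb [set a] :&: X1) :\: nb P1.
    apply/subsetP => g; rewrite !in_setI !in_setD in_setC in_setU negb_or in_setI in_setD.
    move=> /andP[ga /andP[-> ->]]; rewrite ga /=.
    move: ga => /nbP[e]; rewrite inE => /eqP ea.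
    by rewrite inE -(shK e g) ea cW.1 ?aW ?pa // par_sh pa.
  rewrite (leq_trans (subset_leq_card sub)) //.
  case: (boolP (a \in B1)) => [/rest1 //|].
  rewrite inE aA -leqNgt leqn0 => /eqP a0.
  by rewrite (leq_trans (subset_leq_card (subsetDl _ _))) ?a0.
set S1 := almost_in psi F1 in AS1.
pose X2 := S1 :\: Aside W.
pose B2 := [set v | [&& ~~ par v, v \notin W & 0 < #|nb [set v] :&: X2|]].
have [P2 [P2B cP2 rest2]] := @greedy _ _ (fun a => nb [set a]) B2 X2 psi.+1 isT.
rewrite -nb_bigcup in cP2 rest2; set S2 := prune_out S1 P2.
have P2O v : v \in P2 -> [/\ ~~ par v, v \notin W & 0 < #|nb [set v] :&: X2|].
  by move/(subsetP P2B); rewrite inE => /and3P[].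
have outS2 v : ~~ par v -> v \notin W -> #|in_dirs S2 v| <= psi.
  move=> pv vW; rewrite card_dirs.
  have sub : nb [set v] :&: S2 \subset (nb [set v] :&: X2) :\: nb P2.
    apply/subsetP => y; rewrite !(in_setI, in_setD) => /and3P[yv -> ->].
    rewrite yv andbT /=; move: yv => /nbP[e]; rewrite inE => /eqP ev.
    by rewrite inE -(shK e y) ev cW.1 ?(negbTE vW) ?(negbTE pv).
  rewrite (leq_trans (subset_leq_card sub)) //.
  case: (boolP (v \in B2)) => [/rest2 //|].
  rewrite inE pv vW -leqNgt leqn0 => /eqP a0.
  by rewrite (leq_trans (subset_leq_card (subsetDl _ _))) ?a0.
exists P1, P2; split=> //.
- split.
  + rewrite subUset F1G; apply/subsetP => v; rewrite inE => /andP[pv big].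
    rewrite inE pv andbT; apply: contraLR big => vW.
    by rewrite -leqNgt; apply: outS2.
  + apply/subsetP => a aA; rewrite in_setD (subsetP AS1) // andbT.
    apply/nbP => -[e /P2O[pe eW _]]; move: aA; rewrite inE -(shK e a).
    by rewrite cW.1 ?(negbTE eW) ?(negbTE pe).
  + by move=> y; rewrite !inE => /and3P[].
  + move=> y; rewrite in_setD => /andP[_]; rewrite inE => /andP[_].
    apply: leq_trans; apply: subset_leq_card; apply/subsetP => e.
    by rewrite ![_ \in out_dirs _ _]in_set in_setU => /norP[].
  + move=> v pv; rewrite in_setU => /norP[_].
    by rewrite in_set pv /= -leqNgt.
- by rewrite (leq_trans cP1) // subset_leq_card ?subsetIl.
- by rewrite (leq_trans cP2) // subset_leq_card ?subsetIl.
- by move=> p /P1A[_ /meetP].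
split=> // p /P2O[_ _ /meetP]; exact.
Qed.

End Refinement.

(** * Codes for approximations *)

Section Codes.
Variable L : lattice_graph.
Implicit Types (x y z v : L) (e f s : dir L) (X Y B C U F S P : {set L}).

Definition ball r X := iter r (fun Y => Y :|: nb Y) X.

Lemma ballP r X x : reflect (exists2 u, u \in X & near r u x) (x \in ball r X).
Proof.
elim: r x => [|r IH] x /=.
  apply: (iffP idP) => [xX|[u uX [[|//] _ <-]]] //.
  by exists x => //; apply: near0.
apply: (iffP setUP) => [[/IH[u uX ux]|/near_nb[y /IH[u uX uy] xy]]|[u uX [p sp px]]].
- by exists u => //; apply: near_le ux.
- exists u => //; rewrite -addn1; apply: near_trans uy _; exact: near_sym.
case/lastP: p => [|p e] in sp px; first by left; apply/IH; exists u => //; exists [::].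
right; rewrite -px -cats1 walk_cat /=; apply/nb_sh/IH; exists u => //.
by exists p => //; rewrite size_rcons in sp.
Qed.

Arguments ball : simpl never.

Definition inner W : {set L} := [set x in Gside W | 0 < #|crossing W x|].

(** Stated for predicates because the potential argument that proves it starts from an arbitrary
    predicate propagated by double steps. *)
Definition two_linked X := forall Q : pred L,
  (forall x e f, x \in X -> sh f (sh e x) \in X -> Q x -> Q (sh f (sh e x))) ->
  forall x y, x \in X -> y \in X -> Q x -> Q y.

(** The radius is [8 = 3 + 2 + 3]: from [X] to a point of [Z], a double step in [Z], and back to
    [X]. *)
Lemma two_linked_linked X Z x0 : two_linked Z -> x0 \in Z ->
    (forall x, x \in Z -> exists2 u, u \in X & near 3 x u) ->
    (forall z, z \in X -> exists2 x, x \in Z & near 4 z x) ->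
  linked 8 X x0.
Proof.
move=> lZ x0Z ZX XZ Y x0Y /properP[YX [z zX zY]].
suff : ~~ [disjoint X :\: Y & ball 8 Y].
  case/pred0Pn => u /= /andP[uXY /ballP[y yY yu]].
  by exists y, u.
apply/negP => /pred0P dj.
have far y u r : y \in Y -> near r y u -> r <= 8 -> u \in X -> u \in Y.
  move=> yY yu r8 uX; have /= /negbT := dj u.
  rewrite in_setD uX andbT; apply: contraNT => ->.
  by apply/ballP; exists y => //; apply: near_le yu.
have [x xZ zx] := XZ z zX.
have : x \in ball 3 Y.
  apply: (lZ (mem (ball 3 Y)) _ _ _ x0Z xZ); last first.
    by apply/ballP; exists x0 => //; apply: near_le (near0 x0).
  move=> {xZ zx}x e f xZ yZ /ballP[u uY ux]; apply/ballP.
  have [w wX xw] := ZX _ yZ; exists w; last exact: near_sym.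
  have xy : near 2 x (sh f (sh e x)) by exists [:: e; f].
  exact: (far u w 8 uY (near_trans (near_trans ux xy) xw) isT wX).
move=> /ballP[u uY ux]; case/negP: zY.
exact: (far u z 7 uY (near_trans ux (near_sym zx)) isT zX).
Qed.

Variables (Lout : {set L}) (d psi : nat).

(** One walk, four masks selecting [U], [P1], [P2] and [Y] among its visits, and [k] bits choosing
    among the large components, which the decoder computes from [U]. *)
Definition code n k : Type :=
  (n.-tuple (dir L) * (n.+1.-tuple bool * n.+1.-tuple bool * n.+1.-tuple bool
     * n.+1.-tuple bool) * k.-tuple bool).
HB.instance Definition _ n k := Finite.on (code n k).

Lemma card_code n k :
  #|{: code n k}| = #|dir L| ^ n * 2 ^ (4 * n.+1 + k).
Proof.
by rewrite !card_prod !card_tuple card_bool -!expnD -mulnA -expnD; congr (_ * 2 ^ _); lia.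
Qed.

Section Decode.
Variables (n k : nat) (c : code n k) (x0 : L).
Let w := c.1.1.
Let m := c.1.2.
Definition dec_U := selected w m.1.1.1 x0.
Definition dec_P1 := selected w m.1.1.2 x0.
Definition dec_P2 := selected w m.1.2 x0.
Definition dec_Y := selected w m.2 x0.
Definition dec_Q : {set {set L}} := [set C in mask c.2 (enum (bigcomps Lout d dec_U))].
Definition dec_F := refined_F psi (evens dec_Q) dec_P1 dec_P2.
Definition dec_S := refined_S psi (evens dec_Q) dec_P1 dec_P2.
End Decode.

Lemma subset_mask (T : finType) (A B : {set T}) k : A \subset B -> #|B| <= k ->
  exists q : k.-tuple bool, A = [set i in mask q (enum B)].
Proof.
move=> /subsetP AB ck.
pose q := [seq i \in A | i <- enum B] ++ nseq (k - #|B|) false.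
have sz : size q == k by rewrite size_cat size_map -cardE size_nseq subnKC.
exists (Tuple sz); apply/setP => i; rewrite inE /=.
rewrite -[enum B]cats0 mask_cat ?size_map // mem_cat.
have -> : mask (nseq (k - #|B|) false) [::] = [::] :> seq T by case: (k - _).
rewrite orbF -filter_mask mem_filter mem_enum.
by case: (boolP (i \in A)) => // /AB ->.
Qed.

Variables (W : {set L}) (x0 : L) (Lg : nat).
Hypothesis cW : contour W.
Hypothesis Dd : #|dir L| = 2 * d.
Hypothesis psi_le : psi <= d.
Hypothesis d_gt1 : 1 < d.
Hypothesis ltDLg : #|dir L| < 2 ^ Lg.
Hypothesis iso : forall C, [disjoint C & Lout] -> d <= #|C| ->
  d ^ 2 <= \sum_(x in C) #|[set e | sh e x \notin C]|.
Hypothesis Lout_W : forall v, v \in Lout -> v \notin W /\ #|crossing W v| < d.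
Hypothesis lW : two_linked (inner W).
Hypothesis x0W : x0 \in inner W.
Local Notation t := (thickness W).

Lemma near_inner v : 0 < #|crossing W v| -> exists2 x, x \in inner W & near 1 v x.
Proof.
move=> kv; have [e ev] := kk_gt0 kv; have lv := crossing_loose cW ev.
case: (boolP (v \in W)) => vW.
  exists v; last exact: near_le (near0 v).
  by rewrite !inE kv andbT -lv vW.
exists (sh e v); last exact: near_sh.
have ke : 0 < #|crossing W (sh e v)|.
  by apply/card_gt0P; exists (op e); apply: crossing_op.
rewrite !inE ke andbT par_sh negbK; move: ev; rewrite inE (negbTE vW).
by move: lv; rewrite (negbTE vW); case: (par v) => // _; case: (_ \in W).
Qed.

(** The set [Y] is quantified last because one choice for it is the defect [Gside W :\: F], known
    only once [F] is. The factor [16] is twice the jump radius [8], and [4 * #|U|] compares the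
    [d ^ 2] boundary edges of a large component with the edges at [nb U]. *)
Lemma approx_data : exists U F S, exists a b : nat,
  [/\ approx psi W F S, d * #|U| <= 72 * t * Lg,
      psi.+1 * a <= 2 * t + 6 * d * #|U|,
      psi.+1 * b <= 2 * t
    & forall Y n k, Y \subset inner W ->
        16 * (1 + #|U| + a + b + #|Y|) <= n -> 4 * #|U| <= k ->
        exists c : code n k, [/\ dec_F c x0 = F, dec_S c x0 = S & dec_Y c x0 = Y]].
Proof.
have d0 : 0 < d by apply: ltnW.
pose th := d./2.
have th0 : 0 < th by rewrite /th; lia.
have th2 : 2 * th <= d by rewrite /th; lia.
have th3 : d <= 3 * th by rewrite /th; lia.
have [U [UB cU covU]] := cover_exists (rough W th) th0 ltDLg.
have stL v : v \in Lout -> ~~ status W d v.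
  by case/Lout_W => vW kv; rewrite /status (negbTE vW) leqNgt kv.
have [Q [QB EG cE nE]] := inner_approx cW Dd th2 covU d0 stL.
have [P1 [P2 [apx cP1 cP2 nP1 [F1G nP2]]]] := refine_exists psi cW EG.
(* The constant [72] is [9 * 8]: this bound and that of the cover give
   [th ^ 2 * #|U| <= 8 * d * t * Lg], and [d <= 3 * th]. *)
have crough : th * #|rough W th| <= 2 * (2 * d * t).
  by rewrite -Dd; apply: card_many => // x; rewrite inE.
have cUd : d * #|U| <= 72 * t * Lg.
  rewrite -(leq_pmul2l d0).
  apply: (@leq_trans (9 * th * (th * #|U|))).
    rewrite [leqRHS](_ : _ = 3 * th * (3 * th) * #|U|); last by lia.
    by rewrite mulnA !leq_mul.
  apply: (@leq_trans (9 * th * (2 * #|rough W th| * Lg))); first by rewrite leq_mul.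
  have -> : 9 * th * (2 * #|rough W th| * Lg) = 18 * Lg * (th * #|rough W th|) by lia.
  have -> : d * (72 * t * Lg) = 18 * Lg * (2 * (2 * d * t)) by lia.
  by rewrite leq_mul.
exists U, (refined_F psi (evens Q) P1 P2), (refined_S psi (evens Q) P1 P2).
exists #|P1|, #|P2|; split=> //.
- exact: leq_trans cP1 cE.
- apply: leq_trans cP2 _; apply: (card_almost cW Dd psi_le d0 F1G) => y.
  by rewrite inE => /andP[].
move=> Y n k YI le_n le_k.
pose X := [set x0] :|: U :|: P1 :|: P2 :|: Y.
have sub A : A \in [:: U; P1; P2; Y] -> {subset A <= X}.
  rewrite !inE => h; apply/subsetP; move: h; rewrite /X.
  case/or4P => /eqP ->; apply/subsetP => v vA; rewrite !inE vA ?orbT //.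
have x0X : x0 \in X by rewrite !inE eqxx.
have UI u : u \in U -> exists2 x, x \in inner W & near 1 u x.
  move/(subsetP UB); rewrite inE => ku; apply: near_inner.
  exact: leq_trans ku.
have lX : linked 8 X x0.
  apply: (two_linked_linked lW x0W) => [x|z].
    rewrite inE => /andP[_ kx].
    have [u uU xu] := near_cover3 cW Dd th2 covU d0 kx.
    by exists u => //; apply: (sub U _ u uU); rewrite inE eqxx.
  rewrite !in_setU -!orbA => /or4P[|zU|zP1|/orP[zP2|zY]].
  - by rewrite inE => /eqP->; exists x0 => //; apply: near_le (near0 x0).
  - by have [x xI ux] := UI z zU; exists x => //; apply: near_le ux.
  - have [g gE zg] := nP1 z zP1; have [u uU gu] := nE g gE.
    have [x xI ux] := UI u uU; exists x => //.
    exact: (near_trans (near_trans zg gu) ux).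
  - have [y yS zy] := nP2 z zP2.
    have ky : d <= #|crossing W y|.
      move: yS; rewrite in_setD => /andP[yA]; rewrite inE => /andP[py sy].
      apply: (kk_almost Dd psi_le F1G _ sy).
      by move: yA; rewrite inE py andbT.
    have [x xI yx] := near_inner (leq_trans d0 ky).
    by exists x => //; apply: near_le (near_trans zy yx).
  - by exists z; [apply: (subsetP YI)|apply: near_le (near0 z)].
have cX : #|X| <= 1 + #|U| + #|P1| + #|P2| + #|Y|.
  rewrite /X; do 4!apply: leq_trans (leq_card_setU _ _) (leq_add _ (leqnn _)).
  by rewrite cards1.
have D0 : 0 < #|dir L| by rewrite Dd muln_gt0.
have [w wX] : exists w : n.-tuple (dir L), {subset X <= visits w x0}.
  by apply: linked_tuple D0 x0X lX _; apply: leq_trans le_n; rewrite leq_mul.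
have sel A : A \in [:: U; P1; P2; Y] -> exists m, A = selected w m x0.
  by move=> /sub AX; apply: selectedP => y /AX/wX.
have [m1 eU] := sel U (mem_nth U (isT : 0 < size [:: U; P1; P2; Y])).
have [m2 eP1] := sel P1 (mem_nth U (isT : 1 < size [:: U; P1; P2; Y])).
have [m3 eP2] := sel P2 (mem_nth U (isT : 2 < size [:: U; P1; P2; Y])).
have [m4 eY] := sel Y (mem_nth U (isT : 3 < size [:: U; P1; P2; Y])).
have ck : #|bigcomps Lout d U| <= k.
  apply: leq_trans le_k; rewrite -(leq_pmul2l (_ : 0 < d ^ 2)) ?expn_gt0 ?d0 //.
  rewrite (leq_trans (card_bigcomps U iso)) //.
  rewrite (leq_trans (leq_mul (leqnn _) (card_nb U))) // Dd; lia.
have [q eQ] := subset_mask QB ck.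
pose c : code n k := (w, (m1, m2, m3, m4), q); exists c.
have eUc : dec_U c x0 = U by rewrite /dec_U /= -eU.
rewrite /dec_F /dec_S /dec_Y /dec_Q eUc /= -eQ.
by rewrite /dec_P1 /dec_P2 /= -eP1 -eP2 -eY.
Qed.

End Codes.

Definition indep (L : lattice_graph) (I : {set L}) :=
  forall x e, x \in I -> sh e x \notin I.

(** What the translation needs of a region: no edge joins a particle inside to a vacancy outside
    that could become occupied by it, and no particle outside touches the region. *)
Definition enclosed (L : lattice_graph) (W I : {set L}) :=
  [/\ forall v e, (v \in W) = par v -> (sh e v \in W) = (v \in W),
      forall v e, v \in I -> v \in W -> ~~ par v -> sh e v \in W
    & forall z e, z \in I -> par z -> sh e z \in W -> z \in W].

(** * The region enclosed by an odd cluster *)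

Section Fill.
Variable L : lattice_graph.
Implicit Types (x y z v w : L) (e f s : dir L) (X Y Z K I W : {set L}).
Variables (o v0 : L).

Definition odd_rel I : rel L :=
  [rel x y | [&& y \in I, par y & [exists e, exists f, sh f (sh e x) == y]]].

Definition odd_cluster I : {set L} := [set y | connect (odd_rel I) v0 y].
Definition hull I := odd_cluster I :|: nb (odd_cluster I).
Definition region I := ~: comp (hull I) o.

Variable Lout : {set L}.
Hypothesis Lout_comp : forall K, [disjoint K & Lout] -> Lout \subset comp K o.
Hypothesis o_out : o \in Lout.
Hypothesis o_nbr : exists e, sh e o \in Lout.
Hypothesis whole : forall Z, (forall x e, x \in Z -> sh e x \in Z) ->
  forall x, x \in Z -> o \in Z.
Hypothesis par_v0 : par v0.

Section Config.
Variable I : {set L}.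
Hypothesis iI : indep I.
Hypothesis v0I : v0 \in I.
Hypothesis safe : forall z, z \in I -> par z ->
  z \notin Lout /\ forall e, sh e z \notin Lout.
Local Notation RO := (odd_cluster I).
Local Notation W := (region I).

Lemma odd_clusterP y : y \in RO -> (y \in I) /\ par y.
Proof.
rewrite inE => /connectP[p pv ->] {y}; case/lastP: p pv => [|p y]; first by [].
by rewrite rcons_path last_rcons => /andP[_ /and3P[]].
Qed.

Lemma odd_cluster_step x y e f : x \in RO -> y \in I -> par y ->
  sh f (sh e x) = y -> y \in RO.
Proof.
rewrite !inE => xR yI py xy; apply: connect_trans xR (connect1 _).
apply/and3P; split=> //.
by apply/existsP; exists e; apply/existsP; exists f; apply/eqP.
Qed.

Lemma odd_cluster0 : v0 \in RO. Proof. by rewrite inE connect0. Qed.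

Lemma nb_par v : v \in nb RO -> ~~ par v.
Proof.
by case/nbP=> e /odd_clusterP[_]; rewrite par_sh.
Qed.

Lemma hull_odd v : par v -> (v \in hull I) = (v \in RO).
Proof.
by move=> pv; rewrite in_setU orbC (contraTF (@nb_par v) pv).
Qed.

Lemma hull_even v : ~~ par v -> (v \in hull I) = (v \in nb RO).
Proof.
move=> pv; rewrite in_setU; case: (boolP (v \in RO)) => // /odd_clusterP[_].
by rewrite (negbTE pv).
Qed.

Lemma hull_Lout : [disjoint hull I & Lout].
Proof.
apply/pred0P => v /=; apply/negP => /andP[+ vL]; rewrite in_setU => /orP[].
  by move=> /odd_clusterP[vI pv]; have [] := safe vI pv; rewrite vL.
case/nbP=> e /odd_clusterP[wI pw]; have [_ /(_ (op e))] := safe wI pw.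
by rewrite shK vL.
Qed.

Lemma region_Lout : [disjoint W & Lout].
Proof.
apply/pred0P => v /=; apply/negP => /andP[]; rewrite inE => /negP vo vL.
by apply: vo; apply: (subsetP (Lout_comp hull_Lout)).
Qed.

Lemma o_hull : o \notin hull I.
Proof. by apply: contraTN o_out => oh; rewrite (disjointFr hull_Lout). Qed.

Lemma hull_region : hull I \subset W.
Proof.
apply/subsetP => v vh; rewrite inE; apply: contraTN vh; exact: comp_uncovered o_hull.
Qed.

Lemma out_hull v : v \notin W -> v \notin hull I.
Proof. by apply: contraNN; apply: (subsetP hull_region). Qed.

Lemma out_step v e : v \notin W -> sh e v \notin hull I -> sh e v \notin W.
Proof.
move=> vW eh; have vo : v \in comp (hull I) o by move: vW; rewrite in_setC negbK.
by rewrite in_setC negbK -(comp_eq vo); apply: comp_sh; first exact: out_hull.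
Qed.

Lemma boundary_hull v e : v \in W -> sh e v \notin W -> v \in hull I.
Proof.
move=> vW eW; apply: contraTT vW => vh.
by rewrite -(shK e v); apply: out_step; rewrite ?shK.
Qed.

Lemma v0_region : v0 \in W.
Proof. by apply: (subsetP hull_region); rewrite in_setU odd_cluster0. Qed.

Lemma odd_nb v e : v \in RO -> sh e v \in W.
Proof.
by move=> vR; apply: (subsetP hull_region); rewrite in_setU nb_sh ?orbT.
Qed.

(** Edges leave the region only from the hull, and an odd vertex of the hull is in the cluster,
    whose neighbours belong to the hull by construction. *)
Lemma region_tight v e : (v \in W) = par v -> (sh e v \in W) = (v \in W).
Proof.
case: (boolP (v \in W)) => vW pv.
  apply: contraT => eW; have := boundary_hull vW eW.
  by rewrite hull_odd // => /(@odd_nb _ e); rewrite (negbTE eW).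
apply: contraTF isT => eW; have ph : par (sh e v) by rewrite par_sh -pv.
have : sh e v \in hull I by apply: (@boundary_hull _ (op e)); rewrite ?shK.
rewrite hull_odd // => eR; have := odd_nb (op e) eR; rewrite shK.
by rewrite (negbTE vW).
Qed.

Lemma region_loose v : (v \in W) = ~~ par v -> exists e, (sh e v \in W) = (v \in W).
Proof.
case: (boolP (v \in W)) => vW pv.
  case: (boolP (v \in hull I)) => [|vh].
    rewrite hull_even -?pv // => /nbP[e eR]; exists e.
    by apply: (subsetP hull_region); rewrite in_setU eR.
  (* Any direction will do, since a vertex of the region off the hull has no edge leaving the
     region. *)
  have [e _] := o_nbr; exists e; apply: contraT => eW.
  by rewrite (boundary_hull vW eW) in vh.
(* The first step of a path to [o] provides the neighbour, except at [o] itself, where a neighbour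
   in [Lout] is used. *)
case: (eqVneq v o) => [->|vo].
  have [e eL] := o_nbr; exists e; apply/negbTE.
  by apply: contraTN eL => eW; rewrite (disjointFr region_Lout).
have : connect (uncovered_rel (hull I)) v o.
  by rewrite uncovered_sym; move: vW; rewrite !inE negbK.
case/connectP=> -[/= _ ov|w p /= /andP[/and3P[_ wh /existsP[e /eqP ew]] _ _]].
  by rewrite ov eqxx in vo.
by exists e; apply/negbTE/out_step; rewrite ?ew.
Qed.

Lemma region_contour : contour W.
Proof. by split=> *; [apply: region_tight|apply: region_loose]. Qed.

(** An even particle of the region with a neighbour outside would be in the hull, hence next to an
    odd particle. An odd particle next to the region touches a neighbour of the cluster, so it is
    two steps from the cluster and belongs to it. *)
Lemma region_enclosed : enclosed W I.
Proof.
split=> [v e|v e vI vW pv|z e zI pz eW]; first exact: region_tight.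
  apply: contraT => eW; have := boundary_hull vW eW.
  rewrite hull_even // => /nbP[f /odd_clusterP[fI _]].
  by rewrite (negbTE (iI _ vI)) in fI.
apply: contraT => zW; have : sh e z \in hull I.
  by apply: (@boundary_hull _ (op e)); rewrite ?shK.
rewrite hull_even ?par_sh ?pz // => /nbP[f fR].
have := @odd_cluster_step _ z (op f) (op e) fR zI pz.
rewrite !shK => /(_ erefl) zR; case/negP: zW.
by apply: (subsetP hull_region); rewrite in_setU zR.
Qed.

Lemma region_conn Z : Z \subset W ->
    (forall x e, x \in Z -> sh e x \in W -> sh e x \in Z) ->
  v0 \notin Z -> Z = set0.
Proof.
move=> /subsetP ZW cZ v0Z.
have ROZ x : x \in RO -> x \notin Z.
  rewrite inE => /connectP[p pv ->] {x}.
  suff G y : y \in RO -> path (odd_rel I) y p -> y \notin Z -> last y p \notin Z.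
    by apply: G; rewrite ?odd_cluster0.
  elim: p y {pv} => //= w p IH y yR /andP[+ pw] yZ.
  case/and3P=> wI pyw /existsP[e /existsP[f /eqP eyw]].
  apply: IH pw _; first by apply: odd_cluster_step eyw.
  apply: contraNN yZ => wZ.
  have mW : sh e y \in W by apply: odd_nb.
  have mZ : sh e y \in Z by rewrite -(shK f (sh e y)); apply: cZ; rewrite ?eyw ?shK // -eyw shK.
  by rewrite -(shK e y); apply: cZ => //; rewrite shK; apply: (subsetP hull_region); rewrite in_setU yR.
have hZ x : x \in hull I -> x \notin Z.
  rewrite in_setU => /orP[/ROZ //|/nbP[e eR]].
  apply: contraTN (ROZ _ eR) => xZ; rewrite negbK; apply: cZ => //.
  by apply: (subsetP hull_region); rewrite in_setU eR.
apply/setP => z; rewrite in_set0; apply/negbTE/negP => zZ.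
have : o \in Z.
  apply: whole zZ => x e xZ; apply: cZ => //.
  apply: contraTT xZ => eW; apply: contraL eW => xZ.
  by rewrite negbK; apply: contraT => eW; have := hZ x (boundary_hull (ZW _ xZ) eW); rewrite xZ.
by move=> /ZW; rewrite inE comp_refl.
Qed.

Lemma out_conn Z : (forall x, x \in Z -> x \notin W) ->
    (forall x e, x \in Z -> sh e x \notin W -> sh e x \in Z) ->
  o \notin Z -> Z = set0.
Proof.
move=> ZW cZ oZ; apply/setP => z; rewrite in_set0.
apply: contraNF oZ => zZ.
have : connect (uncovered_rel (hull I)) z o.
  by rewrite uncovered_sym; move: (ZW z zZ); rewrite !inE negbK.
case/connectP=> p; elim: p z zZ => [z zZ _ -> //|w p IH z zZ /=].
case/andP=> /and3P[_ wh /existsP[e /eqP ew]] pw op; apply: IH pw op.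
by rewrite -ew; apply: cZ => //; apply: out_step; rewrite ?ew ?ZW.
Qed.

End Config.

(** This lets a decoder identify the region: it depends only on the cluster, and both clusters grow
    inside [S], where the configurations agree. *)
Lemma region_eq I1 I2 (F S : {set L}) :
    odd_cluster I1 \subset S -> odd_cluster I2 \subset S ->
    {in S :|: F, I1 =i I2} ->
  region I1 = region I2.
Proof.
move=> S1 S2 agree.
have sub (I J : {set L}) : odd_cluster I \subset S ->
    {in S :|: F, I =i J} -> odd_cluster I \subset odd_cluster J.
  move=> SI IJ; apply/subsetP => y; rewrite inE => /connectP[p pv ->] {y}.
  suff G y : y \in odd_cluster I -> y \in odd_cluster J -> path (odd_rel I) y p ->
      last y p \in odd_cluster J.
    by apply: G; rewrite ?odd_cluster0.
  elim: p y {pv} => //= w p IH y yI yJ /andP[yw pw].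
  have wI : w \in odd_cluster I.
    by move: yI; rewrite !inE => yI; apply: connect_trans yI (connect1 yw).
  apply: IH => //; move: yJ; rewrite !inE => yJ; apply: connect_trans yJ (connect1 _).
  move: yw => /and3P[wI' pw' ew]; apply/and3P; split=> //.
  by rewrite -IJ // in_setU (subsetP SI).
rewrite /region /hull; suff -> : odd_cluster I1 = odd_cluster I2 by [].
apply/eqP; rewrite eqEsubset !sub // => v vS; by rewrite agree.
Qed.

End Fill.

(** * The torus *)

Section TorusDef.
Variables (d k : nat) (b : bool).
Local Notation n := k.*2.+4.
(** An even side makes parity consistent across the wrap-around, and a side of at least [3] keeps
    opposite unit steps distinct. *)
Definition torus : Type := {ffun 'I_d -> 'I_n}.
HB.instance Definition _ := Finite.on torus.
Implicit Types (x y : torus) (e f : 'I_d * bool).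

Definition turn (up : bool) (a : 'I_n) : 'I_n := if up then ordS a else ord_pred a.

Definition tsh e x : torus :=
  [ffun j => if j == e.1 then turn e.2 (x j) else x j].
Definition top e := (e.1, ~~ e.2).
Definition tpar x := odd (\sum_j x j) (+) b.

Lemma turnK up : cancel (turn up) (turn (~~ up)).
Proof. by case: up; [apply: ordSK|apply: ord_predK]. Qed.

Lemma tshK e : cancel (tsh e) (tsh (top e)).
Proof.
move=> x; apply/ffunP => j; rewrite !ffunE /=.
by case: eqP => // _; rewrite turnK.
Qed.

Lemma topK : involutive top. Proof. by case=> i c; rewrite /top negbK. Qed.

Lemma turn_comm c c' a : turn c (turn c' a) = turn c' (turn c a).
Proof. by case: c c' => [] [] //=; rewrite ordSK ord_predK. Qed.

Lemma tsh_comm e f x : tsh e (tsh f x) = tsh f (tsh e x).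
Proof.
apply/ffunP => j; rewrite !ffunE.
by case: (j == e.1); case: (j == f.1) => //; rewrite turn_comm.
Qed.

Lemma val_up (a : 'I_n) : turn true a = (if a == n.-1 :> nat then 0 else a.+1) :> nat.
Proof.
have := ltn_ord a; rewrite /=; case: eqP => [->|ne lt]; first by rewrite modnn.
by rewrite modn_small //; lia.
Qed.

Lemma val_down (a : 'I_n) : turn false a = (if a == 0 :> nat then n.-1 else a.-1) :> nat.
Proof.
have := ltn_ord a; rewrite /=; case: eqP => [->|ne lt]; first by rewrite add0n modn_small.
have -> : (a + n).-1 = a.-1 + n by lia.
by rewrite modnDr modn_small; lia.
Qed.

Lemma odd_turn c (a : 'I_n) : odd (turn c a) = ~~ odd a.
Proof.
case: c; first by rewrite val_up; case: eqP => [->|//]; rewrite /= odd_double.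
rewrite val_down; case: eqP => [->|]; first by rewrite /= odd_double.
by case: (nat_of_ord a) => //= m _; rewrite negbK.
Qed.

Lemma tpar_tsh e x : tpar (tsh e x) = ~~ tpar x.
Proof.
rewrite /tpar (bigD1 e.1) //= [in RHS](bigD1 e.1) //= !oddD ffunE eqxx odd_turn.
rewrite (eq_bigr (fun j => x j : nat)) ?addNb //.
by move=> j /negbTE je; rewrite ffunE je.
Qed.

Lemma turn_inj c c' (a : 'I_n) : turn c a = turn c' a -> c = c'.
Proof.
have ne : turn true a <> turn false a.
  move=> /(congr1 (@nat_of_ord _)); rewrite val_up val_down.
  by have := ltn_ord a; do 2!case: eqP; lia.
by case: c; case: c' => // E; case: ne; rewrite E.
Qed.

Lemma turn_neq c (a : 'I_n) : turn c a != a.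
Proof.
by apply/eqP => /(congr1 (fun a : 'I_n => odd a)); rewrite odd_turn; case: odd.
Qed.

Lemma tsh_injl x e f : tsh e x = tsh f x -> e = f.
Proof.
case: e f => [i c] [j c'] /ffunP E; have := E i; rewrite !ffunE /= eqxx.
case: eqP => [-> /turn_inj -> //|_ /eqP].
by rewrite (negbTE (turn_neq _ _)).
Qed.

Definition torus_graph : lattice_graph :=
  LatticeGraph tsh_comm tshK topK tpar_tsh tsh_injl.

End TorusDef.

Section TorusGeometry.
Variables (d k : nat) (b : bool).
Local Notation n := k.*2.+4.
Local Notation L := (torus_graph d k b).
Implicit Types (x y z v : L) (e f : dir L) (i j : 'I_d) (C Z : {set L}).

Definition tcoord x i : nat := (x : torus d k) i.

Lemma coord_lt x i : tcoord x i < n. Proof. exact: ltn_ord. Qed.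

Lemma coord_inj x y : (forall i, tcoord x i = tcoord y i) -> x = y.
Proof. by move=> E; apply/ffunP => i; apply: val_inj; apply: E. Qed.

Lemma coord_sh e x j : tcoord (sh e x) j =
  if j == e.1 then (if e.2 then (if tcoord x j == n.-1 then 0 else (tcoord x j).+1)
                    else (if tcoord x j == 0 then n.-1 else (tcoord x j).-1))
  else tcoord x j.
Proof.
rewrite /tcoord /sh /= ffunE; case: eqP => // _.
by case: e.2; rewrite ?val_up ?val_down.
Qed.

Definition up i : dir L := (i, true).
Definition down i : dir L := (i, false).

Lemma shKd i x : sh (up i) (sh (down i) x) = x.
Proof. exact: (@shK L (down i)). Qed.

Lemma shKu i x : sh (down i) (sh (up i) x) = x.
Proof. exact: (@shK L (up i)). Qed.

Lemma card_dir : #|dir L| = 2 * d.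
Proof. by rewrite card_prod card_ord card_bool mulnC. Qed.

Lemma card_dir_coord i : #|[set e : dir L | e.1 == i]| <= 2.
Proof.
apply: (@leq_trans #|[set up i; down i]|); last by rewrite cards2; case: (_ == _).
apply: subset_leq_card; apply/subsetP => -[j c]; rewrite !inE /= => /eqP ->.
by case: c; rewrite eqxx ?orbT.
Qed.

Lemma sum_deg_split C C1 C2 : [disjoint C1 & C2] -> C = C1 :|: C2 ->
  \sum_(x in C) #|[set e | sh e x \in C]| =
  \sum_(x in C1) #|[set e | sh e x \in C1]| + \sum_(x in C2) #|[set e | sh e x \in C2]|
  + 2 * \sum_(x in C1) #|[set e | sh e x \in C2]|.
Proof.
move=> dj ->.
have split x : #|[set e | sh e x \in C1 :|: C2]| =
    #|[set e | sh e x \in C1]| + #|[set e | sh e x \in C2]|.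
  rewrite -cardsUI (_ : _ :&: _ = set0) ?cards0 ?addn0.
    by apply: eq_card => e; rewrite !inE.
  by apply/setP => e; rewrite !inE; case: (boolP (_ \in C1)) => // /(disjointFr dj) ->.
rewrite (eq_bigr _ (fun x _ => split x)) (eq_bigl [predU C1 & C2]) => [|x]; last by rewrite !inE.
rewrite bigU //= !big_split /= (sum_dirs C2 C1).
by rewrite mul2n -addnn -!addnA; congr (_ + _); rewrite [RHS]addnC -!addnA.
Qed.

(* Cutting [C] along one coordinate loses at most two edges per vertex of the
   smaller part, whose size is at most half that of [C]. *)
Lemma inner_degree k0 C : #|C| <= 2 ^ k0 ->
  \sum_(x in C) #|[set e | sh e x \in C]| <= 4 * k0 * #|C|.
Proof.
have [m] := ubnP #|C|; elim: m C k0 => // m IH C k0 ltm le2.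
case: (leqP #|C| 1) => [C1|].
  rewrite big1 // => x xC; apply: eq_card0 => e; rewrite !inE; apply/negP => eC.
  have /card_le1_eqP/(_ _ _ xC eC) E := C1.
  by move: (congr1 (@par L) E); rewrite par_sh; case: (par x).
move=> C2; have /card_gt1P[x [y [xC yC xy]]] := C2.
have [i xyi] : exists i, tcoord x i != tcoord y i.
  apply/existsP; apply: contraR xy; rewrite negb_exists => /forallP E.
  by apply/eqP/coord_inj => i; have := E i; rewrite negbK => /eqP.
pose A := [set z in C | tcoord z i == tcoord x i].
pose B := [set z in C | tcoord z i != tcoord x i].
have dAB : [disjoint A & B].
  by apply/pred0P => z /=; rewrite !inE; case: eqP; rewrite ?andbF.
have CAB : C = A :|: B.
  by apply/setP => z; rewrite !inE -andb_orr orbN andbT.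
have cAB : #|C| = #|A| + #|B|.
  rewrite CAB -cardsUI (_ : A :&: B = set0) ?cards0 ?addn0 //.
  by apply/eqP; rewrite setI_eq0.
have A0 : 0 < #|A| by apply/card_gt0P; exists x; rewrite inE xC eqxx.
have B0 : 0 < #|B| by apply/card_gt0P; exists y; rewrite inE yC eq_sym.
have cross (X Y : {set L}) : {in X & Y, forall z w, tcoord z i != tcoord w i} ->
    \sum_(z in X) #|[set e | sh e z \in Y]| <= 2 * #|X|.
  move=> XY; rewrite [leqRHS]mulnC -sum_nat_const leq_sum // => z zX.
  apply: leq_trans (card_dir_coord i); apply: subset_leq_card.
  apply/subsetP => e; rewrite !inE => eY; have := XY _ _ zX eY.
  by rewrite coord_sh [i == _]eq_sym; case: (e.1 == i) => //; rewrite eqxx.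
have cA : \sum_(z in A) #|[set e | sh e z \in B]| <= 2 * #|A|.
  by apply: cross => z w; rewrite !inE => /andP[_ /eqP ->] /andP[_]; rewrite eq_sym.
have cB : \sum_(z in A) #|[set e | sh e z \in B]| <= 2 * #|B|.
  by rewrite sum_dirs; apply: cross => z w; rewrite !inE => /andP[_ ne] /andP[_ /eqP ->].
rewrite (sum_deg_split dAB CAB).
case: k0 le2 => [|k1]; rewrite ?expnS => le2; first by lia.
have IHA := IH A k1.+1; have IHB := IH B k1.+1; rewrite !expnS in IHA IHB.
case: (leqP #|A| #|B|) => AB.
  have := IH A k1; lia.
have := IH B k1; lia.
Qed.

End TorusGeometry.

(** * Isoperimetry and the exterior layer *)

Section TorusBoundary.
Variables (d k : nat) (b : bool).
Local Notation n := k.*2.+4.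
Local Notation L := (torus_graph d k b).
Implicit Types (x y z v : L) (e f : dir L) (i j : 'I_d) (C Z W : {set L}).

(* The box of radius [M = k.+1], translated by [M], occupies the coordinates
   [0] to [2 * M] of a torus of side [2 * M + 2]: the extreme coordinates are
   those of its boundary and of the layer outside it. *)
Definition extreme (a : nat) := (a == 0) || (k.*2.+2 <= a).
Definition Lout : {set L} := [set x | [exists i, extreme (tcoord x i)]].
Definition origin : L := ([ffun=> ord0] : torus d k).

Lemma coord0 i : tcoord origin i = 0.
Proof. by rewrite /tcoord /origin ffunE. Qed.

Lemma LoutP x : reflect (exists i, extreme (tcoord x i)) (x \in Lout).
Proof. by rewrite inE; apply: existsP. Qed.

Lemma coord_gt0 C x i : [disjoint C & Lout] -> x \in C -> tcoord x i != 0.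
Proof.
move=> dC xC; apply: contraFneq (disjointFr dC xC) => x0.
by apply/LoutP; exists i; rewrite x0.
Qed.

Lemma coord_up x i j : tcoord x i != n.-1 ->
  tcoord (sh (up _ _ i) x) j = tcoord x j + (j == i).
Proof. by move=> ne; rewrite coord_sh /=; case: eqP => [->|_]; rewrite ?(negbTE ne) ?addn1 ?addn0. Qed.

Lemma coord_down x i j : tcoord x i != 0 ->
  tcoord (sh (down _ _ i) x) j = tcoord x j - (j == i).
Proof. by move=> ne; rewrite coord_sh /=; case: eqP => [->|_]; rewrite ?(negbTE ne) ?subn1 ?subn0. Qed.

Definition proj i x : L :=
  ([ffun j => if j == i then ord0 else (x : torus d k) j] : torus d k).

Lemma coord_proj i x j : tcoord (proj i x) j = if j == i then 0 else tcoord x j.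
Proof. by rewrite /tcoord /proj ffunE; case: eqP. Qed.

Lemma proj_eq i x y : proj i x = proj i y -> forall j, j != i -> tcoord x j = tcoord y j.
Proof.
by move=> E j ji; have := congr1 (fun z : L => tcoord z j) E; rewrite !coord_proj (negbTE ji).
Qed.

Lemma proj_sh i c x : proj i (sh ((i, c) : dir L) x) = proj i x.
Proof.
by apply: coord_inj => j; rewrite !coord_proj coord_sh /=; case: (j == i).
Qed.

Definition exits C e := [set x in C | sh e x \notin C].

(** Every line in direction [i] contains a point of coordinate zero, which is not in [C]. So a walk
    along the line from a point of [C] leaves [C], whichever way it goes. *)
Lemma proj_exits i c C : (forall x, x \in C -> tcoord x i != 0) ->
  #|proj i @: C| <= #|exits C (i, c)|.
Proof.
move=> C0; rewrite (leq_trans _ (leq_imset_card (proj i) _)) //.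
apply: subset_leq_card; apply/subsetP => _ /imsetP[x xC ->].
suff [y yE <-] : exists2 y, y \in exits C (i, c) & proj i y = proj i x.
  exact: imset_f.
have step m y : y \in C -> (if c then n - tcoord y i else tcoord y i) < m ->
    exists2 z, z \in exits C (i, c) & proj i z = proj i y.
  elim: m y => // m IH y yC lt.
  case: (boolP (sh ((i, c) : dir L) y \in C)) => syC; last by exists y; rewrite // inE yC.
  have [|z zE zy] := IH _ syC; last by exists z; rewrite // zy proj_sh.
  move: lt (C0 _ yC) (C0 _ syC) (coord_lt y i); rewrite coord_sh /= eqxx.
  case: (c); first by case: (_ == n.-1) => //; lia.
  by case: (tcoord y i) => //=; lia.
exact: (step _ x xC (ltnSn _)).
Qed.

Lemma sum_exits C :
  \sum_(x in C) #|[set e | sh e x \notin C]| = \sum_e #|exits C e|.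
Proof.
have E1 x : #|[set e : dir L | sh e x \notin C]| = \sum_e (sh e x \notin C : nat).
  by rewrite -sum1_card big_mkcond; apply: eq_bigr => e _; rewrite inE; case: (_ \notin _).
rewrite (eq_bigr _ (fun x _ => E1 x)) exchange_big /=; apply: eq_bigr => e _.
rewrite -sum1_card big_mkcond [RHS]big_mkcond; apply: eq_bigr => x _.
by rewrite inE; case: (x \in C); case: (_ \notin _).
Qed.

Lemma exits_le C e : #|exits C e| <= \sum_(x in C) #|[set e | sh e x \notin C]|.
Proof. by rewrite sum_exits (bigD1 e) //= leq_addr. Qed.

Lemma card_proj2 i j C : i != j -> #|C| <= #|proj i @: C| * #|proj j @: C|.
Proof.
move=> ij; rewrite -cardsX.
have inj : injective (fun x => (proj i x, proj j x)).
  move=> x y [Ei Ej]; apply: coord_inj => l.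
  case: (eqVneq l i) => [->|li]; last exact: (proj_eq Ei).
  exact: (proj_eq Ej).
rewrite -(card_imset _ inj); apply: subset_leq_card; apply/subsetP => _ /imsetP[x xC ->].
by rewrite in_setX !imset_f.
Qed.

Lemma card_le_boundary i j C : i != j -> [disjoint C & Lout] ->
  #|C| <= (\sum_(x in C) #|[set e | sh e x \notin C]|) ^ 2.
Proof.
move=> ij dC; apply: leq_trans (card_proj2 C ij) _; rewrite -mulnn.
have P l : #|proj l @: C| <= \sum_(x in C) #|[set e | sh e x \notin C]|.
  apply: leq_trans (exits_le C (up _ _ l)); apply: proj_exits => x.
  exact: coord_gt0.
by rewrite leq_mul.
Qed.

Lemma deg_split C x : #|[set e : dir L | sh e x \in C]| +
  #|[set e : dir L | sh e x \notin C]| = 2 * d.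
Proof.
rewrite -(card_dir d k b) -(cardsC [set e : dir L | sh e x \in C]).
by congr (_ + _); apply: eq_card => e; rewrite !inE.
Qed.

(** Up to size [2 ^ (d %/ 4)], the average inner degree is at most [d], so at least [d] edges per
    vertex leave [C], and [C] has at least [d] vertices. Beyond that size, two projections determine
    a point, and the boundary is at least the square root of the size. *)
Lemma boundary_large i j C : i != j -> d ^ 4 <= 2 ^ (d %/ 4) ->
    [disjoint C & Lout] -> d <= #|C| ->
  d ^ 2 <= \sum_(x in C) #|[set e | sh e x \notin C]|.
Proof.
move=> ij d4 dC dle; case: (leqP #|C| (2 ^ (d %/ 4))) => le.
  have := inner_degree le.
  have : \sum_(x in C) #|[set e | sh e x \in C]| +
      \sum_(x in C) #|[set e | sh e x \notin C]| = #|C| * (2 * d).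
    by rewrite -big_split /= -sum_nat_const; apply: eq_bigr => x _; apply: deg_split.
  move: (\sum_(x in C) _) (\sum_(x in C) _) => A B.
  have : 4 * (d %/ 4) <= d by rewrite mulnC leq_trunc_div.
  rewrite -mulnn; nia.
rewrite -leq_sqr -expnM.
by apply: leq_trans (card_le_boundary ij dC); apply: leq_trans d4 (ltnW le).
Qed.

(** Lower a coordinate other than the extreme one if possible. Otherwise all the others are zero,
    hence extreme themselves, and the first one may be lowered. *)
Lemma Lout_step x i j : i != j -> x \in Lout -> x != origin ->
  exists2 l, tcoord x l != 0 & sh (down _ _ l) x \in Lout.
Proof.
move=> ij /LoutP[l xl] xo.
case: (boolP [exists l' , (l' != l) && (tcoord x l' != 0)]) => [/existsP[l' /andP[ne nz]]|].
  exists l' => //; apply/LoutP; exists l.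
  by rewrite coord_down // eq_sym (negbTE ne) subn0.
rewrite negb_exists => /forallP zero.
have z l' : l' != l -> tcoord x l' = 0.
  by move=> ne; have := zero l'; rewrite ne negbK => /eqP.
have nz : tcoord x l != 0.
  apply: contraNneq xo => x0; apply/eqP/coord_inj => l'; rewrite coord0.
  by case: (eqVneq l' l) => [->//|/z].
exists l => //; apply/LoutP.
have [l' ne] : exists l', l' != l.
  by case: (eqVneq i l) => [<-|]; [exists j; rewrite eq_sym|exists i].
by exists l'; rewrite coord_down // z.
Qed.

Definition height x := \sum_l tcoord x l.

Lemma height_down x l : tcoord x l != 0 -> height x = (height (sh (down _ _ l) x)).+1.
Proof.
move=> nz; rewrite /height (bigD1 l) //= [in RHS](bigD1 l) //= coord_down // eqxx.
rewrite [X in _ = (_ + X).+1](eq_bigr (fun l => tcoord x l)); first by lia.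
by move=> j /negbTE jl; rewrite coord_down // jl subn0.
Qed.

Lemma Lout_connected i j (K : {set L}) : i != j -> [disjoint K & Lout] -> Lout \subset comp K origin.
Proof.
move=> ij dK; apply/subsetP => x; have [m] := ubnP (height x).
elim: m x => // m IH x ltm xL.
case: (eqVneq x origin) => [->|xo]; first exact: comp_refl.
have [l nz yL] := Lout_step ij xL xo.
rewrite -(comp_eq (IH _ _ yL)); last by rewrite (height_down nz) in ltm.
rewrite -{1}(shKd l x); apply: comp_sh; first by rewrite (disjointFl dK).
by rewrite shKd (disjointFl dK).
Qed.

Lemma torus_connected Z : (forall x e, x \in Z -> sh e x \in Z) ->
  forall x, x \in Z -> origin \in Z.
Proof.
move=> cZ x; have [m] := ubnP (height x); elim: m x => // m IH x ltm xZ.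
case: (boolP [exists l, tcoord x l != 0]) => [/existsP[l nz]|].
  by apply: IH (cZ x (down _ _ l) xZ); rewrite (height_down nz) in ltm.
rewrite negb_exists => /forallP z; suff -> : origin = x by [].
by apply: coord_inj => l; rewrite coord0; have := z l; rewrite negbK => /eqP ->.
Qed.

Lemma origin_Lout i : origin \in Lout.
Proof. by apply/LoutP; exists i; rewrite coord0. Qed.

Lemma origin_nbr i j : i != j -> exists e, sh e origin \in Lout.
Proof.
move=> ij; exists (up _ _ i); apply/LoutP; exists j.
by rewrite coord_sh /= eq_sym (negbTE ij) coord0.
Qed.

Lemma Lout_crossing W v : 2 < d -> [disjoint W & Lout] -> v \in Lout ->
  v \notin W /\ #|crossing W v| < d.
Proof.
move=> d2 dW vL; have vW : v \notin W by rewrite (disjointFl dW).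
split=> //; have /LoutP[i vi] := vL.
apply: leq_ltn_trans d2; apply: leq_trans (card_dir_coord k b i).
apply: subset_leq_card; apply/subsetP => e; rewrite !inE (negbTE vW) eqbF_neg negbK => eW.
apply: contraFT (disjointFr dW eW) => ne; apply/LoutP; exists i.
by rewrite coord_sh eq_sym (negbTE ne).
Qed.

(* The boundary edges of [W] whose inner endpoint satisfies [Q] form a cocycle
   modulo 2, because [Q] is constant across the squares of the lattice.  Its
   potential vanishes outside [W] and is constant on [W], hence so is [Q] on
   the inner boundary: that boundary is connected in steps of length two. *)
Section Potential.
Variable W : {set L}.
Variable v0 : L.
Hypothesis cW : contour W.
Hypothesis dW : [disjoint W & Lout].
Hypothesis W_conn : forall Z, Z \subset W ->
    (forall x e, x \in Z -> sh e x \in W -> sh e x \in Z) -> v0 \notin Z -> Z = set0.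
Hypothesis out_conn : forall Z, (forall x, x \in Z -> x \notin W) ->
    (forall x e, x \in Z -> sh e x \notin W -> sh e x \in Z) ->
  origin \notin Z -> Z = set0.

Variable Q : pred L.
Hypothesis Qstep : forall x e f, x \in inner W -> sh f (sh e x) \in inner W ->
  Q x -> Q (sh f (sh e x)).

Definition flux x e :=
  if (x \in W) != (sh e x \in W) then Q (if x \in W then x else sh e x) else false.

Lemma flux_op x e : flux (sh e x) (op e) = flux x e.
Proof. by rewrite /flux shK eq_sym; case: (x \in W); case: (_ \in W). Qed.

Lemma Q_square x e f : ~~ par x -> x \in W -> sh f (sh e x) \in W ->
  sh e x \notin W -> Q x = Q (sh f (sh e x)).
Proof.
move=> px xW yW eW; have xI : x \in inner W.
  by rewrite !inE xW px; apply/card_gt0P; exists e; rewrite inE xW (negbTE eW).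
have yI : sh f (sh e x) \in inner W.
  rewrite !inE yW !par_sh negbK (negbTE px); apply/card_gt0P; exists (op f).
  by rewrite inE shK yW (negbTE eW).
apply/idP/idP => [|Qy]; first exact: Qstep.
have := @Qstep _ (op f) (op e) yI; rewrite !shK; exact.
Qed.

Lemma flux_square_even x e f : ~~ par x ->
  flux x e (+) flux (sh e x) f = flux x f (+) flux (sh f x) e.
Proof.
move=> px; rewrite /flux (sh_comm e f x).
have T v g : ~~ par v -> sh g v \in W -> v \in W.
  move=> pv; apply: contraTT => vW.
  by rewrite cW.1 // (negbTE vW) (negbTE pv).
have py : ~~ par (sh f (sh e x)) by rewrite !par_sh negbK.
have i1 := T x e px; have i2 := T x f px.
have i3 : sh e x \in W -> sh f (sh e x) \in W.
  by move=> eW; apply: (T _ (op f) py); rewrite shK.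
have i4 : sh f x \in W -> sh f (sh e x) \in W.
  by move=> fW; apply: (T _ (op e) py); rewrite sh_comm shK.
have Qe := @Q_square x e f px.
have Qf : x \in W -> sh f (sh e x) \in W -> sh f x \notin W -> Q x = Q (sh f (sh e x)).
  by move=> ? ?; rewrite -(sh_comm e f x); apply: Q_square; rewrite // sh_comm.
move: (sh f (sh e x)) i3 i4 Qe Qf => y i3 i4 Qe Qf; move: i1 i2 i3 i4 Qe Qf.
case: (x \in W); case: (y \in W); case: (sh e x \in W); case: (sh f x \in W) => //=;
  try (by move=> /(_ isT)); try (by move=> _ /(_ isT)); try (by move=> _ _ /(_ isT));
  try (by move=> _ _ _ /(_ isT)).
  by move=> _ _ _ _ _ /(_ isT isT isT) ->; rewrite addbb.
by move=> _ _ _ _ /(_ isT isT isT) -> _; rewrite addbb.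
Qed.

Lemma flux_square x e f :
  flux x e (+) flux (sh e x) f = flux x f (+) flux (sh f x) e.
Proof.
case: (boolP (par x)) => px; last exact: flux_square_even.
have := @flux_square_even (sh e x) (op e) f; rewrite par_sh px => /(_ isT).
rewrite shK -{1}(flux_op x e) -(flux_op (sh f x) e) -(sh_comm e f x).
by do 4!case: (flux _ _).
Qed.

Fixpoint potential m x : bool :=
  if m is m'.+1 then
    if [pick l | tcoord x l != 0] is Some l
    then potential m' (sh (down _ _ l) x) (+) flux x (down _ _ l) else false
  else false.

Arguments potential : simpl never.

Lemma potentialS m x : potential m.+1 x =
  if [pick l | tcoord x l != 0] is Some l
  then potential m (sh (down _ _ l) x) (+) flux x (down _ _ l) else false.
Proof. by []. Qed.

(** The potential does not depend on the coordinate picked: two descents can be prolonged to a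
    common vertex, and the flux around the square between them vanishes. *)
Lemma potential_down m x l : height x = m.+1 -> tcoord x l != 0 ->
  potential m.+1 x = potential m (sh (down _ _ l) x) (+) flux x (down _ _ l).
Proof.
elim: m x l => [|m IH] x l hx nz; rewrite potentialS; case: pickP => [i iz|/(_ l)];
  rewrite ?nz //.
  case: (eqVneq i l) => [->//|il]; have := height_down nz; rewrite hx => -[h0].
  have : tcoord (sh (down k b l) x) i == 0.
    by move/esym/eqP: h0; rewrite sum_nat_eq0 => /forallP/(_ i).
  by rewrite coord_down // (negbTE il) subn0 (negbTE iz).
case: (eqVneq i l) => [->//|il].
have iz' : tcoord (sh (down k b l) x) i != 0 by rewrite coord_down // (negbTE il) subn0.
have lz' : tcoord (sh (down k b i) x) l != 0.
  by rewrite coord_down // [l == i]eq_sym (negbTE il) subn0.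
have hi : height (sh (down k b i) x) = m.+1 by have := height_down iz; rewrite hx => -[].
have hl : height (sh (down k b l) x) = m.+1 by have := height_down nz; rewrite hx => -[].
rewrite (IH _ _ hi lz') (IH _ _ hl iz') (sh_comm (down k b l)) -!addbA; congr (_ (+) _).
by have := flux_square x (down k b i) (down k b l); do 4!case: (flux _ _).
Qed.

Definition pot x := potential (height x) x.

Lemma pot_down x l : tcoord x l != 0 ->
  pot x = pot (sh (down _ _ l) x) (+) flux x (down _ _ l).
Proof. by move=> nz; rewrite /pot (height_down nz) (potential_down _ nz) // (height_down nz). Qed.

(** Steps that wrap around are excluded: the cycles of the torus winding around it are not made of
    squares, so the square identity alone gives no control of the flux along them. *)
Lemma pot_sh x e : (e.2 -> tcoord x e.1 != n.-1) -> (~~ e.2 -> tcoord x e.1 != 0) ->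
  pot (sh e x) = pot x (+) flux x e.
Proof.
case: e => l [] /= up_ok down_ok.
  have nz : tcoord (sh (up k b l) x) l != 0 by rewrite coord_up ?eqxx ?addn1 ?up_ok.
  rewrite (pot_down nz) shKu -[flux x _]flux_op; congr (_ (+) flux _ _).
by rewrite (@pot_down x l) ?down_ok // -addbA addbb addbF.
Qed.

Lemma pot_Lout i j x : i != j -> x \in Lout -> pot x = false.
Proof.
move=> ij; have [m] := ubnP (height x); elim: m x => // m IH x ltm xL.
case: (eqVneq x origin) => [->|xo].
  rewrite /pot (_ : height origin = 0) //; apply: big1 => l _; exact: coord0.
have [l nz yL] := Lout_step ij xL xo.
rewrite (pot_down nz) IH //; last by rewrite (height_down nz) in ltm.
by rewrite /flux !(disjointFl dW).
Qed.

Lemma pot_region x : v0 \in W -> x \in W -> pot x = pot v0.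
Proof.
move=> v0W xW; pose Z := [set y in W | pot y != pot v0].
have Z0 : Z = set0.
  apply: W_conn => [|y e|]; last by rewrite inE eqxx andbF.
    by apply/subsetP => y; rewrite inE => /andP[].
  rewrite !inE => /andP[yW ne] eW; rewrite eW /=.
  rewrite pot_sh; first by rewrite /flux yW eW addbF.
    move=> e2; have := coord_gt0 e.1 dW eW; rewrite coord_sh eqxx e2.
    by case: (_ == n.-1).
  by move=> _; apply: coord_gt0 yW.
apply/eqP; apply: contraT => ne; have : x \in Z by rewrite inE xW.
by rewrite Z0 inE.
Qed.

Lemma pot_out i j x : i != j -> x \notin W -> pot x = false.
Proof.
move=> ij xW; pose Z := [set y in ~: W | pot y].
have Z0 : Z = set0.
  apply: out_conn => [y|y e|]; rewrite !inE; first by case/andP.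
    move=> /andP[yW py] eW; rewrite eW /=.
    case: (boolP (y \in Lout)) => yL; first by rewrite (pot_Lout ij yL) in py.
    have ext l : ~~ extreme (tcoord y l) by apply: contraNN yL => ?; apply/LoutP; exists l.
    have := ext e.1; rewrite /extreme negb_or -ltnNge => /andP[y0 yn].
    rewrite pot_sh // ?py /flux ?(negbTE yW) ?(negbTE eW) //.
    by move=> _; rewrite neq_ltn; apply/orP; left; apply: leq_trans yn _.
  by rewrite (pot_Lout ij) ?andbF // (origin_Lout i).
apply: contraTF isT => px; have : x \in Z by rewrite !inE xW.
by rewrite Z0 inE.
Qed.

Lemma inner_pot i j x : i != j -> v0 \in W -> x \in inner W -> Q x = pot v0.
Proof.
move=> ij v0W; rewrite !inE => /andP[/andP[xW _] /card_gt0P[e]].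
rewrite inE xW eqb_id => eW; have := pot_out ij eW.
rewrite pot_sh ?(pot_region v0W xW); first last.
- by move=> _; apply: coord_gt0 xW.
- move=> e2; apply/eqP => xn.
  case/negP: (negbT (disjointFr dW xW)); apply/LoutP; exists e.1.
  by rewrite /extreme xn /= leqnSn.
by rewrite /flux xW (negbTE eW) /=; case: (pot v0); case: (Q x).
Qed.

End Potential.

End TorusBoundary.

Section OddLinked.
Variable L : lattice_graph.
Variables (W : {set L}) (v0 : L).
Hypothesis cW : contour W.
Hypothesis W_conn : forall Z : {set L}, Z \subset W ->
    (forall x e, x \in Z -> sh e x \in W -> sh e x \in Z) -> v0 \notin Z -> Z = set0.

(** If no odd vertex of [W] outside [Y] were two steps from [Y], these vertices and their neighbours
    would be closed under steps in [W] without containing [v0]. *)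
Lemma Aside_linked : par v0 -> linked 2 (Aside W) v0.
Proof.
move=> pv0 Y v0Y /properP[_ [z zA zY]].
pose N := Aside W :\: Y.
suff : ~~ [disjoint N & nb (nb Y)].
  case/pred0Pn => u /= /andP[uN /nbP[e /nbP[f fY]]].
  exists (sh f (sh e u)), u; split=> //.
  by apply: near_sym; exists [:: e; f].
apply/negP => /pred0P dj.
have NP x : x \in N -> [/\ x \in W, par x & x \notin Y].
  by rewrite !inE => /andP[-> /andP[-> ->]].
have Z0 : N :|: nb N = set0.
  apply: W_conn.
  - rewrite subUset; apply/andP; split; apply/subsetP => x; first by case/NP.
    by case/nbP=> e /NP[eW pe _]; rewrite -(shK e x) cW.1 // eW pe.
  - move=> x e; rewrite in_setU => /orP[xN _|/nbP[f fN] eW].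
      by rewrite in_setU nb_sh ?orbT.
    rewrite in_setU; apply/orP; left; have [fW pf _] := NP _ fN.
    have pe : par (sh e x) by move: pf; rewrite !par_sh.
    rewrite in_setD inE eW pe !andbT; apply/negP => eY.
    have /= := dj (sh f x); rewrite fN /= => /negP[].
    apply/nbP; exists (op f); rewrite shK; apply/nbP; by exists e.
  rewrite in_setU negb_or inE v0Y /=; apply/nbP => -[e /NP[_]].
  by rewrite par_sh pv0.
have : z \in N :|: nb N by rewrite in_setU in_setD zA zY.
by rewrite Z0 inE.
Qed.

End OddLinked.

(** * Volume, thickness and base point of a contour *)

Section TorusContour.
Variables (d k : nat) (b : bool).
Local Notation L := (torus_graph d k b).
Implicit Types (x y z v : L) (e f : dir L) (i j : 'I_d).
Variables (W : {set L}) (v0 : L) (i j : 'I_d).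
Hypothesis ij : i != j.
Hypothesis cW : contour W.
Hypothesis dW : [disjoint W & Lout d k b].
Local Notation t := (thickness W).

Lemma sum_boundary : \sum_(x in W) #|[set e | sh e x \notin W]| = 2 * d * t.
Proof.
rewrite -(card_dir d k b) -(sum_crossing_thickness cW).
have E x : x \in W -> #|[set e | sh e x \notin W]| = #|crossing W x|.
  by move=> xW; apply: eq_card => e; rewrite !inE xW eqb_id.
rewrite (eq_bigr _ E) (bigID (fun x : L => par x)) /= big1 ?add0n.
  by apply: eq_bigl => x; rewrite inE.
by move=> x /andP[xW px]; rewrite (tight_kk0 cW) // xW px.
Qed.

Lemma sum_inner : \sum_(x in W) #|[set e | sh e x \in W]| + 2 * d * t = 2 * d * #|W|.
Proof.
rewrite -sum_boundary -big_split /= mulnC -sum_nat_const.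
by apply: eq_bigr => x _; apply: deg_split.
Qed.

Lemma card_region : #|W| <= (2 * d * t) ^ 2.
Proof. by rewrite -sum_boundary; apply: card_le_boundary ij dW. Qed.

(** By [card_W], [#|W|] minus the thickness is twice [#|Aside W|], so the degrees inside [W] sum to
    [4 * d * #|Aside W|]; [inner_degree] bounds this sum by [4 * n * #|W|]. *)
Lemma small_volume n : #|W| <= 2 ^ n -> d * #|Aside W| <= n * #|W|.
Proof.
move=> le; have D0 : 0 < #|dir L|.
  by rewrite card_dir; case: (d) (i) => [[]|].
have := inner_degree le; have := sum_inner; have := card_W cW D0.
rewrite -/t; move: (\sum_(x in W) _) (#|W|) (#|Aside W|) t => s w a tt.
lia.
Qed.

Lemma card_exits_proj l c (P : {set L}) : P \subset W ->
  {in P &, forall x y, tcoord x l = tcoord y l} -> #|P| <= #|exits W (l, c)|.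
Proof.
move=> PW Pl; apply: leq_trans (proj_exits c _) => [|x]; last exact: coord_gt0.
apply: (@leq_trans #|proj l @: P|); last exact: subset_leq_card (imsetS _ PW).
rewrite card_in_imset // => x y xP yP E; apply: coord_inj => l'.
by case: (eqVneq l' l) => [->|ne]; [apply: Pl|apply: (proj_eq E)].
Qed.

(** For each axis, [v0] and its [2 * d - 2] neighbours off that axis lie in [W] on distinct parallel
    lines, and each line exits [W] both ways. Summing over the directions gives [2 * d] times the
    claim. *)
Lemma thickness_ge : v0 \in Aside W -> 2 * d - 1 <= t.
Proof.
rewrite inE => /andP[vW pv].
have d0 : 0 < 2 * d by case: (d) (i) => [[]|].
have ex (e : dir L) : 2 * d - 1 <= #|exits W e|.
  case: e => l c; pose E := [set f : dir L | f.1 != l].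
  pose P := v0 |: [set sh f v0 | f in E].
  have cP : 2 * d - 1 <= #|P|.
    rewrite cardsU1 card_imset; last by move=> f g; apply: sh_injl.
    have -> : v0 \notin [set sh f v0 | f in E].
      by apply/imsetP => -[f _ E0]; have := congr1 (@par L) E0; rewrite par_sh; case: (par v0).
    have := cardsC [set f : dir L | f.1 == l]; rewrite card_dir.
    have -> : ~: [set f : dir L | f.1 == l] = E by apply/setP => f; rewrite !inE.
    have := card_dir_coord k b l; rewrite /= -/L; lia.
  apply: leq_trans cP (card_exits_proj _ _ _).
    apply/subsetP => x; rewrite !inE => /orP[/eqP -> //|/imsetP[f _ ->]].
    by rewrite cW.1 // vW pv.
  have Pl x : x \in P -> tcoord x l = tcoord v0 l.
    rewrite !inE => /orP[/eqP -> //|/imsetP[f]]; rewrite inE => fl ->.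
    by rewrite coord_sh eq_sym (negbTE fl).
  by move=> x y /Pl -> /Pl ->.
rewrite -(leq_pmul2l d0) -sum_boundary sum_exits.
rewrite -{1}(card_dir d k b) -sum_nat_const; apply: leq_sum => e _; exact: ex.
Qed.

(** A code stores its base point as a number of steps along a ray from [v0]. The points of the ray
    before it leaves [W] lie on distinct lines in direction [j], each of which exits [W], so there
    are at most as many as boundary edges. *)
Lemma root_exists : v0 \in W -> exists2 m, m < 2 * d * t &
  iter m (sh (up k b i)) v0 \in inner W.
Proof.
move=> vW; pose it m := iter m (@sh L (up k b i)) v0.
have co m : (forall l, l <= m -> it l \in W) -> tcoord (it m) i = tcoord v0 i + m.
  elim: m => [|m IH] h; first by rewrite addn0.
  have c1 := IH (fun l le => h l (leqW le)).
  have := coord_gt0 i dW (h m.+1 (leqnn _)); rewrite /it iterS -/(it m) coord_sh /= eqxx.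
  by case: (_ == k.*2.+3) => // _; rewrite c1 addnS.
have [m0 m0P] : exists m, it m.+1 \notin W.
  have : ~~ [forall l : 'I_(k.*2.+4).+1, it l \in W].
    apply/negP => /forallP h; have := coord_lt (it k.*2.+4) i.
    rewrite co => [|l le]; last by have := h (Ordinal (le : l < (k.*2.+4).+1)).
    lia.
  rewrite negb_forall => /existsP[[[|l] lt]] //=; first by rewrite vW.
  by move=> h; exists l.
have [m mP mmin] := ex_minnP (ex_intro (fun m => it m.+1 \notin W) m0 m0P).
have itW l : l <= m -> it l \in W.
  case: l => [//|l] lt; apply: contraT => /mmin; lia.
exists m; last first.
  have kx : up k b i \in crossing W (it m) by rewrite inE itW //= -iterS (negbTE mP).
  have := crossing_loose cW kx; rewrite itW // => /esym px.
  by rewrite !inE itW // px; apply/card_gt0P; exists (up k b i).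
have jW : #|[set it (nat_of_ord l) | l : 'I_m.+1]| <= #|exits W (j, true)|.
  apply: card_exits_proj.
    by apply/subsetP => _ /imsetP[l _ ->]; apply: itW; rewrite -ltnS.
  have cj l : tcoord (it l) j = tcoord v0 j.
    by elim: l => // l IH; rewrite /it iterS coord_sh /= eq_sym (negbTE ij).
  by move=> _ _ /imsetP[l _ ->] /imsetP[l' _ ->]; rewrite !cj.
move: jW; rewrite card_in_imset ?card_ord => [jW|l l' _ _ E].
  apply: leq_trans jW _; rewrite -sum_boundary; exact: exits_le.
apply: val_inj; have cc (q : 'I_m.+1) : tcoord (it q) i = tcoord v0 i + q.
  by apply: co => q' le; apply: itW; apply: leq_trans le _; rewrite -ltnS.
by apply/eqP; rewrite -(eqn_add2l (tcoord v0 i)) -!cc E.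
Qed.

Hypothesis W_conn : forall Z : {set L}, Z \subset W ->
    (forall x e, x \in Z -> sh e x \in W -> sh e x \in Z) -> v0 \notin Z -> Z = set0.
Hypothesis out_conn : forall Z : {set L}, (forall x, x \in Z -> x \notin W) ->
    (forall x e, x \in Z -> sh e x \notin W -> sh e x \in Z) ->
  origin d k b \notin Z -> Z = set0.

Lemma inner_two_linked : v0 \in W -> two_linked (inner W).
Proof.
move=> vW Q Qstep x y xI yI.
by rewrite (inner_pot cW dW W_conn out_conn Qstep ij vW xI)
  (inner_pot cW dW W_conn out_conn Qstep ij vW yI).
Qed.

End TorusContour.

From mathcomp Require Import all_order all_algebra.
From mathcomp Require Import ring lra.

Import Order.TTheory GRing.Theory Num.Theory.

(** * The shift *)

Section SubsetSums.
Local Open Scope ring_scope.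
Variable R : realDomainType.

Lemma sum_powerset (T : finType) (B : {set T}) (lam : R) :
  \sum_(P in powerset B) lam ^+ #|P| = (1 + lam) ^+ #|B|.
Proof.
pose F i := if i \in B then lam else 0.
transitivity (\prod_i (F i + 1)); last first.
  rewrite -prodr_const [RHS]big_mkcond /=; apply: eq_bigr => i _; rewrite /F.
  by case: (i \in B); rewrite ?add0r // addrC.
rewrite bigA_distr big_mkcond /=; apply: eq_bigr => J _.
rewrite -big_mkcond /= powersetE; case: (boolP (J \subset B)) => [/subsetP JB|].
  rewrite -prodr_const; apply: eq_bigr => i /JB iB.
  by rewrite /F iB.
case/subsetPn => i iJ iB; rewrite (bigD1 i) //= /F (negbTE iB) mul0r.
by [].
Qed.

Lemma ler_sum_inj (I J : finType) (h : I -> J) (A : {set I}) (B : {set J})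
    (F : I -> R) (G : J -> R) :
    {in A &, injective h} -> (forall i, i \in A -> h i \in B) ->
    (forall i, i \in A -> F i = G (h i)) -> (forall j, 0 <= G j) ->
  \sum_(i in A) F i <= \sum_(j in B) G j.
Proof.
move=> hI hB FG G0; rewrite (eq_bigr _ FG).
rewrite -(big_imset _ hI) /=.
rewrite [leRHS](bigID (mem [set h i | i in A])) /=.
rewrite [leLHS](eq_bigl (fun j => (j \in B) && (j \in [set h i | i in A]))).
  by rewrite lerDl sumr_ge0.
by move=> j; apply/esym/andb_idl => /imsetP[i iA ->]; apply: hB.
Qed.

End SubsetSums.

Section Shift.
Variable L : lattice_graph.
Implicit Types (x y z v u : L) (e f s : dir L) (X Y B C U F S P I J W E : {set L}).
Variables (F S : {set L}) (s : dir L).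
Hypothesis parS : forall y, y \in S -> par y.

(** A particle translated from such a site would land off [F], where a decoder knowing only [F] and
    [S] could not interpret it. These particles are deleted and recorded separately. *)
Definition ambiguous := [set y in S | sh s y \notin F].
Definition exposed := [set x in F | sh (op s) x \notin S].
(** No translated particle arrives here. That these sites depend on [W] does no harm, since the
    region is decoded before the added particles. *)
Definition freed W : {set L} := [set x in Gside W :\: F | sh (op s) x \notin W].
Definition room W := exposed :|: freed W.

Lemma card_exposed : #|exposed| + #|S| = #|F| + #|ambiguous|.
Proof.
rewrite -(cardsID [set x : L | sh (op s) x \in S] F) -(cardsID [set y : L | sh s y \in F] S).
have -> : #|F :&: [set x | sh (op s) x \in S]| = #|S :&: [set y | sh s y \in F]|.
  rewrite -[RHS](card_imset _ (can_inj (@shK L s))); apply: eq_card => x.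
  apply/idP/imsetP => [|[y]]; rewrite !inE.
    by move=> /andP[xF xS]; exists (sh (op s) x); rewrite ?shKV // !inE shKV xF xS.
  by move=> /andP[yS yF] ->; rewrite shK yS yF.
have -> : exposed = F :\: [set x | sh (op s) x \in S].
  by apply/setP => x; rewrite !inE andbC.
have -> : ambiguous = S :\: [set y | sh s y \in F].
  by apply/setP => x; rewrite !inE andbC.
lia.
Qed.

Definition moved W I : {set L} :=
  [set v | sh (op s) v \in (I :&: W) :\: ambiguous].
Definition shifted W I P := (I :\: W) :|: moved W I :|: P.

Lemma card_moved W I : #|moved W I| = #|(I :&: W) :\: ambiguous|.
Proof.
rewrite -[RHS](card_imset _ (can_inj (@shK L s))); apply: eq_card => v.
apply/idP/imsetP => [vm|[u uI ->]]; last by rewrite inE shK.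
by exists (sh (op s) v); rewrite ?shKV //; rewrite inE in vm.
Qed.

(** All that the shift uses of an approximation. With [enclosed], the last two clauses put every
    particle of [S] inside the region and leave the even sites of the region off [F] vacant. *)
Definition compatible W :=
  [/\ F \subset Gside W, Aside W \subset S,
      forall y, y \in S -> y \notin W -> exists e, sh e y \in W
    & forall x, x \in Gside W :\: F -> exists e, sh e x \notin W].

Section OneConfiguration.
Variables (W I P : {set L}).
Hypothesis cW : compatible W.
Hypothesis eI : enclosed W I.
Hypothesis iI : indep I.
Hypothesis PR : P \subset room W.
Local Notation J := (shifted W I P).

Lemma S_closed u : u \in S -> u \in I -> u \in W.
Proof.
move=> uS uI; apply: contraT => uW; have [_ _ h _] := cW.
have [e eW] := h u uS uW; have [_ _ out] := eI.
by rewrite (out u e uI (parS uS) eW) in uW.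
Qed.

Lemma roomW v : v \in room W -> v \in W /\ ~~ par v.
Proof.
have [/subsetP FG _ _ _] := cW; rewrite !inE => /orP[/andP[/FG]|].
  by rewrite inE => /andP[].
by case/andP=> /andP[_ /andP[]].
Qed.

Lemma movedW v : v \in moved W I -> v \in W.
Proof.
rewrite !inE => /andP[_ /andP[uI uW]].
rewrite -(shKV s v); case: eI => tW aW _.
case: (boolP (par (sh (op s) v))) => pu; last exact: aW.
by rewrite tW // uW pu.
Qed.

Lemma shifted_out v : v \notin W -> (v \in J) = (v \in I).
Proof.
move=> vW; rewrite 2!in_setU in_setD vW /=.
have -> : (v \in moved W I) = false by apply: contraNF vW; apply: movedW.
have -> : (v \in P) = false.
  by apply: contraNF vW => /(subsetP PR)/roomW[].
by rewrite !orbF.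
Qed.

Lemma shifted_odd v : v \in S -> (v \in J) = (sh (op s) v \in I :&: F).
Proof.
move=> vS; have pv := parS vS; have [/subsetP FG _ _ hF] := cW.
have [tW aW _] := eI.
have vP : v \notin P by apply: contraTN pv => /(subsetP PR)/roomW[].
have vI : v \notin I :\: W by apply/setDP => -[/(S_closed vS) ->].
have pu : ~~ par (sh (op s) v) by rewrite par_sh pv.
have uS : sh (op s) v \notin S by apply: contraNN pu => /parS.
rewrite 2!in_setU (negbTE vP) (negbTE vI) orbF /= in_set in_setD !in_setI.
rewrite [_ \in ambiguous]in_set (negbTE uS) /=.
case: (boolP (sh (op s) v \in I)) => //= uI; apply/idP/idP => [uW|/FG]; last first.
  by rewrite inE => /andP[].
apply: contraT => uF; have [e /negP[]] : exists e, sh e (sh (op s) v) \notin W.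
  by apply: hF; rewrite in_setD uF inE uW pu.
exact: aW.
Qed.

Lemma shifted_even v : v \in F -> sh (op s) v \in S ->
  (v \in J) = (sh (op s) v \in I).
Proof.
move=> vF uS; have [/subsetP FG _ _ _] := cW.
have vG := FG v vF; have vW : v \in W by move: vG; rewrite inE => /andP[].
have vP : v \notin P.
  by apply/negP => /(subsetP PR); rewrite !inE uS vF.
rewrite 2!in_setU (negbTE vP) orbF !in_setD vW /= in_set in_setD in_setI.
rewrite [_ \in ambiguous]in_set uS shKV vF /=.
by case: (boolP (_ \in I)) => //= uI; rewrite S_closed.
Qed.

Lemma shifted_room v : v \in room W -> (v \in J) = (v \in P).
Proof.
move=> vR; have [vW pv] := roomW vR; have [_ /subsetP AS _ _] := cW.
rewrite 2!in_setU in_setD vW /= (_ : v \in moved W I = false) //.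
apply/negbTE; rewrite in_set in_setD in_setI; apply/negP => /and3P[_ uI uW].
move: vR; rewrite !inE uW andbF orbF => /andP[_ /negP[]].
by apply: AS; rewrite inE uW par_sh.
Qed.

Lemma enclosed_even v : v \in F -> (v \in I) = (sh s v \in S) && (sh s v \in J).
Proof.
move=> vF; have [/subsetP FG /subsetP AS _ _] := cW; have [_ aW _] := eI.
have := FG v vF; rewrite inE => /andP[vW pv].
case: (boolP (sh s v \in S)) => vS /=.
  by rewrite shifted_odd // shK in_setI vF andbT.
apply: contraNF vS => vI; apply: AS.
by rewrite inE aW // par_sh pv.
Qed.

(** The delicate pair is an added particle next to a translated one. The latter comes from an even
    particle of the region, all of whose neighbours are in the region. One of them is the preimage
    of the added site, but sites of [room] have their preimage outside the region or outside [S]. *)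
Lemma shifted_indep : indep J.
Proof.
have [/subsetP FG /subsetP AS _ _] := cW; have [tW aW bW] := eI.
have cross x e : x \in W -> sh e x \notin W -> sh e x \notin I.
  move=> xW yW; apply: contraNN (yW) => yI; apply: (bW _ (op e)); rewrite ?shK //.
  rewrite par_sh; apply: contraNN yW => px; by rewrite tW // xW px.
have PM x e : x \in P -> sh e x \notin moved W I.
  move=> xP; have [xW px] := roomW (subsetP PR x xP).
  rewrite in_set in_setD in_setI sh_comm; apply/negP => /and3P[_ uI uW].
  have pu : ~~ par (sh e (sh (op s) x)) by rewrite !par_sh (negbTE px).
  have := aW _ (op e) uI uW pu; rewrite shK => oW.
  have := subsetP PR x xP; rewrite !inE oW andbF orbF => /andP[_ /negP[]].
  by apply: AS; rewrite inE oW par_sh.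
have JW x : x \in W -> x \in J -> x \in moved W I \/ x \in P.
  by move=> xW; rewrite 2!in_setU in_setD xW => /orP.
move=> x e xJ; apply/negP => yJ.
case: (boolP (x \in W)) (boolP (sh e x \in W)) => xW [] yW.
- have [xm|xP] := JW _ xW xJ; have [ym|yP] := JW _ yW yJ.
  + move: xm ym; rewrite !in_set (sh_comm (op s) e) => /and3P[_ xI _] /and3P[_ yI _].
    by move: yI; apply/negP/iI.
  + by have := PM _ (op e) yP; rewrite shK xm.
  + by have := PM _ e xP; rewrite ym.
  have [_ px] := roomW (subsetP PR x xP).
  by have [_] := roomW (subsetP PR _ yP); rewrite par_sh px.
- by rewrite shifted_out // (negbTE (cross _ _ xW yW)) in yJ.
- rewrite shifted_out // in xJ; have := cross (sh e x) (op e) yW.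
  by rewrite shK xJ => /(_ xW).
rewrite shifted_out // in xJ; rewrite shifted_out // in yJ.
by move: yJ; apply/negP/iI.
Qed.

Lemma card_shifted : #|I| + #|P| = #|J| + #|I :&: ambiguous|.
Proof.
have [tW aW bW] := eI.
have aW' : I :&: ambiguous \subset W.
  by apply/subsetP => u; rewrite !inE => /andP[uI /andP[uS _]]; apply: S_closed.
have disj1 : #|J| = #|(I :\: W) :|: moved W I| + #|P|.
  rewrite -cardsUI (_ : _ :&: P = set0) ?cards0 ?addn0 //.
  apply/setP => v; rewrite in_setI in_set0; apply/negbTE/negP => /andP[vJ vP].
  have vR := subsetP PR v vP; have [vW pv] := roomW vR.
  have [_ /subsetP AS _ _] := cW.
  move: vJ; rewrite in_setU in_setD vW /= in_set in_setD in_setI => /and3P[_ uI uW].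
  move: vR; rewrite !inE uW andbF orbF => /andP[_ /negP[]].
  by apply: AS; rewrite inE uW par_sh.
have disj2 : #|(I :\: W) :|: moved W I| = #|I :\: W| + #|moved W I|.
  rewrite -cardsUI (_ : _ :&: moved W I = set0) ?cards0 ?addn0 //.
  apply/setP => v; rewrite in_setI in_setD in_set0; apply/negbTE/negP.
  by case/andP => /andP[/negP vW _] /movedW.
rewrite disj1 disj2 card_moved.
have := cardsID W I; have := cardsID ambiguous (I :&: W).
have -> : (I :&: W) :&: ambiguous = I :&: ambiguous.
  by rewrite setIAC; apply/setIidPl.
lia.
Qed.

End OneConfiguration.

(** First [I] is read off on [S :|: F] from the image and the recorded ambiguous particles, which
    determines the region. Inside it all particles of [I] lie in [S :|: F], outside it [I] is the
    image, and finally [P] is the image on [room]. *)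
Lemma shifted_inj W1 W2 I1 I2 P1 P2 :
    compatible W1 -> compatible W2 -> enclosed W1 I1 -> enclosed W2 I2 ->
    P1 \subset room W1 -> P2 \subset room W2 ->
    ({in S :|: F, I1 =i I2} -> W1 = W2) ->
    shifted W1 I1 P1 = shifted W2 I2 P2 ->
    I1 :&: ambiguous = I2 :&: ambiguous ->
  I1 = I2 /\ P1 = P2.
Proof.
move=> c1 c2 e1 e2 r1 r2 det eJ eE.
have agree : {in S :|: F, I1 =i I2}.
  move=> v; rewrite in_setU; case: (boolP (v \in F)) => [vF _|vF].
    by rewrite (enclosed_even c1 e1 r1) // (enclosed_even c2 e2 r2) // eJ.
  rewrite orbF => vS; case: (boolP (sh s v \in F)) => svF.
    have := shifted_even c1 e1 r1 svF; have := shifted_even c2 e2 r2 svF.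
    by rewrite shK eJ => /(_ vS) -> /(_ vS) ->.
  by have /setP/(_ v) := eE; rewrite !in_setI [_ \in ambiguous]in_set vS svF !andbT.
have eW := det agree; case: _ / eW in c2 e2 r2 eJ *.
have out W I v : compatible W -> enclosed W I -> v \in W -> v \in I -> v \in S :|: F.
  move=> [_ /subsetP AS _ hF] [_ aW _] vW vI; rewrite in_setU.
  case: (boolP (par v)) => pv; first by rewrite AS ?inE ?vW.
  apply/orP; right; apply: contraT => vF.
  have [e /negP[]] : exists e, sh e v \notin W by apply: hF; rewrite !inE vF vW pv.
  exact: aW.
have eI : I1 = I2.
  apply/setP => v; case: (boolP (v \in W1)) => vW; last first.
    by rewrite -(shifted_out c1 e1 r1 vW) eJ (shifted_out c2 e2 r2 vW).
  apply/idP/idP => vI; first by rewrite -agree // (out W1 I1).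
  by rewrite agree // (out W1 I2).
split=> //; apply/setP => v; case: (boolP (v \in room W1)) => vR.
  by rewrite -(shifted_room I1 P1 c1 vR) eJ (shifted_room I2 P2 c2 vR).
by apply/idP/idP => [/(subsetP r1)|/(subsetP r2)]; rewrite (negbTE vR).
Qed.

Local Open Scope ring_scope.

(* The region of [I] is known only up to the approximation [(F, S)].  Still,
   the map sending [(I, P)] to the shifted configuration together with
   [I :&: ambiguous] is injective, so that the gain is [#|room| - #|ambiguous|]. *)
Lemma shift_bound (R : realFieldType) (lam : R) (Om Fam : {set {set L}})
    (Wf : {set L} -> {set L}) (y : nat) :
    0 <= lam ->
    (forall I, I \in Fam -> [/\ indep I, compatible (Wf I) & enclosed (Wf I) I]) ->
    {in Fam &, forall I1 I2, {in S :|: F, I1 =i I2} -> Wf I1 = Wf I2} ->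
    {in Fam, forall I J, indep J -> {in ~: Wf I, J =i I} -> J \in Om} ->
    {in Fam, forall I, (#|S| + y <= #|F| + #|freed (Wf I)|)%N} ->
  (1 + lam) ^+ y * (\sum_(I in Fam) lam ^+ #|I|) <= \sum_(J in Om) lam ^+ #|J|.
Proof.
move=> lam0 FamP det closed gain.
have lam1 : 1 <= 1 + lam by rewrite lerDl.
have lam1_gt0 : 0 < 1 + lam by apply: lt_le_trans lam1.
pose A := [set p : {set L} * {set L} | (p.1 \in Fam) && (p.2 \subset room (Wf p.1))].
pose B := setX Om (powerset ambiguous).
pose h (p : {set L} * {set L}) := (shifted (Wf p.1) p.1 p.2, p.1 :&: ambiguous).
have key : \sum_(p in A) lam ^+ (#|p.1| + #|p.2|) <=
    \sum_(q in B) lam ^+ (#|q.1| + #|q.2|).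
  apply: (@ler_sum_inj _ _ _ h) => [[I1 P1] [I2 P2]|[I P]|[I P]|q].
  - rewrite !inE /= => /andP[F1 r1] /andP[F2 r2] [eJ eE].
    have [_ c1 e1] := FamP _ F1; have [_ c2 e2] := FamP _ F2.
    by have [-> ->] := shifted_inj c1 c2 e1 e2 r1 r2 (det _ _ F1 F2) eJ eE.
  - rewrite inE /= => /andP[FI r]; have [iI c e] := FamP _ FI.
    rewrite in_setX /= powersetE subsetIr andbT; apply: (closed _ FI).
      exact: shifted_indep.
    by move=> v; rewrite in_setC => vW; apply: shifted_out.
  - rewrite inE /= => /andP[FI r]; have [iI c e] := FamP _ FI.
    by rewrite (card_shifted c e r).
  by rewrite exprn_ge0.
have sumB : \sum_(q in B) lam ^+ (#|q.1| + #|q.2|) =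
    (\sum_(J in Om) lam ^+ #|J|) * (1 + lam) ^+ #|ambiguous|.
  rewrite -sum_powerset big_distrlr /= pair_big /=.
  by apply: eq_big => [q|q _]; [rewrite inE|rewrite exprD].
have sumA : \sum_(p in A) lam ^+ (#|p.1| + #|p.2|) =
    \sum_(I in Fam) lam ^+ #|I| * (1 + lam) ^+ #|room (Wf I)|.
  under [RHS]eq_bigr => I _ do rewrite -sum_powerset big_distrr /=.
  rewrite pair_big_dep /=; apply: eq_big => [q|q _]; last by rewrite exprD.
  by rewrite !inE.
rewrite sumB sumA in key.
rewrite -(ler_pM2r (exprn_gt0 #|ambiguous| lam1_gt0)).
apply: le_trans key; rewrite -mulrA mulrC -mulrA -exprD mulr_suml.
apply: ler_sum => I FI; rewrite ler_wpM2l ?exprn_ge0 //.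
apply: ler_weXn2l => //.
have disj : #|room (Wf I)| = (#|exposed| + #|freed (Wf I)|)%N.
  rewrite -cardsUI (_ : _ :&: _ = set0) ?cards0 ?addn0 //.
  by apply/setP => x; rewrite !inE; case: (x \in F); rewrite ?andbF.
have := gain _ FI; have := card_exposed; rewrite disj; lia.
Qed.

End Shift.

Lemma contour_Gside (L : lattice_graph) (W : {set L}) : contour W ->
  Gside W = nb (Aside W).
Proof.
move=> cW; apply/setP => x; apply/idP/nbP => [|[e]]; rewrite !inE.
  move=> /andP[xW px]; have [e eW] : exists e, (sh e x \in W) = (x \in W).
    by apply: cW.2; rewrite xW px.
  by exists e; rewrite inE eW xW par_sh.
rewrite par_sh => /andP[eW pe]; rewrite pe andbT.
by rewrite -(shK e x) cW.1 // eW par_sh pe.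
Qed.

Lemma contour_Aside (L : lattice_graph) (W : {set L}) : contour W ->
  Aside W = [set v | par v & [forall e, sh e v \in Gside W]].
Proof.
move=> cW; apply/setP => v; rewrite !inE andbC; case: (boolP (par v)) => //= pv.
apply/idP/forallP => [vW e|vG].
  by rewrite inE par_sh pv cW.1 ?vW.
apply: contraT => vW; have [e eW] : exists e, (sh e v \in W) = (v \in W).
  by apply: cW.2; rewrite (negbTE vW) pv.
by have := vG e; rewrite inE eW (negbTE vW).
Qed.

Lemma contour_split (L : lattice_graph) (W : {set L}) : W = Aside W :|: Gside W.
Proof. by apply/setP => v; rewrite !inE -andb_orr orbN andbT. Qed.

Lemma contour_inj (L : lattice_graph) (W1 W2 : {set L}) :
  contour W1 -> contour W2 -> Aside W1 = Aside W2 -> W1 = W2.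
Proof.
move=> c1 c2 E.
by rewrite (contour_split W1) (contour_split W2) !contour_Gside // E.
Qed.

Section FreedDirection.
Variable L : lattice_graph.
Variables (W F S : {set L}) (psi : nat).
Hypothesis cW : contour W.
Hypothesis apx : approx psi W F S.
Hypothesis psi_lt : psi < #|dir L|.

Lemma approx_compatible : compatible F S W.
Proof.
have [FG AS pS sS sF] := apx; split=> // [y yS yW|x].
  have : 0 < #|in_dirs F y| by have := card_in_out F y; have := sS y yS; lia.
  by case/card_gt0P=> e; rewrite inE => /(subsetP FG); rewrite inE => /andP[eW _]; exists e.
rewrite in_setD => /andP[xF xG]; have px : ~~ par x by move: xG; rewrite inE => /andP[].
have : 0 < #|out_dirs S x| by have := card_in_out S x; have := sF x px xF; lia.
case/card_gt0P=> e; rewrite inE => eS; exists e; apply: contraNN eS => eW.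
by apply: (subsetP AS); rewrite inE eW par_sh px.
Qed.

(** Averaging over directions: a missing even vertex has at most [psi] neighbours in [S], and every
    neighbour off [S] is outside [W]. *)
Lemma freed_direction : exists s : dir L,
  (#|dir L| - psi) * #|Gside W :\: F| <= #|dir L| * #|freed F s W|.
Proof.
have [FG AS pS sS sF] := apx.
have sum : (#|dir L| - psi) * #|Gside W :\: F| <= \sum_(s : dir L) #|freed F s W|.
  have -> : \sum_(s : dir L) #|freed F s W| =
      \sum_(x in Gside W :\: F) #|[set s : dir L | sh (op s) x \notin W]|.
    have E1 s : #|freed F s W| = \sum_(x in Gside W :\: F) (sh (op s) x \notin W : nat).
      rewrite -sum1_card big_mkcond [RHS]big_mkcond; apply: eq_bigr => x _.
      by rewrite inE; case: (x \in _); case: (_ \notin _).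
    rewrite (eq_bigr _ (fun s _ => E1 s)) exchange_big /=; apply: eq_bigr => x _.
    rewrite -sum1_card [RHS]big_mkcond; apply: eq_bigr => s _.
    by rewrite inE; case: (_ \notin _).
  rewrite mulnC -sum_nat_const; apply: leq_sum => x.
  rewrite in_setD => /andP[xF xG]; have px : ~~ par x by move: xG; rewrite inE => /andP[].
  rewrite leq_subLR -(card_in_out S x) leq_add ?sF //.
  rewrite -[leqLHS](card_imset _ (inv_inj (@opK L))); apply: subset_leq_card.
  apply/subsetP => s /imsetP[e]; rewrite !inE => eS ->; rewrite opK.
  by apply: contraNN eS => eW; apply: (subsetP AS); rewrite inE eW par_sh px.
apply/existsP; apply: contraLR sum; rewrite negb_exists => /forallP h.
have D0 : 0 < #|dir L| by apply: leq_ltn_trans psi_lt.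
rewrite -ltnNge -(ltn_pmul2l D0) big_distrr /= -sum_nat_const.
have /card_gt0P[s0 _] := D0.
rewrite (bigD1 s0) //= [ltnRHS](bigD1 s0) //= -addSn leq_add //.
  by have := h s0; rewrite -ltnNge.
by apply: leq_sum => s _; have := h s; rewrite -ltnNge => /ltnW.
Qed.

End FreedDirection.

(** * Sums over contours *)

Section UnionBound.
Local Open Scope ring_scope.
Variables (R : realFieldType) (T K : finType).

Lemma union_bound (Fam : {set T}) (G : K -> {set T}) (w : T -> R) (c Z : R) :
    (forall I, 0 <= w I) -> 0 <= c ->
    (forall I, I \in Fam -> exists k, I \in G k) ->
    (forall k, c * (\sum_(I in Fam :&: G k) w I) <= Z) ->
  c * (\sum_(I in Fam) w I) <= #|K|%:R * Z.
Proof.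
move=> w0 c0 cov bd.
apply: (@le_trans _ _ (\sum_(k : K) c * (\sum_(I in Fam :&: G k) w I))); last first.
  rewrite (le_trans (ler_sum _ (fun k _ => bd k))) //.
  by rewrite sumr_const mulr_natl lexx.
rewrite -mulr_sumr ler_wpM2l //.
have E k : \sum_(I in Fam :&: G k) w I = \sum_(I in Fam) (if I \in G k then w I else 0).
  by rewrite -big_mkcondr; apply: eq_bigl => I; rewrite inE.
rewrite (eq_bigr _ (fun k _ => E k)) exchange_big /=; apply: ler_sum => I IF.
have [k IG] := cov I IF; rewrite (bigD1 k) //= IG lerDl sumr_ge0 // => k' _.
by case: ifP.
Qed.

End UnionBound.

Section PeierlsSums.
Local Open Scope ring_scope.
Variables (R : realFieldType) (lam : R) (d k : nat) (b : bool).
Local Notation L := (torus_graph d k b).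
Variables (v0 : L) (i j : 'I_d) (bdry : pred L).
Hypothesis lam_gt0 : 0 < lam.
Hypothesis ij : i != j.
Hypothesis d_gt2 : (2 < d)%N.
Hypothesis d_large : (d ^ 4 <= 2 ^ (d %/ 4))%N.
Hypothesis par_v0 : par v0.
Hypothesis bdry_par : forall x, bdry x -> ~~ par x.
Hypothesis bdry_nbr : forall (z : L) e, z \notin Lout d k b -> par z ->
  sh e z \in Lout d k b -> bdry (sh e z).

Definition configs : {set {set L}} :=
  [set J : {set L} | [forall x in J, forall e, sh e x \notin J] &&
     [forall x in Lout d k b, (x \in J) == bdry x]].

Lemma configsP J : reflect (indep J /\ {in Lout d k b, forall x, (x \in J) = bdry x})
  (J \in configs).
Proof.
rewrite inE; apply: (iffP andP) => [[/forall_inP h1 /forall_inP h2]|[h1 h2]].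
  by split=> [x e /h1/forallP|x /h2/eqP].
split; apply/forall_inP => x xJ; last by rewrite h2.
by apply/forallP => e; apply: h1.
Qed.

Definition bad : {set {set L}} := [set J in configs | v0 \in J].
Definition reg (I : {set L}) : {set L} := region (origin d k b) v0 I.
Local Notation w I := (lam ^+ #|I : {set L}|).
Local Notation Z := (\sum_(J in configs) w J).
Local Notation t I := (thickness (reg I)).

Lemma bad_safe I : I \in bad -> forall z, z \in I -> par z ->
  z \notin Lout d k b /\ forall e, sh e z \notin Lout d k b.
Proof.
rewrite inE => /andP[/configsP[iI bI] _] z zI pz.
have zL : z \notin Lout d k b.
  by apply: contraTN pz => zL; apply: bdry_par; rewrite -bI.
split=> // e; apply/negP => eL; have := iI z e zI.
by rewrite bI // bdry_nbr.
Qed.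

Lemma bad_facts I : I \in bad ->
  [/\ [/\ indep I, v0 \in I & enclosed (reg I) I], contour (reg I),
      [disjoint reg I & Lout d k b], v0 \in Aside (reg I) &
      two_linked (inner (reg I)) /\ linked 2 (Aside (reg I)) v0].
Proof.
move=> IB; have safe := bad_safe IB; move: IB; rewrite inE => /andP[/configsP[iI bI] vI].
have LC K := @Lout_connected d k b i j K ij.
have oL := origin_Lout k b i; have oN := origin_nbr k b ij.
have wh := @torus_connected d k b.
have cR : contour (reg I) by apply: (region_contour (Lout := Lout d k b)).
have dR : [disjoint reg I & Lout d k b] by apply: region_Lout.
have vR : v0 \in reg I by apply: (v0_region (Lout := Lout d k b)).
have Wc := @region_conn _ _ _ _ oL wh par_v0 _ vI safe.
have oc := @out_conn _ _ _ _ oL par_v0 _ vI safe.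
split=> //.
- by split=> //; apply: (region_enclosed (Lout := Lout d k b)).
- by rewrite inE vR.
split; first exact: (inner_two_linked ij cR dR Wc oc vR).
exact: Aside_linked cR Wc par_v0.
Qed.

Lemma odd_cluster_Aside I : I \in bad -> odd_cluster v0 I \subset Aside (reg I).
Proof.
move=> IB; have safe := bad_safe IB; have [[_ vI _] _ _ _ _] := bad_facts IB.
have oL := origin_Lout k b i.
apply/subsetP => y yR; have [_ py] := odd_clusterP par_v0 vI yR.
rewrite inE py andbT.
by apply: (subsetP (hull_region oL par_v0 vI safe)); rewrite in_setU yR.
Qed.

Lemma peierls_bound (F S : {set L}) s y (Fam : {set {set L}}) :
    (forall v, v \in S -> par v) -> Fam \subset bad ->
    {in Fam, forall I, compatible F S (reg I)} ->
    {in Fam, forall I, (#|S| + y <= #|F| + #|freed F s (reg I)|)%N} ->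
  (1 + lam) ^+ y * (\sum_(I in Fam) w I) <= Z.
Proof.
move=> pS /subsetP FB cF gain.
apply: (shift_bound (Wf := reg) pS (ltW lam_gt0) _ _ _ gain) => [I IF|I1 I2 F1 F2 agree|I IF J iJ JI].
- by have [[iI vI eI] _ _ _ _] := bad_facts (FB I IF); split=> //; apply: cF.
- apply: (region_eq _ _ _ agree).
    by have [_ AS _ _] := cF _ F1; apply: subset_trans (odd_cluster_Aside (FB _ F1)) AS.
  by have [_ AS _ _] := cF _ F2; apply: subset_trans (odd_cluster_Aside (FB _ F2)) AS.
have [_ _ dR _ _] := bad_facts (FB I IF).
have : I \in configs by have := FB I IF; rewrite inE => /andP[].
case/configsP=> _ bI; apply/configsP; split=> // x xL.
by rewrite JI ?bI // in_setC (disjointFl dR).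
Qed.

(** With the exact pair [Gside W0], [Aside W0] the gain is the whole thickness. *)
Lemma fixed_region_bound W0 (Fam : {set {set L}}) y :
    Fam \subset bad -> {in Fam, forall I, reg I = W0 /\ (y <= t I)%N} ->
  (1 + lam) ^+ y * (\sum_(I in Fam) w I) <= Z.
Proof.
move=> FB FW; have [->|[I0 I0F]] := set_0Vmem Fam.
  by rewrite big_set0 mulr0 sumr_ge0 // => J _; rewrite exprn_ge0 // ltW.
have [r0 ty] := FW _ I0F.
have [_ cR dR _ _] := bad_facts (subsetP FB _ I0F); rewrite r0 in cR dR ty.
have D0 : (0 < #|dir L|)%N by rewrite card_dir; lia.
apply: (@peierls_bound (Gside W0) (Aside W0) (up k b i)) => //.
- by move=> v; rewrite inE => /andP[].
- move=> I /FW[-> _]; split=> // [v|v]; first by rewrite inE => /andP[->].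
  by rewrite setDv inE.
move=> I /FW[-> _].
have := leq_AG cR D0; move: ty; rewrite /thickness; lia.
Qed.

Lemma approx_bound psi (F S : {set L}) s y (Fam : {set {set L}}) :
    (psi < 2 * d)%N -> Fam \subset bad ->
    {in Fam, forall I, approx psi (reg I) F S /\
       (#|S| + y <= #|F| + #|freed F s (reg I)|)%N} ->
  (1 + lam) ^+ y * (\sum_(I in Fam) w I) <= Z.
Proof.
move=> psi_lt FB FA; have [->|[I0 I0F]] := set_0Vmem Fam.
  by rewrite big_set0 mulr0 sumr_ge0 // => J _; rewrite exprn_ge0 // ltW.
apply: (@peierls_bound F S s) => // [v|I IF|I /FA[]//].
  by have [[_ _ pS _ _] _] := FA _ I0F; apply: pS.
by have [apx _] := FA _ IF; apply: (approx_compatible apx); rewrite card_dir.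
Qed.

Section Small.
Variables (H Lg X T0 : nat).
Hypothesis lamH : 2 <= (1 + lam) ^+ H.
Hypothesis dLg : (2 * d <= 2 ^ Lg)%N.
Hypothesis smallX : forall I, I \in bad -> (t I < T0)%N ->
  (X + H * (4 * Lg + 8) * #|Aside (reg I)| <= t I)%N.

(** The odd part of the region determines it and is visited by a walk of [4 * a] steps. The surplus
    of the thickness over [X] pays for the walk and its mask, with [a.+2] bits to spare that make
    the sum over [a] geometric. *)
Lemma small_fixed a :
  (1 + lam) ^+ X * (\sum_(I in bad | (t I < T0)%N && (#|Aside (reg I)| == a)) w I)
    <= (1 / 2) ^+ a.+2 * Z.
Proof.
have lam1 : 1 <= 1 + lam by rewrite lerDl ltW.
have Z0 : 0 <= Z by apply: sumr_ge0 => J _; rewrite exprn_ge0 // ltW.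
pose Fam := [set I in bad | (t I < T0)%N && (#|Aside (reg I)| == a)].
have -> : \sum_(I in bad | (t I < T0)%N && (#|Aside (reg I)| == a)) w I = \sum_(I in Fam) w I.
  by apply: eq_bigl => I; rewrite !inE.
have FamP I : I \in Fam -> [/\ I \in bad, (t I < T0)%N & #|Aside (reg I)| = a].
  by rewrite inE => /and3P[-> -> /eqP].
case: (posnP a) => [a0|a0].
  rewrite (_ : Fam = set0); first by rewrite big_set0 mulr0 mulr_ge0 // exprn_ge0 //; lra.
  apply/setP => I; rewrite in_set0; apply/negbTE/negP => /FamP[/bad_facts[_ _ _ vA _] _ ca].
  by have /eqP := etrans ca a0; rewrite cards_eq0 => /eqP A0; rewrite A0 inE in vA.
pose n := (4 * a)%N.
pose G (c : n.-tuple (dir L) * n.+1.-tuple bool) : {set {set L}} :=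
  [set I | Aside (reg I) == selected c.1 c.2 v0].
have key : (1 + lam) ^+ (X + H * (4 * Lg + 8) * a) * (\sum_(I in Fam) w I) <=
    #|{: n.-tuple (dir L) * n.+1.-tuple bool}|%:R * Z.
  apply: (union_bound (G := G)) => [I||I|c].
  - by rewrite exprn_ge0 // ltW.
  - by rewrite exprn_ge0 // (le_trans _ lam1).
  - move=> /FamP[IB _ ca]; have [_ _ _ vA [_ lA]] := bad_facts IB.
    have [||tw Aw] := @linked_tuple L 2 n (Aside (reg I)) v0 _ vA lA; rewrite ?ca //.
      by rewrite card_dir muln_gt0 (leq_trans _ d_gt2).
    have [m Am] := selectedP Aw; exists (tw, m); by rewrite inE /= -Am.
  have [E0|[I0 I0F]] := set_0Vmem (Fam :&: G c).
    by rewrite E0 big_set0 mulr0.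
  apply: (fixed_region_bound (W0 := reg I0)).
    by apply/subsetP => I; rewrite inE => /andP[/FamP[]].
  have [/FamP[IB0 _ _]] := setIP I0F; rewrite inE => /eqP GI0.
  move=> I /setIP[/FamP[IB lt ca]]; rewrite inE => /eqP GI.
  split; last by have := smallX IB lt; rewrite ca.
  have [_ c1 _ _ _] := bad_facts IB; have [_ c0 _ _ _] := bad_facts IB0.
  exact: contour_inj c1 c0 (etrans GI (esym GI0)).
have cK : (#|{: n.-tuple (dir L) * n.+1.-tuple bool}| * 2 ^ a.+2 <= 2 ^ ((4 * Lg + 8) * a))%N.
  rewrite card_prod !card_tuple card_bool card_dir.
  apply: (@leq_trans ((2 ^ Lg) ^ n * 2 ^ n.+1 * 2 ^ a.+2)).
    by rewrite !leq_mul // leq_exp2r // /n; lia.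
  by rewrite -expnM -!expnD leq_exp2l // /n; nia.
have p1 : 0 < (1 + lam) ^+ (H * (4 * Lg + 8) * a).
  by rewrite exprn_gt0 // (lt_le_trans _ lam1).
rewrite -(ler_pM2l p1) mulrA -exprD addnC (le_trans key) // mulrA ler_wpM2r //.
rewrite -mulnA exprM.
have big2 : (2 ^ ((4 * Lg + 8) * a))%N%:R <= ((1 + lam) ^+ H) ^+ ((4 * Lg + 8) * a).
  by rewrite natrX lerXn2r // nnegrE ?ler0n // exprn_ge0 // (le_trans _ lam1).
have h2 : 0 < (1 / 2 : R) ^+ a.+2 by rewrite exprn_gt0 //; lra.
apply: (le_trans _ (ler_wpM2r (ltW h2) big2)).
rewrite -(ler_nat R) natrM natrX in cK.
apply: le_trans (ler_wpM2r (ltW h2) cK); rewrite -mulrA -exprMn.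
by rewrite (_ : 2 * (1 / 2) = 1) ?expr1n ?mulr1 //; lra.
Qed.

Lemma sum_half_le N : \sum_(a < N) (1 / 2 : R) ^+ a.+2 <= 1 / 2.
Proof.
suff -> : \sum_(a < N) (1 / 2 : R) ^+ a.+2 = 1 / 2 - (1 / 2) ^+ N.+1.
  by rewrite lerBlDr lerDl exprn_ge0 //; lra.
elim: N => [|N IH]; first by rewrite big_ord0 expr1 subrr.
rewrite big_ord_recr /= IH !exprS; lra.
Qed.

Lemma small_sum :
  (1 + lam) ^+ X * (\sum_(I in bad | (t I < T0)%N) w I) <= 1 / 2 * Z.
Proof.
have Z0 : 0 <= Z by apply: sumr_ge0 => J _; rewrite exprn_ge0 // ltW.
rewrite (partition_big (fun I => inord #|Aside (reg I)| : 'I_(#|L|).+1) predT) //=.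
rewrite mulr_sumr.
apply: (@le_trans _ _ (\sum_(a < #|L|.+1) (1 / 2) ^+ a.+2 * Z)).
  apply: ler_sum => a _; apply: le_trans (small_fixed a).
  rewrite le_eqVlt; apply/orP; left; apply/eqP; congr (_ * _); apply: eq_bigl => I.
  rewrite -andbA; congr (_ && (_ && _)); apply/eqP/eqP => [<-|->].
    by rewrite inordK // ltnS max_card.
  by rewrite inord_val.
by rewrite -mulr_suml ler_wpM2r // sum_half_le.
Qed.

End Small.

Section Large.
Variables (Lg psi T u mu y : nat).
Hypothesis dLg : (2 * d < 2 ^ Lg)%N.
Hypothesis psi_le : (psi <= d)%N.
Hypothesis boundU : forall U, (d * U <= 72 * T * Lg -> U <= u)%N.
Hypothesis boundP1 : forall U a,
  (d * U <= 72 * T * Lg -> psi.+1 * a <= 2 * T + 6 * d * U -> a <= u)%N.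
Hypothesis boundP2 : forall a, (psi.+1 * a <= 2 * T -> a <= u)%N.
Hypothesis gain : forall F S Y st fr,
  (2 * d * S <= 2 * d * F + psi * (Y + st) -> Y <= 2 * T -> st <= 2 * T ->
   mu < Y -> (2 * d - psi) * Y <= 2 * d * fr -> S + y <= F + fr)%N.

Definition walk_length m := (16 * (1 + 3 * u + m))%N.
Lemma walk_length_le (a1 a2 a3 a4 m : nat) : (a1 <= u)%N -> (a2 <= u)%N ->
  (a3 <= u)%N -> (a4 <= m)%N -> (16 * (1 + a1 + a2 + a3 + a4) <= walk_length m)%N.
Proof. rewrite /walk_length; lia. Qed.

Definition codes m := ((2 * d) ^ walk_length m * 2 ^ (4 * (walk_length m).+1 + 4 * u))%N.

Let root m : L := iter m (sh (up k b i)) v0.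
Let F_ n (m : nat) (c : code L n (4 * u)) := dec_F (Lout d k b) d psi c (root m).
Let S_ n (m : nat) (c : code L n (4 * u)) := dec_S (Lout d k b) d psi c (root m).
Let Y_ n (m : nat) (c : code L n (4 * u)) := dec_Y c (root m).

Definition recon (G : {set L}) : {set L} := G :|: [set v | par v & [forall e, sh e v \in G]].

(* The approximation has a large defect, and the shift gains from it without
   knowing the region. *)
Definition rough_family (c : 'I_(2 * d * T) * dir L * code L (walk_length 0) (4 * u)) :
    {set {set L}} :=
  [set I | approxb psi (reg I) (F_ c.1.1 c.2) (S_ c.1.1 c.2) &&
    (#|S_ c.1.1 c.2| + y <= #|F_ c.1.1 c.2| + #|freed (F_ c.1.1 c.2) c.1.2 (reg I)|)%N].

(* The approximation has a small defect, which is part of the code. *)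
Definition exact_family (c : 'I_(2 * d * T) * code L (walk_length mu) (4 * u)) :
    {set {set L}} :=
  [set I | reg I == recon (F_ c.1 c.2 :|: Y_ c.1 c.2)].

Lemma recon_Gside (W : {set L}) : contour W -> recon (Gside W) = W.
Proof.
by move=> cW; rewrite /recon -contour_Aside // setUC -contour_split.
Qed.

(** The alternative is decided by the size of the defect [Gside (reg I) :\: F]. It can be put on the
    same walk because a missing vertex has at least [d] boundary edges, hence lies in [inner]. *)
Lemma large_cover I : I \in bad -> t I = T ->
  (exists c, I \in rough_family c) \/ (exists c, I \in exact_family c).
Proof.
move=> IB tI; have [_ cR dR vA [lR _]] := bad_facts IB.
have vR : v0 \in reg I by move: vA; rewrite inE => /andP[].
have [m mlt x0I] := root_exists ij cR dR vR; rewrite tI in mlt.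
have Dd := card_dir d k b.
have ltD : (#|dir L| < 2 ^ Lg)%N by rewrite Dd.
have d0 : (0 < d)%N by apply: leq_trans d_gt2.
have iso (C : {set L}) := @boundary_large d k b i j C ij d_large.
have [U [F [S [a1 [b1 [apx cU ca cb enc]]]]]] :=
  @approx_data L (Lout d k b) d psi (reg I) (root m) Lg cR Dd psi_le (ltnW d_gt2)
    ltD iso (fun v => Lout_crossing d_gt2 dR) lR x0I.
rewrite tI in cU ca cb.
have leU := boundU cU; have lea := boundP1 cU ca; have leb := boundP2 cb.
have k4 : (4 * #|U| <= 4 * u)%N by rewrite leq_mul2l leU orbT.
have [FG AS pS sS sF] := apx.
case: (leqP #|Gside (reg I) :\: F| mu) => Ymu.
  right; have YI : Gside (reg I) :\: F \subset inner (reg I).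
    apply/subsetP => v; rewrite in_setD => /andP[vF vG]; rewrite in_set vG /=.
    apply: leq_trans d0 _; apply: (kk_missing Dd psi_le AS vG).
    by apply: sF vF; move: vG; rewrite inE => /andP[].
  have [|c [eF _ eY]] := enc _ (walk_length mu) (4 * u)%N YI _ k4.
    exact: walk_length_le.
  exists (Ordinal mlt, c); rewrite inE /= /F_ /Y_ eF eY.
  rewrite (_ : F :|: (Gside (reg I) :\: F) = Gside (reg I)) ?recon_Gside //.
  by apply/setP => v; rewrite in_setU in_setD; case: (boolP (v \in F)) => // /(subsetP FG) ->.
left; have [|c [eF eS _]] := enc set0 (walk_length 0) (4 * u)%N (sub0set _) _ k4.
  by apply: walk_length_le; rewrite ?cards0.
have psi_lt : (psi < #|dir L|)%N.
  by rewrite Dd (leq_ltn_trans psi_le) // mul2n -addnn -[X in (X < _)%N]addn0 ltn_add2l.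
have [s fs] := freed_direction apx psi_lt.
exists (Ordinal mlt, s, c); rewrite inE /= /F_ /S_ eF eS; apply/andP; split; first exact/approxP.
rewrite Dd in fs; apply: gain Ymu fs.
- by have := approx_card cR apx; rewrite Dd; apply.
- by rewrite -tI; apply: card_missing d0 apx.
- by rewrite -tI; apply: (card_almost cR Dd psi_le d0 FG) => v vS; split; [apply: pS|apply: sS].
Qed.

Lemma large_sum (B : R) : 0 <= B ->
    (2 * d * T * (2 * d) * codes 0)%N%:R <= B * (1 + lam) ^+ y ->
    (2 * d * T * codes mu)%N%:R <= B * (1 + lam) ^+ T ->
  \sum_(I in bad | t I == T) w I <= 2 * B * Z.
Proof.
move=> B0 big1 big2.
have lam1 : 1 <= 1 + lam by rewrite lerDl ltW.
have lam1_gt0 : 0 < 1 + lam by apply: lt_le_trans lam1.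
have Z0 : 0 <= Z by apply: sumr_ge0 => J _; rewrite exprn_ge0 // ltW.
have w0 (I : {set L}) : 0 <= w I by rewrite exprn_ge0 // ltW.
pose FT := [set I in bad | t I == T].
have FTP I : I \in FT -> I \in bad /\ t I = T by rewrite inE => /andP[-> /eqP].
pose FA := FT :&: \bigcup_c rough_family c.
pose FB := FT :&: \bigcup_c exact_family c.
have cov : \sum_(I in FT) w I <= \sum_(I in FA) w I + \sum_(I in FB) w I.
  have E (A : {set {set L}}) : A \subset FT ->
      \sum_(I in A) w I = \sum_(I in FT) (if I \in A then w I else 0).
    move=> /subsetP AF; rewrite -big_mkcondr; apply: eq_bigl => I.
    by apply/esym/andb_idl/AF.
  rewrite (E FA) ?subsetIl // (E FB) ?subsetIl // -big_split /=; apply: ler_sum => I IF.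
  have [IB tI] := FTP I IF.
  have [[c Ic]|[c Ic]] := large_cover IB tI.
    rewrite (_ : I \in FA); last by rewrite in_setI IF; apply/bigcupP; exists c.
    by rewrite lerDl; case: ifP.
  rewrite (_ : I \in FB); last by rewrite in_setI IF; apply/bigcupP; exists c.
  by rewrite lerDr; case: ifP.
have -> : \sum_(I in bad | t I == T) w I = \sum_(I in FT) w I.
  by apply: eq_bigl => I; rewrite [RHS]in_set.
apply: le_trans cov _; rewrite (_ : 2 * B * Z = B * Z + B * Z); last by ring.
apply: lerD.
  have keyA : (1 + lam) ^+ y * (\sum_(I in FA) w I) <=
      #|{: 'I_(2 * d * T) * dir L * code L (walk_length 0) (4 * u)}|%:R * Z.
    apply: (union_bound (G := rough_family)) => [//||I|c].
    - by rewrite exprn_ge0 // ltW.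
    - by rewrite inE => /andP[_ /bigcupP[c _ Ic]]; exists c.
    apply: (@approx_bound psi (F_ c.1.1 c.2) (S_ c.1.1 c.2) c.1.2).
    - by rewrite (leq_ltn_trans psi_le) // mul2n -addnn -[X in (X < _)%N]addn0 ltn_add2l (leq_trans _ d_gt2).
    - by apply/subsetP => I; rewrite !in_setI => /andP[/andP[/FTP[]]].
    by move=> I; rewrite in_setI => /andP[_]; rewrite inE => /andP[/approxP].
  rewrite 2!card_prod card_ord card_code !card_dir in keyA.
  rewrite -(ler_pM2l (exprn_gt0 y lam1_gt0)); apply: le_trans keyA _.
  by rewrite mulrA [X in _ <= X * _]mulrC ler_wpM2r.
have keyB : (1 + lam) ^+ T * (\sum_(I in FB) w I) <=
    #|{: 'I_(2 * d * T) * code L (walk_length mu) (4 * u)}|%:R * Z.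
  apply: (union_bound (G := exact_family)) => [//||I|c].
  - by rewrite exprn_ge0 // ltW.
  - by rewrite inE => /andP[_ /bigcupP[c _ Ic]]; exists c.
  apply: (@fixed_region_bound (recon (F_ c.1 c.2 :|: Y_ c.1 c.2))).
    by apply/subsetP => I; rewrite !in_setI => /andP[/andP[/FTP[]]].
  move=> I; rewrite in_setI => /andP[]; rewrite in_setI => /andP[/FTP[_ tI] _].
  by rewrite inE => /eqP rI; split=> //; rewrite tI.
rewrite card_prod card_ord card_code !card_dir in keyB.
rewrite -(ler_pM2l (exprn_gt0 T lam1_gt0)); apply: le_trans keyB _.
by rewrite mulrA [X in _ <= X * _]mulrC ler_wpM2r.
Qed.

End Large.

End PeierlsSums.

(** * Arithmetic of the constants *)

Section Arithmetic.
Variables (q d : nat).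
Hypothesis q_large : 1000 <= q.
Hypothesis d_ge : q ^ 160 <= d.
Hypothesis d_le : d <= q ^ 176.
Hypothesis growth : forall m, q <= m -> m ^ 400 <= 2 ^ m.

Lemma q_gt0 : 0 < q. Proof. exact: leq_trans q_large. Qed.

Lemma leq_q a b : a <= b -> q ^ a <= q ^ b.
Proof. by move=> le; rewrite leq_pexp2l ?q_gt0. Qed.

(* Constants up to [1000] are absorbed by one factor [q]. *)
Lemma leq_cq c a b : c <= 1000 -> a < b -> c * q ^ a <= q ^ b.
Proof.
move=> c1 ab; apply: leq_trans (leq_q ab); rewrite expnS leq_mul2r.
by rewrite (leq_trans c1) ?orbT.
Qed.

Lemma q400 : q ^ 400 <= 2 ^ q. Proof. exact: growth. Qed.

Lemma d_gt2_q : 2 < d.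
Proof.
apply: leq_trans d_ge; apply: leq_trans (leq_q (_ : 1 <= 160)) => //.
by rewrite expn1 (leq_trans _ q_large).
Qed.

Lemma dLg_q : 2 * d < 2 ^ q.
Proof.
apply: leq_trans q400; apply: (@leq_trans (3 * q ^ 176)); last exact: leq_cq.
have : 0 < q ^ 176 by rewrite expn_gt0 q_gt0.
move: d_le; move: (q ^ 176) => x; clear; lia.
Qed.

Lemma d4_q : d ^ 4 <= 2 ^ (d %/ 4).
Proof.
have d8 : 8 * q <= d.
  apply: leq_trans d_ge; rewrite -{1}[q]expn1; exact: leq_cq.
pose m := d %/ 4.
have qm : q <= m by rewrite leq_divRL //; apply: leq_trans d8; rewrite mulnC leq_mul2r orbT.
have m1 : 8 <= m by apply: leq_trans qm; apply: leq_trans q_large.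
apply: leq_trans (growth qm); rewrite -/m.
have dm : d <= m ^ 2.
  have := divn_eq d 4; have := ltn_pmod d (isT : 0 < 4).
  rewrite -/m -mulnn; move: m1; move: (m) (d %% 4) => m' r; clear; nia.
apply: (@leq_trans ((m ^ 2) ^ 4)); first by rewrite leq_exp2r.
by rewrite -expnM leq_pexp2l // (leq_trans _ m1).
Qed.

(** The volume is at most [2 ^ (4 * q)], so isoperimetry gives [d * a <= 8 * q * t]. As [d] exceeds
    [8 * q ^ 48], the code costs at most [t / q], and the remaining [(1 - 1 / q) * t] covers [X]. *)
Lemma small_arith X a t w : q * X <= (q - 1) * (2 * d - 1) ->
    w = 2 * a + t -> w <= (2 * d * t) ^ 2 -> t < 2 ^ q -> 2 * d - 1 <= t ->
    (forall n, w <= 2 ^ n -> d * a <= n * w) ->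
  X + q ^ 44 * (4 * q + 8) * a <= t.
Proof.
move=> qX wE w2 tq dt vol.
have w4 : w <= 2 ^ (4 * q).
  apply: leq_trans w2 _; rewrite [4 * q](_ : _ = (q + q) * 2); last by clear; lia.
  rewrite expnM leq_exp2r // expnD; apply: leq_mul; last exact: ltnW.
  exact: ltnW dLg_q.
have d1 := vol _ w4; rewrite wE in d1.
have d16 : 16 * q <= d by apply: leq_trans d_ge; rewrite -{1}[q]expn1; exact: leq_cq.
have d2 : d * a <= 8 * q * t by move: d1 d16; clear; nia.
have e1 : q ^ 44 * (4 * q + 8) <= q ^ 46.
  rewrite (expnD q 44 2) leq_mul2l -mulnn; apply/orP; right.
  by move: q_large; clear; nia.
have e2 : q * (q ^ 46 * a) <= t.
  rewrite -(leq_pmul2l (_ : 0 < 8 * q)); last by rewrite muln_gt0 q_gt0.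
  apply: leq_trans d2; have e : 8 * q ^ 48 <= d by apply: leq_trans d_ge; exact: leq_cq.
  rewrite (_ : _ * _ = 8 * q ^ 48 * a) ?leq_mul2r ?e ?orbT //.
  by rewrite (expnD q 46 2) -mulnn; move: (q ^ 46) => x; clear; lia.
have e3 : q ^ 44 * (4 * q + 8) * a <= q ^ 46 * a by rewrite leq_mul2r e1 orbT.
rewrite -(leq_pmul2l q_gt0) mulnDr.
have e4 : q * (q ^ 44 * (4 * q + 8) * a) <= t by apply: leq_trans e2; rewrite leq_mul2l e3 orbT.
apply: leq_trans (leq_add qX e4) _.
have e5 : (q - 1) * (2 * d - 1) <= (q - 1) * t by rewrite leq_mul2l dt orbT.
rewrite (leq_trans (leq_add e5 (leqnn t))) // -[X in _ + X]mul1n -mulnDl subnK ?q_gt0 //.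
Qed.

Variable T : nat.
Hypothesis T_ge : 2 ^ q <= T.
(** With [psi = q ^ 100], the cover and both greedy sets have size at most [u]. A recorded vertex
    costs about [q ^ 46] in the exponent: [u * q ^ 46] is much smaller than the gain [y], and
    [mu * q ^ 46] much smaller than [T]. The threshold [mu] exceeds the error of order [psi * T / d]
    in the edge count, since [d >= q ^ 160]. *)
Let u := T %/ q ^ 98.
Let mu := T %/ q ^ 50.
Let y := T %/ (2 * q ^ 50).

Lemma T_ge_q : q ^ 400 <= T. Proof. exact: leq_trans q400 T_ge. Qed.

Let qp a : 0 < q ^ a. Proof. by rewrite expn_gt0 q_gt0. Qed.

Lemma boundU_q U : d * U <= 72 * T * q -> U <= u.
Proof.
move=> h; rewrite leq_divRL //.
rewrite -(leq_pmul2r (_ : 0 < 72 * q)); last by rewrite muln_gt0 q_gt0.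
have e : q ^ 98 * (72 * q) <= d.
  apply: leq_trans d_ge; rewrite mulnCA -expnSr; exact: leq_cq.
rewrite -mulnA (leq_trans (leq_mul (leqnn U) e)) // mulnC (leq_trans h) //.
by clear; lia.
Qed.

Lemma boundP1_q U a : d * U <= 72 * T * q ->
  (q ^ 100).+1 * a <= 2 * T + 6 * d * U -> a <= u.
Proof.
move=> h1 h2; rewrite leq_divRL // -(leq_pmul2l (qp 2)).
have e : 434 * q <= q ^ 2 by rewrite -{1}[q]expn1; exact: leq_cq.
have e2 : q ^ 2 * (a * q ^ 98) <= (q ^ 100).+1 * a.
  by rewrite mulnCA -expnD mulnC leq_mul2r leqnSn orbT.
apply: leq_trans e2 (leq_trans h2 _).
apply: (@leq_trans (434 * q * T)); last by rewrite leq_mul2r e orbT.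
move: h1 q_gt0; clear; nia.
Qed.

Lemma boundP2_q a : (q ^ 100).+1 * a <= 2 * T -> a <= u.
Proof.
move=> h2; rewrite leq_divRL // -(leq_pmul2l (qp 2)).
have e : 2 <= q ^ 2 by rewrite -[2]muln1 -[1](expn0 q); exact: leq_cq.
have e2 : q ^ 2 * (a * q ^ 98) <= (q ^ 100).+1 * a.
  by rewrite mulnCA -expnD mulnC leq_mul2r leqnSn orbT.
by apply: leq_trans e2 (leq_trans h2 _); rewrite leq_mul2r e orbT.
Qed.

Lemma psi_le_q : q ^ 100 <= d.
Proof. by apply: leq_trans d_ge; apply: leq_q. Qed.

(** The edge count loses [psi * (Y + st) / (2 * d)] and the averaging [psi * Y / (2 * d)], together
    at most [3 * psi * T / d]. This is at most half of [Y] because [Y > mu], and the other half is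
    at least [y]. *)
Lemma gain_q F S Y st fr :
  2 * d * S <= 2 * d * F + q ^ 100 * (Y + st) -> Y <= 2 * T -> st <= 2 * T ->
  mu < Y -> (2 * d - q ^ 100) * Y <= 2 * d * fr -> S + y <= F + fr.
Proof.
move=> h1 hY hst hmu h2.
have pd := psi_le_q.
have d0 : 0 < d by apply: leq_trans (qp 160) d_ge.
rewrite -(leq_pmul2l (_ : 0 < 2 * d)) ?muln_gt0 //.
have hy : y * (2 * q ^ 50) <= T by apply: leq_trunc_div.
have hm : T <= Y * q ^ 50 by rewrite ltn_divLR // in hmu; apply: ltnW.
have h150 : 6 * q ^ 100 * q ^ 50 <= d.
  by apply: leq_trans d_ge; rewrite -mulnA -expnD; apply: leq_cq.
have h3 : 2 * d * y + 6 * q ^ 100 * T <= 2 * d * Y.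
  rewrite -(leq_pmul2r (qp 50)) mulnDl.
  have a1 : 2 * d * y * q ^ 50 <= d * T.
    by rewrite (_ : _ * _ = d * (y * (2 * q ^ 50))) ?leq_mul2l ?hy ?orbT //; clear; lia.
  have a2 : 6 * q ^ 100 * T * q ^ 50 <= d * T by rewrite mulnAC leq_mul2r h150 orbT.
  have a3 : 2 * (d * T) <= 2 * d * Y * q ^ 50.
    by rewrite -!mulnA !leq_mul2l hm !orbT.
  by apply: leq_trans (leq_add a1 a2) _; rewrite addnn -mul2n.
move: (q ^ 100) h1 h2 h3 pd => psi h1 h2 h3 pd.
have h4 : psi * (2 * Y + st) <= 6 * psi * T.
  rewrite (_ : 6 * psi * T = psi * (6 * T)); last by clear; lia.
  by rewrite leq_mul2l; apply/orP; right; move: hY hst; clear; lia.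
rewrite !mulnDr; rewrite mulnDr in h1; rewrite mulnDr in h4.
have h5 : 2 * d * Y <= 2 * d * fr + psi * Y.
  apply: leq_trans (leq_add h2 (leqnn _)); rewrite -mulnDl leq_mul2r subnK ?leqnn ?orbT //.
  by apply: leq_trans pd _; rewrite leq_pmull.
move: h1 h3 h4 h5; move: (2 * d * S) (2 * d * F) (2 * d * Y) (2 * d * fr) (2 * d * y).
move=> A B C D E; rewrite mulnCA; move: (psi * Y) (psi * st) (6 * psi * T) => p r s.
clear; lia.
Qed.

Let z := (trunc_log 2 T).+1.

Lemma z_bounds : T < 2 ^ z /\ 16 * q ^ 97 * z <= T.
Proof.
have T0 : 0 < T by apply: leq_trans T_ge; rewrite expn_gt0.
split; first exact: trunc_log_ltn.
pose m := trunc_log 2 T.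
have mT : 2 ^ m <= T by apply: trunc_logP.
have qm : q <= m by apply: trunc_log_max.
apply: leq_trans mT; apply: leq_trans (growth qm).
have m1 : 1000 <= m by apply: leq_trans qm.
rewrite /z -/m; apply: (@leq_trans (16 * m ^ 97 * (2 * m))).
  by rewrite leq_mul ?leq_mul2l ?leq_exp2r //; move: m1; clear; lia.
rewrite (_ : _ * _ = 32 * m ^ 98); last by rewrite (expnSr m 97); move: (m ^ 97); clear; lia.
apply: (@leq_trans (m ^ 99)); last by rewrite leq_pexp2l // (leq_trans _ m1).
by rewrite (expnS m 98) leq_mul2r (leq_trans _ m1) ?orbT.
Qed.

Lemma kappa_le m n : n <= 16 + 48 * u + 16 * m ->
  2 * q + 3 * z + 2 + q * n + 4 * n.+1 + 4 * u <= q ^ 2 * (z + u + m).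
Proof.
move=> le; have z0 : 0 < z by [].
have k1 x : 1000 * (q * x) <= q ^ 2 * x by rewrite -mulnn !mulnA !leq_mul2r q_large !orbT.
have k2 x : x <= q * x by rewrite leq_pmull ?q_gt0.
have k3 : q <= q * z by rewrite leq_pmulr.
have k4 : q * n <= 16 * q + 48 * (q * u) + 16 * (q * m).
  by rewrite (leq_trans (leq_mul (leqnn q) le)) //; clear; lia.
rewrite !mulnDr; move: (k1 z) (k1 u) (k1 m) (k2 z) (k2 u) (k2 m) k3 k4 le q_large.
move: (q ^ 2 * z) (q ^ 2 * u) (q ^ 2 * m) (q * z) (q * u) (q * m) (q * n).
move: (z) (u) => z' u'; clear; lia.
Qed.

(** The factor [4 * T * T.+1] reserves room for the later summation over all thicknesses. *)
Lemma codes_le m (n := walk_length u m) :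
  2 * d * T * (2 * d) * codes d u m * (4 * T * T.+1) <=
  2 ^ (2 * q + 3 * z + 2 + q * n + 4 * n.+1 + 4 * u).
Proof.
have [Tz _] := z_bounds; have dq := ltnW dLg_q; rewrite /codes -/n.
apply: (@leq_trans (2 ^ q * 2 ^ z * 2 ^ q * ((2 ^ q) ^ n * 2 ^ (4 * n.+1 + 4 * u)) *
   (2 ^ 2 * 2 ^ z * 2 ^ z))).
  have Tz' := ltnW Tz; do !apply: leq_mul => //.
  by case: (n) => // n'; rewrite leq_exp2r.
rewrite -expnM -!expnD leq_exp2l //.
by move: (q * n) => x; clear; lia.
Qed.

Lemma u_le : u * q ^ 98 <= T. Proof. exact: leq_trunc_div. Qed.

Lemma budget_rough : exists kappa,
  2 * d * T * (2 * d) * codes d u 0 * (4 * T * T.+1) <= 2 ^ kappa /\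
  q ^ 44 * kappa + 2 * d <= y.
Proof.
have [_ zT] := z_bounds.
exists (q ^ 2 * (z + u + 0)); split.
  apply: leq_trans (codes_le 0) _; rewrite leq_exp2l //; apply: kappa_le.
  by rewrite /walk_length; move: (u) => u'; clear; lia.
have p : 0 < 2 * q ^ 50 by rewrite muln_gt0 qp.
rewrite leq_divRL // addn0 (mulnA (q ^ 44)) -(expnD q 44 2).
have h1 : 8 * (2 * q ^ 96 * z) <= T.
  apply: leq_trans zT; rewrite (_ : 8 * _ = 16 * q ^ 96 * z).
    by rewrite leq_mul2r leq_mul2l leq_q ?orbT.
  by move: (q ^ 96) => x; clear; lia.
have h2 : 4 * (2 * q ^ 96 * u) <= T.
  apply: leq_trans u_le; rewrite (_ : 4 * _ = u * (8 * q ^ 96)).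
    by rewrite leq_mul2l leq_cq ?orbT.
  by move: (q ^ 96) (u) => x u'; clear; lia.
have h3 : 4 * (2 * d * (2 * q ^ 50)) <= T.
  apply: leq_trans T_ge_q; apply: (@leq_trans (16 * q ^ 226)); last exact: leq_cq.
  rewrite (expnD q 176 50); move: d_le; move: (q ^ 176) (q ^ 50) => x x'.
  by clear; nia.
rewrite mulnDl.
have -> : q ^ 46 * (z + u) * (2 * q ^ 50) = 2 * q ^ 96 * z + 2 * q ^ 96 * u.
  by rewrite (expnD q 46 50); move: (q ^ 46) (q ^ 50) (u) => x x' u'; clear; lia.
by move: h1 h2 h3; move: (_ * z) (_ * u) (2 * d * _) => a b c; clear; lia.
Qed.

Lemma budget_exact : exists kappa,
  2 * d * T * codes d u mu * (4 * T * T.+1) <= 2 ^ kappa /\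
  q ^ 44 * kappa + 2 * d <= T.
Proof.
have [_ zT] := z_bounds.
have d0 : 0 < 2 * d by rewrite muln_gt0 (leq_trans _ d_gt2_q).
exists (q ^ 2 * (z + u + mu)); split.
  apply: (@leq_trans (2 * d * T * (2 * d) * codes d u mu * (4 * T * T.+1))).
    by rewrite !leq_mul2r leq_pmulr ?orbT.
  apply: leq_trans (codes_le mu) _; rewrite leq_exp2l //; apply: kappa_le.
  by rewrite /walk_length; move: (u) (mu) => u' m'; clear; lia.
rewrite (mulnA (q ^ 44)) -(expnD q 44 2).
have h1 : 4 * (q ^ 46 * z) <= T.
  apply: leq_trans zT; rewrite mulnA leq_mul2r; apply/orP; right.
  by apply: leq_mul => //; apply: leq_q.
have h2 : 4 * (q ^ 46 * u) <= T.
  apply: leq_trans u_le; rewrite mulnA mulnC leq_mul2l leq_cq ?orbT //.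
have h3 : 4 * (q ^ 46 * mu) <= T.
  apply: leq_trans (leq_trunc_div T (q ^ 50)); rewrite mulnA mulnC leq_mul2l leq_cq ?orbT //.
have h4 : 4 * (2 * d) <= T.
  apply: leq_trans T_ge_q; apply: (@leq_trans (8 * q ^ 176)); last exact: leq_cq.
  by move: d_le; move: (q ^ 176) => x; clear; lia.
rewrite !mulnDr; move: h1 h2 h3 h4; move: (_ * z) (_ * u) (_ * mu) (2 * d).
by clear; lia.
Qed.

End Arithmetic.

Section PeierlsBound.
Local Open Scope ring_scope.
Variables (R : realFieldType) (lam : R) (d k : nat) (b : bool) (q : nat).
Local Notation L := (torus_graph d k b).
Variables (v0 : L) (i j : 'I_d) (bdry : pred L).
Hypothesis lam_gt0 : 0 < lam.
Hypothesis ij : i != j.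
Hypothesis par_v0 : par v0.
Hypothesis bdry_par : forall x, bdry x -> ~~ par x.
Hypothesis bdry_nbr : forall (z : L) e, z \notin Lout d k b -> par z ->
  sh e z \in Lout d k b -> bdry (sh e z).
Hypothesis q_large : (1000 <= q)%N.
Hypothesis d_ge : (q ^ 160 <= d)%N.
Hypothesis d_le : (d <= q ^ 176)%N.
Hypothesis growth : forall m, (q <= m -> m ^ 400 <= 2 ^ m)%N.
Hypothesis lamH : 2 <= (1 + lam) ^+ (q ^ 44).
Local Notation w I := (lam ^+ #|I : {set L}|).
Local Notation Z := (\sum_(J in configs bdry) w J).
Local Notation BAD := (bad v0 bdry).

Lemma sum_telescope n : \sum_(1 <= t < n.+1) (1 / (t * t.+1)%N%:R : R) <= 1.
Proof.
suff -> : \sum_(1 <= t < n.+1) (1 / (t * t.+1)%N%:R : R) = 1 - 1 / n.+1%:R.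
  by rewrite lerBlDr lerDl divr_ge0 ?ler0n.
elim: n => [|n IH]; first by rewrite big_geq // divr1 subrr.
rewrite big_nat_recr //= IH natrM.
have n1 : (n.+1%:R : R) != 0 by rewrite pnatr_eq0.
have n2 : (n.+2%:R : R) != 0 by rewrite pnatr_eq0.
rewrite -[n.+2%:R]natr1 in n2 *; move: (n.+1%:R) n1 n2 => x n1 n2.
by field; rewrite n1 n2.
Qed.

(** Only the exponent [2 * d] is kept; the rest of the gain pays for the codes and for the weight
    [1 / (T * T.+1)], whose sum telescopes. *)
Lemma large_thickness T : (2 ^ q <= T)%N ->
  (1 + lam) ^+ (2 * d) * (\sum_(I in BAD | thickness (reg v0 I) == T) w I)
    <= 1 / (T * T.+1)%N%:R * (1 / 2 * Z).
Proof.
move=> TT; have lam1 : 1 <= 1 + lam by rewrite lerDl ltW.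
have lam1_gt0 : 0 < 1 + lam by apply: lt_le_trans lam1.
have T0 : (0 < T)%N by apply: leq_trans TT; rewrite expn_gt0.
pose c : R := (4 * T * T.+1)%N%:R.
have c0 : 0 < c by rewrite ltr0n !muln_gt0 T0.
pose B := ((1 + lam) ^+ (2 * d))^-1 * c^-1.
have e0 : 0 < (1 + lam) ^+ (2 * d) by rewrite exprn_gt0.
have B0 : 0 <= B by rewrite mulr_ge0 // invr_ge0 ltW.
have dig (K kappa e : nat) : (K * (4 * T * T.+1) <= 2 ^ kappa)%N ->
    (q ^ 44 * kappa + 2 * d <= e)%N -> K%:R <= B * (1 + lam) ^+ e.
  move=> h1 h2; rewrite /B -invfM mulrC ler_pdivlMr ?mulr_gt0 //.
  rewrite [_ * c]mulrC mulrA -natrM.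
  apply: (@le_trans _ _ ((2 ^ kappa)%N%:R * (1 + lam) ^+ (2 * d))).
    by rewrite (ler_wpM2r (ltW e0)) // ler_nat.
  apply: (@le_trans _ _ (((1 + lam) ^+ (q ^ 44)) ^+ kappa * (1 + lam) ^+ (2 * d))).
    by rewrite (ler_wpM2r (ltW e0)) // natrX lerXn2r // nnegrE ?ler0n // exprn_ge0 // ltW.
  by rewrite -exprM -exprD ler_weXn2l.
have [k1 [b1 b1']] := budget_rough q_large d_le growth TT.
have [k2 [b2 b2']] := budget_exact q_large d_ge d_le growth TT.
have := @large_sum R lam d k b v0 i j bdry lam_gt0 ij (d_gt2_q q_large d_ge)
  (d4_q q_large d_ge growth) par_v0 bdry_par bdry_nbr q (q ^ 100) T
  (T %/ q ^ 98) (T %/ q ^ 50) (T %/ (2 * q ^ 50))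
  (dLg_q q_large d_le growth) (psi_le_q q_large d_ge)
  (@boundU_q q d q_large d_ge T) (@boundP1_q q d q_large T)
  (@boundP2_q q q_large T) (@gain_q q d q_large d_ge T) B B0
  (dig _ _ _ b1 b1') (dig _ _ _ b2 b2').
move=> le; apply: le_trans (ler_wpM2l (ltW e0) le) _.
rewrite le_eqVlt; apply/orP; left; apply/eqP.
rewrite /B /c -[(4 * T * T.+1)%N]mulnA natrM.
have ne : ((T * T.+1)%N%:R : R) != 0 by rewrite pnatr_eq0 -lt0n muln_gt0 T0.
have pe : (1 + lam) ^+ (2 * d) != 0 by rewrite gt_eqF.
by move: ((T * T.+1)%N%:R) ne ((1 + lam) ^+ (2 * d)) pe => x ne p pe; field; rewrite ne pe.
Qed.

Lemma peierls X : (q * X <= (q - 1) * (2 * d - 1))%N ->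
  (1 + lam) ^+ X * (\sum_(I in BAD) w I) <= Z.
Proof.
move=> qX; have lam1 : 1 <= 1 + lam by rewrite lerDl ltW.
have Z0 : 0 <= Z by apply: sumr_ge0 => J _; rewrite exprn_ge0 // ltW.
have w0 (I : {set L}) : 0 <= w I by rewrite exprn_ge0 // ltW.
have d2 := d_gt2_q q_large d_ge; have d4 := d4_q q_large d_ge growth.
have dq := dLg_q q_large d_le growth.
have X2d : (X <= 2 * d)%N.
  rewrite -(leq_pmul2l (q_gt0 q_large)) (leq_trans qX) //.
  by rewrite leq_mul ?leq_subr.
pose th I := thickness (reg v0 I).
rewrite (bigID (fun I => (th I < 2 ^ q)%N)) /= mulrDr.
have -> : Z = 1 / 2 * Z + 1 / 2 * Z by field.
apply: lerD.
  apply: (@small_sum _ _ _ _ _ v0 i j bdry lam_gt0 ij d2 d4 par_v0 bdry_par bdry_nbr _ _ _ _ lamH (ltnW dq)).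
  move=> I IB lt.
  have [_ cR dR vA _] := bad_facts ij par_v0 bdry_par bdry_nbr IB.
  have D0 : (0 < #|dir L|)%N by rewrite card_dir muln_gt0 (leq_trans _ d2).
  apply: (@small_arith q d q_large d_ge d_le growth X _ _ _ qX (card_W cR D0)) => //.
  - exact: card_region ij cR dR.
  - exact: (thickness_ge ij cR dR vA).
  by move=> n; apply: (small_volume ij cR dR).
apply: (@le_trans _ _ ((1 + lam) ^+ (2 * d) * (\sum_(I in BAD | ~~ (th I < 2 ^ q)%N) w I))).
  by rewrite ler_wpM2r ?sumr_ge0 // ler_weXn2l.
rewrite (partition_big (fun I => inord (th I) : 'I_(#|L|).+1)
  (fun t : 'I_(#|L|).+1 => (2 ^ q <= t)%N)) /=; last first.
  move=> I /andP[_]; rewrite -leqNgt inordK // ltnS.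
  by rewrite (leq_trans (leq_subr _ _)) // max_card.
rewrite mulr_sumr.
apply: (@le_trans _ _ (\sum_(t < #|L|.+1 | (2 ^ q <= t)%N) 1 / (t * t.+1)%N%:R * (1 / 2 * Z))).
  apply: ler_sum => t tq; apply: le_trans (large_thickness tq).
  rewrite le_eqVlt; apply/orP; left; apply/eqP; congr (_ * _).
  apply: eq_bigl => I; rewrite -andbA; congr (_ && _).
  have tI : (th I < #|L|.+1)%N by rewrite ltnS (leq_trans (leq_subr _ _)) // max_card.
  apply/andP/eqP => [[_ /eqP <-]|tt]; first by rewrite inordK.
  have {}tt : th I = t by [].
  by split; [rewrite -leqNgt tt|apply/eqP/val_inj; rewrite /= inordK].
rewrite -mulr_suml -[leRHS]mul1r ler_wpM2r //; first by rewrite mulr_ge0 //; lra.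
apply: le_trans (sum_telescope #|L|).
rewrite [leRHS]big_geq_mkord big_mkcond [leRHS]big_mkcond /=; apply: ler_sum => t _.
have f0 : 0 <= 1 / (t * t.+1)%N%:R :> R by rewrite divr_ge0 ?ler0n.
case: ifP => [tq|_]; last by case: ifP.
by rewrite (leq_trans _ tq) // expn_gt0.
Qed.

End PeierlsBound.

From mathcomp Require Import reals.
From mathcomp Require Import all_boot all_order all_algebra.

Import Order.TTheory GRing.Theory Num.Theory.

Local Open Scope ring_scope.

(** * From the box to the torus *)

Lemma Posz_sum (I : finType) (F : I -> nat) :
  (\sum_i F i)%N%:Z = \sum_i (F i)%:Z.
Proof. exact: (big_morph Posz PoszD (erefl _)). Qed.

Section BoxTorus.
Variables (d k : nat) (side : bool).
Local Notation M := k.+1.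
Local Notation n := k.*2.+4.
Local Notation b := (odd (d * M) (+) side).
Local Notation L := (torus_graph d k b).
Local Notation box := (box d M).
Implicit Types (x y : box) (I : {set box}) (z : L).

Lemma box_bound x i : (absz (x i) <= M)%N.
Proof. exact: leq_trans (leq_bigmax (F := fun i => absz (x i)) i) (box_valP x). Qed.

(** Adding [M] to all [d] coordinates changes the parity of their sum by [d * M], hence the parity
    bit [b] of the torus. *)
Definition iota x : L := ([ffun i => inord (absz (x i + M%:Z))] : torus d k).

Lemma iota_lt x i : (absz (x i + M%:Z)%R <= k.*2.+2)%N.
Proof. by have := box_bound x i; lia. Qed.

Lemma coord_iota x i : tcoord (iota x) i = absz (x i + M%:Z).
Proof. by rewrite /tcoord /iota ffunE inordK // ltnS (leq_trans (iota_lt x i)). Qed.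

Lemma coord_iotaZ x i : (tcoord (iota x) i)%:Z = x i + M%:Z.
Proof. by rewrite coord_iota; have := box_bound x i; lia. Qed.

Lemma box_eq x y : (forall i, x i = y i) -> x = y.
Proof. by move=> E; apply: val_inj; apply/ffunP. Qed.

Lemma iota_inj : injective iota.
Proof.
move=> x y E; apply: box_eq => i.
by have := coord_iotaZ x i; rewrite E coord_iotaZ; lia.
Qed.

Lemma iotaP z : reflect (exists x, z = iota x) [forall i, (tcoord z i <= k.*2.+2)%N].
Proof.
apply: (iffP forallP) => [zP|[x ->] i]; last by rewrite coord_iota iota_lt.
pose f : lattice d := [ffun i => (tcoord z i)%:Z - M%:Z].
have fP : (sup_norm f <= M)%N.
  by apply/bigmax_leqP => i _; rewrite ffunE; have := zP i; lia.
exists (Box fP); apply: coord_inj => i.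
by rewrite coord_iota ffunE subrK.
Qed.

Lemma adj_iota x y : box_adj x y = [exists e : dir L, sh e (iota x) == iota y].
Proof.
rewrite /box_adj /lattice_adj.
have -> : \sum_(i < d) `|x i - y i| = (\sum_(i < d) absz (x i - y i))%N%:Z.
  by rewrite Posz_sum; apply: eq_bigr => i _; rewrite abszE.
apply/eqP/existsP => [[s1]|[[i c] /eqP E]].
  have /existsP[i xi] : [exists i, absz (x i - y i) != 0%N].
    apply: contra_eqT s1; rewrite negb_exists => /forallP zero.
    by rewrite big1 // => i _; have := zero i; rewrite negbK => /eqP.
  move: s1; rewrite (bigD1 i) //=; set r := (\sum_(j < d | _) _)%N => s1.
  have r0 : r = 0%N by lia.
  have xj j : j != i -> x j = y j.
    move=> ji; move/eqP: r0; rewrite sum_nat_eq0 => /forallP/(_ j)/implyP/(_ ji); lia.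
  exists (i, (x i < y i)%R); apply/eqP/coord_inj => j; rewrite coord_sh /=.
  have cx := coord_iotaZ x i; have cy := coord_iotaZ y i.
  have bx := box_bound x i; have by' := box_bound y i.
  case: eqP => [->|/eqP ji]; last first.
    by have := coord_iotaZ x j; have := coord_iotaZ y j; rewrite (xj j ji); lia.
  case: ltrP => lt; case: eqP; lia.
have cj j : tcoord (sh ((i, c) : dir L) (iota x)) j = tcoord (iota y) j by rewrite E.
have diff j : absz (x j - y j) = (j == i).
  have := cj j; rewrite coord_sh /=; have := coord_iotaZ x j; have := coord_iotaZ y j.
  have := box_bound x j; have := box_bound y j.
  by case: (j == i); [case: (c); case: eqP|]; lia.
rewrite (eq_bigr (fun j => (j == i) : nat)) => [|j _]; last exact: diff.
by rewrite (bigD1 i) //= eqxx big1 // => j /negbTE ->.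
Qed.

Lemma par_iota x : par (iota x) = odd_vertex x (+) side.
Proof.
rewrite /par /= /tpar.
have -> : (\sum_j (iota x : torus d k) j = \sum_j tcoord (iota x) j)%N by [].
have E : (\sum_j tcoord (iota x) j)%N%:Z = \sum_(i < d) x i + (d * M)%N%:Z.
  rewrite Posz_sum (eq_bigr (fun i => x i + M%:Z)) => [|i _]; last exact: coord_iotaZ.
  by rewrite big_split /= sumr_const card_ord PoszM -mulr_natl natz.
rewrite addbA; congr (_ (+) _); rewrite /odd_vertex /even_vertex.
have -> : \sum_(i < d) x i = (\sum_j tcoord (iota x) j)%N%:Z - (d * M)%N%:Z.
  by rewrite E addrK.
move: (\sum_j tcoord (iota x) j)%N => s; move: (d * M)%N => t.
rewrite dvdzE; lia.
Qed.

Variables (i0 j0 : 'I_d).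
Hypothesis ij0 : i0 != j0.

Lemma boundary_Lout x : (x \in boundary d M) = (iota x \in Lout d k b).
Proof.
rewrite inE; apply/eqP/LoutP => [sM|[i]].
  have [|i xi] := bigop.eq_bigmax (fun i => absz (x i)); first by apply/card_gt0P; exists i0.
  exists i; have := coord_iotaZ x i; move: xi; rewrite -/(sup_norm x) sM /extreme; lia.
rewrite /extreme => ext; apply/eqP; rewrite eqn_leq box_valP /=.
apply: leq_trans (leq_bigmax (F := fun i => absz (x i)) i).
have := coord_iotaZ x i; have := box_bound x i; lia.
Qed.

Lemma boundary_neighbour x : x \in boundary d M ->
  exists2 y, y \in boundary d M & exists e : dir L, sh e (iota x) = iota y.
Proof.
rewrite boundary_Lout => /LoutP[i xi].
have [j ji] : exists j, j != i.
  by case: (eqVneq i0 i) => [<-|]; [exists j0; rewrite eq_sym|exists i0].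
pose e : dir L := (j, (tcoord (iota x) j < k.*2.+2)%N).
have lt l : (tcoord (sh e (iota x)) l <= k.*2.+2)%N.
  rewrite coord_sh /=; case: eqP => [->|_]; last by rewrite coord_iota iota_lt.
  have := coord_iota x j; have := iota_lt x j.
  by case: ltnP; case: eqP; lia.
have /iotaP[y ey] : [forall l, (tcoord (sh e (iota x)) l <= k.*2.+2)%N] by apply/forallP.
exists y; last by exists e.
rewrite boundary_Lout -ey; apply/LoutP; exists i.
by rewrite coord_sh eq_sym (negbTE ji).
Qed.

Definition bdry z := ~~ par z && [exists x in boundary d M, iota x == z].
Definition side_boundary : {set box} := boundary d M :&: [set x | ~~ par (iota x)].

Lemma bdry_iota x : bdry (iota x) = (x \in side_boundary).
Proof.
rewrite /bdry !inE andbC; congr (_ && _).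
apply/exists_inP/idP => [[y yB /eqP/iota_inj <-]|xB]; first by move: yB; rewrite inE.
by exists x; rewrite ?inE.
Qed.

Lemma bdry_par z : bdry z -> ~~ par z. Proof. by case/andP. Qed.

Lemma bdry_nbr z (e : dir L) : z \notin Lout d k b -> par z ->
  sh e z \in Lout d k b -> bdry (sh e z).
Proof.
move=> zL pz eL; rewrite /bdry par_sh pz /=.
have inn l : ~~ extreme k (tcoord z l) by apply: contraNN zL => h; apply/LoutP; exists l.
have /iotaP[y ey] : [forall l, (tcoord (sh e z) l <= k.*2.+2)%N].
  apply/forallP => l; have := inn l; rewrite /extreme negb_or -ltnNge => /andP[/eqP z0 zl].
  rewrite coord_sh; case: (l == e.1); last exact: ltnW.
  by case: e.2; case: eqP => // _; apply: leq_trans (leq_pred _) (ltnW zl).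
by apply/exists_inP; exists y; rewrite ?ey // boundary_Lout -ey.
Qed.

Lemma independent_iota I : independent (@box_adj d M) I <-> indep (iota @: I).
Proof.
split=> [/forall_inP ind z e /imsetP[x xI ->]|ind].
  apply/imsetP => -[y yI E]; have /forall_inP/(_ y yI) := ind x xI.
  by rewrite adj_iota => /existsP[]; exists e; rewrite E.
apply/forall_inP => x xI; apply/forall_inP => y yI; rewrite adj_iota.
apply/existsP => -[e /eqP E]; have := ind (iota x) e (imset_f _ xI).
by rewrite E imset_f.
Qed.

Definition box_configs : {set {set box}} :=
  [set I | independent (@box_adj d M) I && (side_boundary \subset I)].

(** Conditioning fixes the whole configuration on [Lout]: the additional layer is empty, and a
    boundary vertex of the parity of [v0] has a boundary neighbour of the other parity, which is
    occupied. *)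
Lemma configs_box : configs bdry = [set iota @: (I : {set box}) | I in box_configs].
Proof.
apply/setP => J; apply/configsP/imsetP => [[iJ bJ]|[I + ->]].
  pose I := iota @^-1: J.
  have JI : J = iota @: I.
    apply/setP => z; apply/idP/imsetP => [zJ|[x xI ->]]; last by rewrite inE in xI.
    have /iotaP[x zx] : [forall l, (tcoord z l <= k.*2.+2)%N].
      apply/forallP => l; apply: contraT; rewrite -ltnNge => lt.
      have : bdry z by rewrite -bJ //; apply/LoutP; exists l; rewrite /extreme; lia.
      case/andP=> _ /exists_inP[x _ /eqP zx]; move: lt.
      by rewrite -zx coord_iota; have := iota_lt x l; lia.
    by exists x => //; rewrite inE -zx.
  exists I => //; rewrite inE; apply/andP; split.
    by apply/independent_iota; rewrite -JI.
  apply/subsetP => x; rewrite -bdry_iota => bx; rewrite inE bJ //.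
  by rewrite -boundary_Lout; move: bx; rewrite bdry_iota inE => /andP[].
rewrite inE => /andP[/independent_iota iI /subsetP BI]; split=> // z zL.
case: (boolP [forall l, (tcoord z l <= k.*2.+2)%N]) => [/iotaP[x zx]|zn]; last first.
  have ni x : z != iota x by apply: contraNneq zn => zx; apply/iotaP; exists x.
  transitivity false.
    by apply/negbTE/imsetP => -[x _ zx]; have := ni x; rewrite zx eqxx.
  apply/esym/negbTE; rewrite negb_and negbK; apply/orP; right.
  by apply/exists_inP => -[x _ /eqP zx]; have := ni x; rewrite zx eqxx.
rewrite {}zx in zL *; rewrite -boundary_Lout in zL.
rewrite (mem_imset _ _ iota_inj) bdry_iota; apply/idP/idP => [xI|/BI //].
rewrite inE zL inE /=; apply/negP => px.
have [y yB [e E]] := boundary_neighbour zL.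
have yI : y \in I by apply: BI; rewrite inE yB inE -E par_sh px.
by have := iI _ e (imset_f iota xI); rewrite E imset_f.
Qed.

Lemma imset_iota_inj : injective (fun I : {set box} => iota @: I).
Proof. exact: imset_inj iota_inj. Qed.

Lemma sum_configs (R : realFieldType) (lam : R) :
  \sum_(J in configs bdry) lam ^+ #|J| = \sum_(I in box_configs) lam ^+ #|I|.
Proof.
rewrite configs_box big_imset /=; last by move=> I J _ _; apply: imset_iota_inj.
by apply: eq_bigr => I _; rewrite card_imset //; apply: iota_inj.
Qed.

Lemma sum_bad (R : realFieldType) (lam : R) v0 :
  \sum_(J in bad (iota v0) bdry) lam ^+ #|J| = \sum_(I in box_configs | v0 \in I) lam ^+ #|I|.
Proof.
have -> : bad (iota v0) bdry = [set iota @: (I : {set box}) | I in [set I in box_configs | v0 \in I]].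
  apply/setP => J; rewrite inE configs_box; apply/andP/imsetP => [[/imsetP[I IB ->]]|[I]].
    by rewrite (mem_imset _ _ iota_inj) => vI; exists I; rewrite // inE IB.
  rewrite inE => /andP[IB vI] ->; split; last exact: imset_f.
  by apply/imsetP; exists I.
rewrite big_imset /=; last by move=> I J _ _; apply: imset_iota_inj.
apply: eq_big => [I|I _]; first by rewrite inE.
by rewrite card_imset //; apply: iota_inj.
Qed.

End BoxTorus.

Section BoxPeierls.
Variables (R : realType) (lam : R) (d k q : nat) (side : bool).
Local Notation M := k.+1.
Local Notation b := (odd (d * M) (+) side).
Hypothesis lam_gt0 : 0 < lam.
Hypothesis q_large : (1000 <= q)%N.
Hypothesis d_ge : (q ^ 160 <= d)%N.
Hypothesis d_le : (d <= q ^ 176)%N.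
Hypothesis growth : forall m, (q <= m -> m ^ 400 <= 2 ^ m)%N.
Hypothesis lamH : 2 <= (1 + lam) ^+ (q ^ 44).

Lemma hc_prob_sum (T : finType) (e : rel T) (A : {set {set T}}) :
  hc_prob e lam A =
  (\sum_(I in [set I in A | independent e I]) lam ^+ #|I|) / hc_partition e lam.
Proof.
rewrite /hc_prob mulr_suml big_mkcond [RHS]big_mkcond; apply: eq_bigr => I _.
by rewrite /hc_mass inE; case: (I \in A); case: (independent e I).
Qed.

Lemma box_peierls (v0 : box d M) X : (q * X <= (q - 1) * (2 * d - 1))%N ->
    odd_vertex v0 (+) side ->
  hc_cond_prob (@box_adj d M) lam (occupied v0)
    (contains (boundary d M :&: [set x : box d M | ~~ (odd_vertex x (+) side)]))
   <= (1 + lam) ^- X.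
Proof.
move=> qX pv; have d2 := d_gt2_q q_large d_ge.
have [i [j ij]] : exists i j : 'I_d, i != j.
  by exists (Ordinal (ltnW (ltnW d2))), (Ordinal (ltnW d2)).
set B := contains _; have SB : B = contains (side_boundary d k side).
  rewrite /B /side_boundary; congr (contains (_ :&: _)).
  by apply/setP => x; rewrite !inE par_iota.
have lam1 : 0 < 1 + lam by rewrite addr_gt0.
have P0 : 0 < hc_partition (@box_adj d M) lam.
  rewrite /hc_partition (bigD1 set0) /=; last by apply/forall_inP => x; rewrite inE.
  by rewrite cards0 expr0 ltr_pwDl // sumr_ge0 // => I _; rewrite exprn_ge0 // ltW.
have := @peierls R lam d k b q (iota side v0) i j (@bdry d k side) lam_gt0 ij
  (etrans (par_iota side v0) pv) (@bdry_par d k side) (@bdry_nbr d k side i j ij) q_large d_ge d_le growth lamH X qX.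
rewrite (sum_configs k side ij) (sum_bad side ij) => key.
rewrite /hc_cond_prob !hc_prob_sum.
set N := \sum_(I in box_configs _ _ _ | _) _ in key.
set Dn := \sum_(I in box_configs _ _ _) _ in key.
have -> : \sum_(I in [set I in B | independent (@box_adj d M) I]) lam ^+ #|I| = Dn.
  by apply: eq_bigl => I; rewrite SB !inE andbC.
have -> : \sum_(I in [set I in occupied v0 :&: B | independent (@box_adj d M) I]) lam ^+ #|I| = N.
  by apply: eq_bigl => I; rewrite SB !inE -andbA andbC [X in X && _]andbC.
rewrite invf_div mulrA divfK ?gt_eqF //.
(* If the denominator vanishes, the quotient is [0] by the convention for inverses. *)
have [Dn0|Dn0] := eqVneq Dn 0.
  by rewrite Dn0 invr0 mulr0 invr_ge0 exprn_ge0 // ltW.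
have DnP : 0 < Dn by rewrite lt_neqAle eq_sym Dn0 sumr_ge0 // => I _; rewrite exprn_ge0 // ltW.
by rewrite ler_pdivrMr // ler_pdivlMl // exprn_gt0.
Qed.

End BoxPeierls.

From mathcomp Require Import all_classical all_reals all_analysis.

Import Order.TTheory GRing.Theory Num.Theory.
Import numFieldNormedType.Exports.

Local Open Scope classical_set_scope.
Local Open Scope ring_scope.

(** * Asymptotics *)

Lemma leq_exp2_large c m : (0 < c)%N -> (4 * c * c <= m)%N -> (m ^ c <= 2 ^ m)%N.
Proof.
move=> c0 cm; set j := (m %/ (2 * c))%N.
have c2 : (0 < 2 * c)%N by rewrite muln_gt0.
have jm : (2 * c * j <= m)%N by rewrite mulnC leq_trunc_div.
have mj : (m < 2 * c * j.+1)%N by rewrite mulnC ltn_ceil.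
have cj : (2 * c <= j)%N by rewrite leq_divRL //; move: cm; clear; lia.
have le1 : (m <= 2 ^ (2 * j))%N.
  apply: leq_trans (ltnW mj) _; rewrite [(2 * j)%N]mul2n -addnn expnD leq_mul //.
    exact: leq_trans cj (ltnW (ltn_expl j (ltnSn 1))).
  by apply: ltn_expl.
apply: (@leq_trans ((2 ^ (2 * j)) ^ c)); first by rewrite leq_exp2r.
by rewrite -expnM leq_exp2l //; move: jm; clear; lia.
Qed.

Lemma power_growth : exists Q, forall m, (Q <= m -> m ^ 400 <= 2 ^ m)%N.
Proof. by exists (4 * 400 * 400)%N => m; apply: leq_exp2_large. Qed.

(** The integer part of the 160th root of [d]. *)
Definition root160 d := (\max_(m < d.+1 | m ^ 160 <= d) m)%N.

Lemma root160_le d : (root160 d ^ 160 <= d)%N.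
Proof.
rewrite /root160; elim/big_ind: _ => // x y hx hy.
by rewrite /maxn; case: ifP.
Qed.

Lemma root160_ge d Q : (Q ^ 160 <= d)%N -> (Q <= root160 d)%N.
Proof.
move=> Qd; have lt : (Q < d.+1)%N.
  rewrite ltnS (leq_trans _ Qd) //; case: Q {Qd} => // Q.
  by rewrite -[leqLHS]expn1 leq_pexp2l.
exact: (leq_bigmax_cond (F := fun m : 'I_d.+1 => m : nat) (Ordinal lt) Qd).
Qed.

(** Rounding costs at most [2 ^ 160], which is absorbed by [q ^ 16] once [q >= 2 ^ 10]. The exponent
    [176] is divisible by four, whence [q ^ 44 >= d ^ (1 / 4)]. *)
Lemma root160_upper d : (1024 <= root160 d)%N -> (d <= root160 d ^ 176)%N.
Proof.
set q := root160 d => q1024.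
have q0 : (0 < q)%N by rewrite (leq_trans _ q1024).
have : (d < q.+1 ^ 160)%N by rewrite ltnNge; apply/negP => /root160_ge; rewrite ltnn.
move=> /ltnW/leq_trans; apply.
apply: (@leq_trans ((2 * q) ^ 160)); first by rewrite leq_exp2r //; move: q0; clear; lia.
rewrite expnMn (_ : 176 = 16 + 160)%N // expnD leq_mul2r; apply/orP; right.
by rewrite (_ : 160 = 10 * 16)%N // expnM leq_exp2r.
Qed.

Section RealEstimates.
Variable R : realType.
Implicit Types a x y : R.

Lemma gt1_ltr_powR a x y : 1 < a -> x < y -> a `^ x < a `^ y.
Proof.
move=> a1 xy; have a0 : a != 0 by rewrite gt_eqF // (lt_trans ltr01).
by rewrite /powR (negbTE a0) ltr_expR ltr_pM2r // ln_gt0.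
Qed.

Lemma bernoulli_ineq x m : 0 <= x -> 1 + m%:R * x <= (1 + x) ^+ m.
Proof.
move=> x0; elim: m => [|m IH]; first by rewrite mul0r addr0 expr0.
rewrite exprSr; apply: le_trans (ler_wpM2r _ IH); last by rewrite addr_ge0.
have m0 : 0 <= m%:R :> R by [].
by rewrite -natr1; nra.
Qed.

(** By Bernoulli the power is at least [1 + q ^ 44 * lam], and [q ^ 44] dominates [d ^ (1 / 4)]; the
    power of the logarithm is at most one. *)
Lemma activity_bound (lam : R) d q : 0 < lam -> 1 <= ln (d%:R : R) -> (d <= q ^ 176)%N ->
    1 <= lam * d%:R `^ (1 / 4) * (ln (d%:R : R)) `^ (- (3 / 4)) ->
  2 <= (1 + lam) ^+ (q ^ 44).
Proof.
move=> lam0 ln1 dq big.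
apply: le_trans (bernoulli_ineq _ (ltW lam0)).
rewrite -lerBlDl [2 - 1](_ : _ = 1); last by ring.
rewrite mulrC; apply: le_trans big _.
apply: (@le_trans _ _ (lam * d%:R `^ (1 / 4))).
  rewrite ler_piMr ?mulr_ge0 ?powR_ge0 ?(ltW lam0) // powRN invf_le1.
    by rewrite -[leLHS](powRr0 (ln d%:R)) ler_powR //; lra.
  by rewrite powR_gt0 // (lt_le_trans ltr01).
rewrite ler_pM2l //.
have -> : (q ^ 44)%:R = ((q ^ 176)%N%:R : R) `^ (1 / 4).
  rewrite !natrX -[176%N]/(44 * 4)%N exprM -[X in X `^ _]powR_mulrn ?exprn_ge0 // -powRrM.
  by rewrite [4 * (1 / 4)](_ : _ = 1) ?powRr1 ?exprn_ge0 //; field.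
by rewrite ge0_ler_powR ?nnegrE ?ler_nat //; lra.
Qed.

(** The [4] collects the loss [2 * d / q] from the factor [q - 1] and, using [q <= d], the losses
    from [2 * d - 1] and from the integer quotient. The estimate is strict, which gives the strict
    inequality of the theorem. *)
Lemma exponent_bound a d q : 1 < a -> (0 < q <= d)%N ->
  a ^- ((q - 1) * (2 * d - 1) %/ q)%N < a `^ (- ((2 - 4 / q%:R) * d%:R)).
Proof.
move=> a1 /andP[q0 qd]; set X := (_ %/ q)%N.
have a0 : 0 <= a by rewrite (le_trans ler01) // ltW.
rewrite -powR_mulrn // -powRN gt1_ltr_powR // ltrN2.
have : (2 * q * d < q * X + 4 * d)%N.
  have := ltn_ceil ((q - 1) * (2 * d - 1)) q0; rewrite -/X.
  by move: qd q0; clear; nia.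
rewrite -(ltr_nat R) natrD !natrM => lt.
have q0R : 0 < q%:R :> R by rewrite ltr0n.
rewrite -(ltr_pM2l q0R).
have -> : q%:R * ((2 - 4 / q%:R) * d%:R) = 2 * q%:R * d%:R - 4 * d%:R :> R.
  by field; rewrite gt_eqF.
by rewrite ltrBlDr.
Qed.

Lemma cvg_scale : (fun d => 4 / (root160 d)%:R) @ \oo --> (0 : R).
Proof.
apply/cvgrPdist_le => e e0; have [Q eQ] : exists Q, 4 / e < Q%:R.
  by exists (Num.bound (4 / e)); apply: archi_boundP; rewrite divr_ge0 // ltW.
exists (Q ^ 160)%N => // d /= /root160_ge Qd.
rewrite sub0r normrN ger0_norm ?divr_ge0 //.
have q0 : 0 < (root160 d)%:R :> R.
  by rewrite (lt_le_trans _ (_ : Q%:R <= _)) ?ler_nat // (lt_trans _ eQ) ?divr_gt0.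
rewrite ler_pdivrMr // -ler_pdivrMl // mulrC (le_trans (ltW eQ)) // ler_nat //.
Qed.

End RealEstimates.

Theorem theorem1p2 (R : realType) (lam : nat -> R)
  (lam_gt0 : forall d : nat, (0 < d)%N -> 0 < lam d)
  (lam_large :
     (fun d : nat => lam d * d%:R `^ (1 / 4) * (ln d%:R) `^ (- (3 / 4)))
       @ \oo --> +oo) :
  exists2 eps : nat -> R, eps @ \oo --> (0 : R) &
    \forall d \near \oo, forall M : nat, (0 < M)%N ->
      (forall v0 : box d M, odd_vertex v0 ->
         mu_even (lam d) (occupied v0)
           < (1 + lam d) `^ (- ((2 - eps d) * d%:R))) /\
      (forall v0 : box d M, even_vertex v0 ->
         mu_odd (lam d) (occupied v0)
           < (1 + lam d) `^ (- ((2 - eps d) * d%:R))).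
Proof.
exists (fun d => 4 / (root160 d)%:R); first exact: cvg_scale.
have [Q growth] := power_growth.
(* Beyond [N] the logarithm of [d] is at least one, as [activity_bound] requires. *)
have [N eN] : exists N, expR 1 < N%:R :> R.
  by exists (Num.bound (expR 1 : R)); apply: archi_boundP; rewrite expR_ge0.
move/cvgryPge : lam_large => /(_ 1) lam_large.
near=> d => -[//|k] _; set q := root160 d.
have qQ : (Q <= q)%N by apply: root160_ge; near: d; apply: nbhs_infty_ge.
have q1024 : (1024 <= q)%N by apply: root160_ge; near: d; apply: nbhs_infty_ge.
have dN : (N <= d)%N by near: d; apply: nbhs_infty_ge.
have lam1 : 1 <= lam d * d%:R `^ (1 / 4) * (ln d%:R) `^ (- (3 / 4)).
  by near: d.
have q_le := root160_le d; rewrite -/q in q_le.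
have q0 : (0 < q)%N by apply: leq_trans q1024.
have qd : (q <= d)%N.
  by apply: leq_trans q_le; rewrite -[leqLHS]expn1 leq_pexp2l.
have d0 : (0 < d)%N by apply: leq_trans qd.
have ln1 : 1 <= ln d%:R :> R.
  rewrite -[leLHS]expRK ler_ln ?posrE ?expR_gt0 ?ltr0n //.
  by rewrite (le_trans (ltW eN)) // ler_nat.
have d_le := root160_upper q1024; rewrite -/q in d_le.
have l0 := lam_gt0 d d0.
have lamH := activity_bound l0 ln1 d_le lam1.
have grow m : (q <= m -> m ^ 400 <= 2 ^ m)%N by move=> qm; apply: growth; apply: leq_trans qm.
have q1000 : (1000 <= q)%N by apply: leq_trans q1024.
have lt : (1 + lam d) ^- ((q - 1) * (2 * d - 1) %/ q)%N < (1 + lam d) `^ (- ((2 - 4 / q%:R) * d%:R)).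
  by apply: exponent_bound; rewrite ?ltrDl ?q0.
have qX : (q * ((q - 1) * (2 * d - 1) %/ q) <= (q - 1) * (2 * d - 1))%N by rewrite mulnC leq_trunc_div.
split=> v0 pv; apply: le_lt_trans lt.
  have := @box_peierls R (lam d) d k q false l0 q1000 q_le d_le grow lamH v0 _ qX.
  rewrite addbF => /(_ pv); congr (hc_cond_prob _ _ _ (contains (_ :&: _)) <= _).
  by apply/setP => x; rewrite !inE addbF negbK.
have := @box_peierls R (lam d) d k q true l0 q1000 q_le d_le grow lamH v0 _ qX.
rewrite addbT negbK => /(_ pv); congr (hc_cond_prob _ _ _ (contains (_ :&: _)) <= _).
by apply/setP => x; rewrite !inE addbT negbK.
Unshelve. all: by end_near.
Qed.
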